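(* Let $d\ge1$, let $\Omega\subseteq\mathbb{R}^d$ be a non-empty open connected set, and let $a,b:\Omega\to\mathbb{R}$ satisfy $a,b\in L^1_{\mathrm{loc}}(\Omega)$ together with (a) $a_{\min}:=\operatorname{ess\,inf}a>-\infty$; (b) $b=b_1+b_2$, where $b_1\in L^1_{\mathrm{loc}}(\Omega)$, $b_{1,\min}:=\operatorname{ess\,inf}b_1>-\infty$, and $b_2\in L^p(\Omega)$ for some $p\in[d,\infty]$. For $\mu\ge0$ let $\gamma_n(\mu)$, $n\in\{1,2,\dots\}$, be the Rayleigh–Ritz (min-max) values of the Dirichlet realization of $-\Delta+b+\mu a$ in $L^2(\Omega)$. Then for every $n\in\{1,2,\dots\}$, $$\lim_{\mu\to+\infty}\frac{\gamma_n(\mu)}{\mu}=a_{\min}.$$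
   Context: $(\cdot,\cdot)$ and $\|\cdot\|$ denote the inner product and norm of the complex Hilbert space $L^2(\Omega)$. For $\mu\ge 0$, $D(s_\mu)$ is the closure of $C_0^\infty(\Omega)$ in the norm $$\|\psi\|_{s_\mu}^2:=\|\psi\|_{H^1(\Omega)}^2+\big\|[\mu(a-a_{\min})+b_1-b_{1,\min}+b_2^+]^{1/2}\psi\big\|^2,$$ where $b_2^+$ is the positive part of $b_2$ and $\|\psi\|_{H^1(\Omega)}^2=\|\nabla\psi\|^2+\|\psi\|^2$; the form is $s_\mu(\phi,\psi):=(\nabla\phi,\nabla\psi)+\mu(\phi,a\psi)+(\phi,b\psi)$ on $D(s_\mu)$, with $s_\mu[\psi]:=s_\mu(\psi,\psi)$. This form is densely defined, closed, symmetric and bounded from below, and the Dirichlet realization $S_\mu$ of $-\Delta+b+\mu a$ is the associated self-adjoint operator. The min-max values are $$\gamma_n(\mu):=\inf\Big\{\sup_{\psi\in L\setminus\{0\}}\frac{s_\mu[\psi]}{\|\psi\|^2}: L\subseteq D(s_\mu)\text{ a subspace},\ \dim L=n\Big\}.$$ *)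

(* Defs.v *)
From HB Require Import structures.
From mathcomp Require Import all_boot all_order all_algebra.
From mathcomp Require Import complex.
From mathcomp Require Import all_classical all_reals all_analysis.
From mathcomp Require Import measurable_realfun ess_sup_inf.
From mathcomp Require Import lra.

Set Implicit Arguments.
Unset Strict Implicit.
Unset Printing Implicit Defensive.

Import Order.TTheory GRing.Theory Num.Theory.
Import numFieldNormedType.Exports.

Local Open Scope classical_set_scope.
Local Open Scope ring_scope.

(* R^n is 'rV[R]_n with its Borel sigma-algebra; Lebesgue measure on it is the
   iterated product of the one-dimensional Lebesgue measure. *)

Definition rV_display : measure_display. Proof. exact. Qed.

Section borel_rV.
Context {R : realType} {n : nat}.

Let B : set (set 'rV[R]_n) := <<s @open 'rV[R]_n >>.

Let B0 : B set0. Proof. exact: sigma_algebra0. Qed.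
Let BC A : B A -> B (~` A). Proof. exact: sigma_algebraC. Qed.
Let BU (F : (set 'rV[R]_n)^nat) : (forall i, B (F i)) -> B (\bigcup_i F i).
Proof. exact: sigma_algebra_bigcup. Qed.

HB.instance Definition _ :=
  @isMeasurable.Build rV_display 'rV[R]_n B B0 BC BU.

Lemma open_measurable_rV (U : set 'rV[R]_n) : open U -> measurable U.
Proof. exact: sub_sigma_algebra. Qed.

End borel_rV.

Section cons_rV.
Context {R : realType} {n : nat}.

Definition cons_rV (u : R * 'rV[R]_n) : 'rV[R]_n.+1 :=
  row_mx (const_mx u.1 : 'rV_1) u.2.

Definition uncons_rV (v : 'rV[R]_n.+1) : R * 'rV[R]_n :=
  (v ord0 ord0, @rsubmx R 1 1 n v).

Lemma cons_rVK : cancel cons_rV uncons_rV.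
Proof.
move=> [x v]; rewrite /uncons_rV /cons_rV row_mxKr; congr pair.
by rewrite mxE; case: splitP => // k _; rewrite mxE.
Qed.

Lemma uncons_rVK : cancel uncons_rV cons_rV.
Proof.
move=> v; rewrite /uncons_rV /cons_rV/=.
have -> : const_mx (v ord0 ord0) = @lsubmx R 1 1 n v.
  apply/matrixP => i j; rewrite !mxE !ord1.
  by congr (v _ _); apply/val_inj.
exact: (@hsubmxK R 1 1 n v).
Qed.

Lemma near_cons_rV (U : set 'rV[R]_n.+1) u : open U -> U (cons_rV u) ->
  exists2 e : R, 0 < e &
    forall v, ball u.1 e v.1 -> ball u.2 e v.2 -> U (cons_rV v).
Proof.
rewrite openE => /(_ _)/[apply]; rewrite /interior -nbhs_ballE => -[e/= e0 eU].
exists e => // v b1 b2; apply: eU; split=> //= i j.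
rewrite !mxE; case: splitP => k _; first by rewrite !mxE.
by case: b2 => _; exact.
Qed.

Lemma rat_near_rV (x : 'rV[R]_n) (e : R) : 0 < e ->
  exists q : 'rV[rat]_n, ball (map_mx ratr q : 'rV[R]_n) e x.
Proof.
move=> e0.
have h (i : 'I_n) : exists q : rat, `|ratr q - x ord0 i| < e.
  have : x ord0 i - e < x ord0 i + e by lra.
  move=> /rat_in_itvoo[q]; rewrite in_itv/= => /andP[q1 q2].
  by exists q; rewrite ltr_distl q1 q2.
have [q qP] := choice h.
exists (\row_i q i); split => // i j; rewrite !mxE (ord1 i).
exact: qP.
Qed.

Lemma measurable_cons_rV : measurable_fun [set: R * 'rV[R]_n] cons_rV.
Proof.
apply: (@measurability _ _ _ _ _ _ (@open 'rV[R]_n.+1)) => //.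
move=> _ [U oU <-]; rewrite setTI.
pose box (t : rat * 'rV[rat]_n * nat) : set (R * 'rV[R]_n) :=
  ball (ratr t.1.1 : R) t.2.+1%:R^-1 `*`
  ball (map_mx ratr t.1.2 : 'rV[R]_n) t.2.+1%:R^-1.
have mbox t : measurable (box t).
  apply: measurableX; first exact: measurable_ball.
  by apply: open_measurable_rV; exact: ball_open.
pose P := [set t | box t `<=` cons_rV @^-1` U].
suff -> : cons_rV @^-1` U =
    \bigcup_t (if t \in P then box t else set0).
  by apply: countable_bigcupT_measurable => // t; case: ifP.
apply/seteqP; split=> [u Uu|u [t _]]; last by case: ifPn => // /set_mem/[apply].
have [e e0 eU] := near_cons_rV oU Uu.
have [k ke] : exists k : nat, k.+1%:R^-1 < e / 2.
  exists (Num.truncn (e / 2)^-1).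
  rewrite invf_plt ?posrE ?divr_gt0 ?ltr0n//.
  exact: truncnS_gt.
have k0 : (0 : R) < k.+1%:R^-1 by rewrite invr_gt0 ltr0n.
have [q1 q1P] : exists q1 : rat, ball (ratr q1 : R) k.+1%:R^-1 u.1.
  have : u.1 - k.+1%:R^-1 < u.1 + k.+1%:R^-1.
    by rewrite ltrBlDr -addrA ltrDl addr_gt0.
  move=> /rat_in_itvoo[q]; rewrite in_itv/= => /andP[? ?].
  by exists q; rewrite /ball/= ltr_distl; apply/andP; split.
have [q2 q2P] := rat_near_rV u.2 k0.
exists (q1, q2, k) => //.
rewrite ifT; first by split.
apply/mem_set => v [/= v1 v2]; apply: eU.
- apply: (ball_splitr (z := ratr q1 : R)).
    exact: le_ball (ltW ke) _ q1P.
  exact: le_ball (ltW ke) _ v1.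
- apply: (ball_splitr (z := map_mx ratr q2 : 'rV[R]_n)).
    exact: le_ball (ltW ke) _ q2P.
  exact: le_ball (ltW ke) _ v2.
Qed.

Lemma measurable_uncons_rV : measurable_fun [set: 'rV[R]_n.+1] uncons_rV.
Proof.
apply/measurable_fun_pairP; split.
- apply: (measurability _ (RGenOpens.measurableE R)) => _ [_ [x [y ->]] <-].
  rewrite setTI; apply: open_measurable_rV.
  apply: open_comp => [v _|]; first exact: coord_continuous.
  exact: interval_open.
- apply: (@measurability _ _ _ _ _ _ (@open 'rV[R]_n)) => // _ [U oU <-].
  rewrite setTI; apply: open_measurable_rV.
  apply: open_comp => // v _; exact: (@continuous_rsubmx R 1 1 n).
Qed.

End cons_rV.

Section lebesgue_rV.
Context {R : realType}.

Section step.
Context {n : nat} (m : {sigma_finite_measure set 'rV[R]_n -> \bar R}).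

Definition lebesgue_step :=
  pushforward (@lebesgue_measure R \x m)%E (@cons_rV R n).

Let lebesgue_step0 : lebesgue_step set0 = 0%E.
Proof. by rewrite /lebesgue_step /pushforward preimage_set0 measure0. Qed.

Let lebesgue_step_ge0 A : (0 <= lebesgue_step A)%E.
Proof. by rewrite /lebesgue_step /pushforward; exact: measure_ge0. Qed.

Let lebesgue_step_sigma_additive : semi_sigma_additive lebesgue_step.
Proof.
pose mu := measure_function_pushforward__canonical__measure_function_Measure
  (@lebesgue_measure R \x m)%E measurable_cons_rV.
exact: (@measure_semi_sigma_additive _ _ _ mu).
Qed.

HB.instance Definition _ := isMeasure.Build _ _ _ lebesgue_step
  lebesgue_step0 lebesgue_step_ge0 lebesgue_step_sigma_additive.

Let lebesgue_step_sigma_finite : sigma_finite setT lebesgue_step.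
Proof.
have /sigma_finiteP[F [TF ndF Foo]] := sigma_finiteT (@lebesgue_measure R).
have /sigma_finiteP[G [TG ndG Goo]] := sigma_finiteT m.
exists (fun k => uncons_rV @^-1` (F k `*` G k)).
  rewrite -preimage_bigcup (_ : \bigcup_i _ = setT) ?preimage_setT//.
  rewrite -subTset => -[x y] _.
  have [i _ Fx] : (\bigcup_i F i) x by rewrite -TF.
  have [j _ Gy] : (\bigcup_i G i) y by rewrite -TG.
  exists (maxn i j) => //; split => /=.
  - by move: x Fx; exact/subsetPset/ndF/leq_maxl.
  - by move: y Gy; exact/subsetPset/ndG/leq_maxr.
move=> k; have [mF Fk] := Foo k; have [mG Gk] := Goo k; split.
  rewrite -[X in measurable X]setTI.
  by apply: measurable_uncons_rV => //; exact: measurableX.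
rewrite /lebesgue_step /pushforward (_ : _ @^-1` _ = F k `*` G k).
  by rewrite product_measure1E// lte_mul_pinfty// ge0_fin_numE.
by apply/seteqP; split => u; rewrite /preimage /mkset cons_rVK.
Qed.

HB.instance Definition _ := Measure_isSigmaFinite.Build _ _ _ lebesgue_step
  lebesgue_step_sigma_finite.

End step.

Fixpoint lebesgue_rV n : {sigma_finite_measure set 'rV[R]_n -> \bar R} :=
  if n is n'.+1 then lebesgue_step (lebesgue_rV n') else \d_(0 : 'rV[R]_0).

End lebesgue_rV.

Section domain.
Context {R : realType} {d : nat} (Omega : set 'rV[R]_d).
Local Notation leb := (@lebesgue_rV R d).
Local Notation C := R[i].
Local Notation Re := (@complex.Re R).
Local Notation Im := (@complex.Im R).
Implicit Types (f g phi psi : 'rV[R]_d -> C).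

(* Functions on Omega are total functions on R^d of which only the values in
   Omega matter; elements of L^p(Omega), L^1_loc(Omega) are represented by
   Borel functions, and equality almost everywhere is kept explicit. *)

Definition L1loc (a : 'rV[R]_d -> R) := measurable_fun Omega a /\
  forall K, compact K -> K `<=` Omega -> leb.-integrable K (EFin \o a).

Definition Lp (p : \bar R) (a : 'rV[R]_d -> R) := measurable_fun Omega a /\
  (Lnorm leb p (EFin \o (a \_ Omega)) < +oo)%E.

(* The value +oo outside Omega makes this the essential infimum over Omega. *)
Definition ess_inf_on (a : 'rV[R]_d -> R) : \bar R :=
  ess_inf leb (patch (cst +oo%E) Omega (EFin \o a)).

Definition cintegral f : C :=
  ((\int[leb]_(x in Omega) Re (f x))%R
  +i* (\int[leb]_(x in Omega) Im (f x))%R)%C.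

Definition inner f g : C := cintegral (fun x => conjc (f x) * g x).

Definition sqnorm f : \bar R :=
  (\int[leb]_(x in Omega) (Normc.normc (f x) ^+ 2)%:E)%E.

Definition L2 f := [/\ measurable_fun Omega (Re \o f),
  measurable_fun Omega (Im \o f) & (sqnorm f < +oo)%E].

Definition partial (i : 'I_d) (u : 'rV[R]_d -> R) : 'rV[R]_d -> R :=
  fun x => 'D_(delta_mx ord0 i) u x.

Definition smooth (u : 'rV[R]_d -> R) := forall (s : seq 'I_d) x,
  {for x, continuous (foldr partial u s)} /\
  forall i, derivable (foldr partial u s) x (delta_mx ord0 i).

Definition cpartial (i : 'I_d) phi : 'rV[R]_d -> C :=
  fun x =>
    (partial i (Re \o phi) x +i* partial i (Im \o phi) x)%C.

(* C_0^oo(Omega), its elements being extended by zero to R^d. *)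
Definition test_function phi :=
  [/\ smooth (Re \o phi), smooth (Im \o phi),
      compact (closure [set x | phi x != 0]) &
      closure [set x | phi x != 0] `<=` Omega].

Definition is_weak_partial (i : 'I_d) f g := forall eta, test_function eta ->
  cintegral (fun x => f x * cpartial i eta x) =
  - cintegral (fun x => g x * eta x).

Definition H1 f := L2 f /\ forall i, exists2 g, L2 g & is_weak_partial i f g.

(* A representative of the (a.e. unique) weak derivative of f in H1. *)
Definition weak_partial (i : 'I_d) f : 'rV[R]_d -> C :=
  xget (cst 0) [set g | L2 g /\ is_weak_partial i f g].

Definition sqnorm_H1 f : \bar R :=
  (\sum_(i < d) sqnorm (weak_partial i f) + sqnorm f)%E.

Definition linear_subspace (L : set ('rV[R]_d -> C)) :=
  L (cst 0) /\
  forall (c : C) f g, L f -> L g -> L (fun x => c * f x + g x).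

(* L has dimension n modulo almost everywhere equality on Omega. *)
Definition has_dim (L : set ('rV[R]_d -> C)) (n : nat) :=
  exists e : 'I_n -> 'rV[R]_d -> C,
  [/\ forall i, L (e i),
      forall c : 'I_n -> C,
        ae_eq leb Omega (fun x => \sum_(i < n) c i * e i x) (cst 0) ->
        forall i, c i = 0 &
      forall f, L f -> exists c : 'I_n -> C,
        ae_eq leb Omega f (fun x => \sum_(i < n) c i * e i x)].

Section form.
Context (a b b1 b2 : 'rV[R]_d -> R) (mu : R).

Definition form_weight (x : 'rV[R]_d) : R :=
  mu * (a x - fine (ess_inf_on a)) + b1 x - fine (ess_inf_on b1) +
  Num.max (b2 x) 0.

Definition sqnorm_form psi : \bar R :=
  (sqnorm_H1 psi +
   sqnorm (fun x => (Num.sqrt (form_weight x))%:C%C * psi x)%R)%E.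

(* The closure of C_0^oo(Omega) for the norm whose square is sqnorm_form. *)
Definition form_domain : set ('rV[R]_d -> C) := [set psi | H1 psi /\
  exists phi : nat -> 'rV[R]_d -> C, (forall k, test_function (phi k)) /\
    sqnorm_form (fun x => phi k x - psi x) @[k --> \oo] --> 0%E].

(* The complex-valued integrals converge for phi and psi in form_domain. *)
Definition form phi psi : C :=
  \sum_(i < d) inner (weak_partial i phi) (weak_partial i psi) +
  mu%:C%C * inner phi (fun x => (a x)%:C%C * psi x) +
  inner phi (fun x => (b x)%:C%C * psi x).

(* form psi psi is a real number, so taking the real part loses nothing. *)
Definition rayleigh psi : R := Re (form psi psi) / fine (sqnorm psi).

(* L ranges over the n-dimensional subspaces of form_domain; ~ ae_eq psi 0
   says that psi is nonzero as an element of L^2(Omega). *)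
Definition minmax (n : nat) : \bar R :=
  ereal_inf [set ereal_sup [set (rayleigh psi)%:E |
      psi in [set psi | L psi /\ ~ ae_eq leb Omega psi (cst 0)]] |
    L in [set L | [/\ L `<=` form_domain, linear_subspace L & has_dim L n]]].

End form.

End domain.

(* Main.v *)
(* Lower bound. Since |b2| <= V + M with V in L^d (split |b2| at height M), the
   Gagliardo-Nirenberg inequality for u = |psi|^2, followed by
   |grad u| <= delta |grad psi|^2 + |psi|^2 / delta, gives
   int V |psi|^2 <= ||grad psi||^2 + c ||psi||^2, first for test functions and
   then on the form domain. Together with a >= a_min and b1 >= b1_min a.e. all
   Rayleigh quotients are at least mu a_min - c, with c independent of mu.

   Upper bound. For t > a_min the set {a < t} is not negligible, hence has n
   distinct points near each of which it stays non-negligible. In a small box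
   around each of them, approximating the indicator function of {a < t} yields
   a test function phi with int (a - t) |phi|^2 < 0. The boxes being disjoint,
   on the span of these n functions the form is at most (mu t + c) ||psi||^2, so
   that the n-th min-max value is at most mu t + c. Dividing by mu and letting
   t decrease to a_min gives the limit. *)
Require Import Defs.
From mathcomp Require Import all_boot all_order all_algebra.
From mathcomp Require Import complex.
From mathcomp Require Import all_classical all_reals all_analysis.
From mathcomp Require Import measurable_realfun ess_sup_inf.
From mathcomp Require Import ring lra.

Set Implicit Arguments.
Unset Strict Implicit.
Unset Printing Implicit Defensive.

Import Order.TTheory GRing.Theory Num.Theory.
Import numFieldNormedType.Exports.

Local Open Scope classical_set_scope.
Local Open Scope ring_scope.

(** * Smooth functions *)

(** The exponent [d] is dual to the embedding of W^{1,1} into L^{d/(d-1)}. Applying it to |psi|^2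
    rather than to psi treats all dimensions [d >= 1] alike, the first two included. [delta] is
    fixed so that the coefficient of the gradient is exactly 1 after the losses of the passage to
    the limit; the gradient term of the form then absorbs int V |psi|^2.

    That passage is delicate, because int V |psi|^2 is not known to be finite beforehand. It is made
    for the truncations min(V, N), for which an L^2 error costs only a factor N, and N is sent to
    infinity last. Likewise a real-valued integral that diverges to infinity is read as 0, so the
    integrability of a |psi|^2 and b |psi|^2 has to be derived from the finiteness of the form norm
    before the integrals are compared.

    In the upper bound, disjoint supports make all weighted integrals diagonal in the coefficients
    of a linear combination. The gradients need only a crude estimate, since their contribution does
    not involve mu. *)

Section flat_function.
Context {R : realType}.
Implicit Types (q : {poly R}) (t : R).

(** [flat 1] is the classical flat function e^{-1/t}, from which all bumps are built. The polynomial
    factor in [t^-1] makes the family stable under differentiation. *)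
Definition flat q t : R := if 0 < t then q.[t^-1] * expR (- t^-1) else 0.

(** For t > 0 the chain rule gives t^-2 (q - q')(1/t) e^{-1/t}. *)
Definition flat_deriv q : {poly R} := 'X^2 * (q - q^`()).

(** Since e^y = (e^{y/n})^n, it suffices that e^s >= 1 + s >= s at s = y / n. *)
Lemma exprn_expRN_le n (y : R) : 0 <= y -> y ^+ n * expR (- y) <= n%:R ^+ n.
Proof.
case: n => [|n] y0; first by rewrite !expr0 mul1r -expR0 ler_expR oppr_le0.
rewrite expRN ler_pdivrMr ?expR_gt0//.
have -> : expR y = expR (y / n.+1%:R) ^+ n.+1.
  by rewrite -expRM_natl; congr expR; rewrite mulrC divfK// pnatr_eq0.
rewrite -exprMn lerXn2r ?nnegrE ?mulr_ge0 ?expR_ge0//.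
rewrite -ler_pdivrMl ?ltr0n// mulrC.
by apply: le_trans (expR_ge1Dx _); rewrite lerDr.
Qed.

Lemma horner_expRN_le q : exists C, forall y : R, 0 <= y ->
  `|q.[y] * expR (- y)| <= C.
Proof.
elim/poly_ind: q => [|q c [C qC]].
  by exists 0 => y _; rewrite horner0 mul0r normr0.
have h2 (p : {poly R}) : exists C, forall y : R, 0 <= y ->
  `|p.[y] * expR (- y)| <= C.
  exists (\sum_(i < size p) `|p`_i| * i%:R ^+ i) => y y0.
  rewrite horner_coef mulr_suml (le_trans (ler_norm_sum _ _ _))//.
  apply: ler_sum => i _; rewrite -mulrA normrM ler_wpM2l//.
  by rewrite ger0_norm ?exprn_expRN_le// mulr_ge0 ?exprn_ge0// expR_ge0.
exact: h2.
Qed.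

(** Boundedness of s q(s) e^{-s} at s = 1/t leaves a factor [t]. For ['X * q] the same estimate
    makes the difference quotient of [flat q] at 0 tend to 0. *)
Lemma flat_le q : exists2 C, 0 <= C & forall t, `|flat q t| <= C * `|t|.
Proof.
have [C hC] := horner_expRN_le ('X * q).
exists (Num.max C 0); first by rewrite le_max lexx orbT.
move=> t; rewrite /flat; case: ifPn => t0; last first.
  by rewrite normr0 mulr_ge0// le_max lexx orbT.
have := hC t^-1; rewrite invr_ge0 (ltW t0) => /(_ isT).
rewrite hornerM hornerX -mulrA normrM gtr0_norm ?invr_gt0// mulrC ler_pdivrMr//.
rewrite (gtr0_norm t0) => /le_trans; apply.
by rewrite ler_wpM2r ?(ltW t0)// le_max lexx.
Qed.

Lemma is_derive_flat q t : is_derive t 1 (flat q) (flat (flat_deriv q) t).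
Proof.
have [t0|t0|->] := ltgtP t 0.
- rewrite {2}/flat ltNge (ltW t0)/=.
  apply: (@near_eq_is_derive _ _ _ (cst 0)).
  near=> x; rewrite /flat ifF//; apply/negbTE; rewrite -leNgt ltW//.
  by near: x; exact: lt_nbhsl.
- rewrite {2}/flat t0.
  have dV : is_derive t (1 : R) (@GRing.inv R) (- t ^- 2).
    apply: is_derive_eq; first exact: (@is_deriveV _ _ _ _ _ (lt0r_neq0 t0) (is_derive_id t (1:R))).
    by rewrite /GRing.scale/= mulr1.
  have dq := is_derive1_comp (is_derive_poly q t^-1) dV.
  have dE := is_derive1_comp (g := - GRing.inv) (is_derive_expR _) (is_deriveN dV).
  apply: (@near_eq_is_derive R R^o R^o ((horner q \o GRing.inv) * (expR \o (- GRing.inv : R -> R)))).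
    near=> x; rewrite /flat ifT//.
    by near: x; exact: lt_nbhsr.
  have dM := is_deriveM dq dE.
  apply: (is_derive_eq dM).
  rewrite /flat_deriv /= !hornerE /GRing.scale/= ?exprVn; ring.
- rewrite {2}/flat ltxx.
  have [C C0 hC] := flat_le ('X * q).
  have key : (fun h : R => h^-1 *: ((flat q \o shift 0) (h *: 1) - flat q 0)) @ 0^' --> (0 : R).
    apply/cvgr0Pnorm_lt => e e0; near=> h.
    have h0 : h != 0 by near: h; exact: nbhs_dnbhs_neq.
    rewrite /= addr0 [_%:A]mulr1 {2}/flat ltxx subr0 /GRing.scale/=.
    (* Dividing by [h] only multiplies the polynomial by ['X], so the quotient is again flat and is
       O(|h|). *)
    have -> : h^-1 * flat q h = flat ('X * q) h.
      by rewrite /flat hornerM hornerX; case: ifP; rewrite ?mulr0// mulrA.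
    apply: (le_lt_trans (hC h)).
    apply: (@le_lt_trans _ _ ((C + 1) * `|h|)).
      by rewrite ler_wpM2r// lerDl.
    rewrite -ltr_pdivlMl ?ltr_wpDl//.
    near: h; apply: dnbhs0_lt.
    by rewrite mulr_gt0// invr_gt0 ltr_wpDl.
  apply: DeriveDef; first by apply/cvg_ex; exists 0.
  exact/cvg_lim.
Unshelve. all: by end_near. Qed.

End flat_function.

Section smooth.
Context {R : realType} {d : nat}.
Implicit Types (u v : 'rV[R]_d -> R) (i j : 'I_d).
Local Notation e_ i := (delta_mx ord0 i : 'rV[R]_d).

(** Turns a directional derivative into a one-variable derivative at 0, where the chain rule for
    real functions is available. *)
Lemma is_derive_line (V W : normedModType R) (f : V -> W) (x v : V) (df : W) :
  is_derive x v f df <-> is_derive (0 : R) (1 : R) (fun h => f (h *: v + x)) df.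
Proof.
have E : (fun h => h^-1 *: ((f \o shift x) (h *: v) - f x)) =
   (fun h => h^-1 *: (((fun h => f (h *: v + x)) \o shift 0) (h *: 1) -
     f ((0 : R) *: v + x))).
  by apply/funext => h /=; rewrite addr0 scale0r add0r [_%:A]mulr1.
by split=> -[]; rewrite /derivable /derive ?E => dx <-; split;
  rewrite /derivable /derive ?E.
Qed.

(** Coinduction: a class stable under partial derivatives contains all iterated partials of its
    members, so first-order facts about the class suffice. This replaces formulas for derivatives of
    higher order. *)
Lemma smooth_coind (S : set ('rV[R]_d -> R)) :
  (forall u, S u -> continuous u /\
    forall i, (forall x, derivable u x (e_ i)) /\ S (partial i u)) ->
  S `<=` smooth.
Proof.
move=> SP u Su s x.
have Ss : S (foldr partial u s).
  by elim: s => //= i s /SP[_ /(_ i)[]].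
have [c D] := SP _ Ss.
by split; [exact: c|move=> i; have [] := D i].
Qed.

Lemma smooth_continuous u : smooth u -> continuous u.
Proof. by move=> su x; have [] := su [::] x. Qed.

Lemma smooth_derivable u i x : smooth u -> derivable u x (e_ i).
Proof. by move=> su; have [_] := su [::] x; exact. Qed.

Lemma smooth_partial u i : smooth u -> smooth (partial i u).
Proof. by move=> su s x; have := su (rcons s i) x; rewrite foldr_rcons. Qed.

Lemma smooth_partialD u v i x : smooth u -> smooth v ->
  partial i (fun x => u x + v x) x = partial i u x + partial i v x.
Proof. by move=> su sv; apply: deriveD; exact: smooth_derivable. Qed.

Lemma smooth_partialM u v i x : smooth u -> smooth v ->
  partial i (fun x => u x * v x) x = u x * partial i v x + v x * partial i u x.
Proof. by move=> su sv; apply: deriveM; exact: smooth_derivable. Qed.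

Lemma smooth_partialZ (c : R) u i x : smooth u ->
  partial i (fun x => c * u x) x = c * partial i u x.
Proof. by move=> su; apply: deriveZ; exact: smooth_derivable. Qed.

Lemma smooth_partialN u i x : smooth u ->
  partial i (fun x => - u x) x = - partial i u x.
Proof. by move=> su; apply: deriveN; exact: smooth_derivable. Qed.

(** Products alone are not stable under partial derivatives, since Leibniz's rule yields sums. The
    algebra generated by the smooth functions is, so [smooth_coind] applies to it. *)
Inductive smooth_algebra : ('rV[R]_d -> R) -> Prop :=
| smooth_algebra_smooth u : smooth u -> smooth_algebra u
| smooth_algebraD u v : smooth_algebra u -> smooth_algebra v ->
    smooth_algebra (u \+ v)
| smooth_algebraM u v : smooth_algebra u -> smooth_algebra v ->
    smooth_algebra (u \* v).

Lemma smooth_algebra_sub : smooth_algebra `<=` smooth.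
Proof.
apply: smooth_coind => u; elim=> {u} [u su|u v su [uc uD] sv [vc vD]
                                     |u v su [uc uD] sv [vc vD]].
- split; first exact: smooth_continuous.
  move=> i; split=> [x|]; first exact: smooth_derivable.
  exact/smooth_algebra_smooth/smooth_partial.
- split; first by move=> x; apply: continuousD; [exact: uc|exact: vc].
  move=> i; have [ud us] := uD i; have [vd vs] := vD i.
  split; first by move=> x; exact: derivableD.
  rewrite (_ : partial i _ = partial i u \+ partial i v).
    exact: smooth_algebraD.
  by apply/funext => x; exact: deriveD.
- split; first by move=> x; apply: continuousM; [exact: uc|exact: vc].
  move=> i; have [ud us] := uD i; have [vd vs] := vD i.
  split; first by move=> x; exact: derivableM.
  rewrite (_ : partial i _ = (u \* partial i v) \+ (v \* partial i u)).
    by apply: smooth_algebraD; exact: smooth_algebraM.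
  by apply/funext => x; exact: deriveM.
Qed.

Lemma smoothD u v : smooth u -> smooth v -> smooth (fun x => u x + v x).
Proof.
by move=> su sv; apply: (smooth_algebra_sub (t := u \+ v)); apply: smooth_algebraD;
  exact: smooth_algebra_smooth.
Qed.

Lemma smoothM u v : smooth u -> smooth v -> smooth (fun x => u x * v x).
Proof.
by move=> su sv; apply: (smooth_algebra_sub (t := u \* v)); apply: smooth_algebraM;
  exact: smooth_algebra_smooth.
Qed.

Lemma partial_cst (c : R) i : partial i (cst c) = cst 0.
Proof. by apply/funext => x; exact: derive_cst. Qed.

Lemma smooth_cst (c : R) : smooth (cst c : 'rV[R]_d -> R).
Proof.
apply: (@smooth_coind [set u | exists c, u = cst c]); last by exists c.
move=> _ [{}c ->]; split; first by move=> x; exact: cst_continuous.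
move=> i; split; first by move=> x; exact: derivable_cst.
by exists 0; exact: partial_cst.
Qed.

Lemma smoothN u : smooth u -> smooth (fun x => - u x).
Proof.
move=> su; rewrite (_ : (fun x => - u x) = fun x => - 1 * u x).
  exact: smoothM (smooth_cst _) su.
by apply/funext => x; rewrite mulN1r.
Qed.

Lemma smoothZ (c : R) u : smooth u -> smooth (fun x => c * u x).
Proof. by move=> su; exact: smoothM (smooth_cst c) su. Qed.

Lemma smooth_prod (I : Type) (s : seq I) (F : I -> 'rV[R]_d -> R) :
  (forall k, smooth (F k)) -> smooth (fun x => \prod_(k <- s) F k x).
Proof.
move=> sF; elim: s => [|k s ih].
  under eq_fun do rewrite big_nil; exact: smooth_cst.
under eq_fun do rewrite big_cons; exact: smoothM.
Qed.

Lemma smooth_flat (q : {poly R}) (al c : R) i :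
  smooth (fun x : 'rV[R]_d => flat q (al * x ord0 i + c)).
Proof.
(* The scalar [k] absorbs the inner derivative [al * (j == i)%:R], so every partial derivative stays
   in this family. *)
pose S : set ('rV[R]_d -> R) := [set u | exists k q,
  u = fun x : 'rV[R]_d => k * flat q (al * x ord0 i + c)].
suff SP : S `<=` smooth.
  by apply: SP; exists 1, q; apply/funext => x; rewrite mul1r.
apply: (@smooth_coind S) => _ [k [{}q ->]].
have D j x : is_derive x (e_ j) (fun x : 'rV[R]_d => k * flat q (al * x ord0 i + c))
    (k * (al * (j == i)%:R) * flat (flat_deriv q) (al * x ord0 i + c)).
  apply/is_derive_line.
  pose g h : R := al * ((h * (j == i)%:R) + x ord0 i) + c.
  rewrite (_ : (fun h => _) = k \*: (flat q \o g)); last first.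
    apply/funext => h; rewrite !mxE eqxx/= /g.
    by rewrite [j == i]eq_sym.
  have dg : is_derive (0 : R) (1 : R) g (al * (j == i)%:R).
    rewrite /g; apply: is_derive_eq; rewrite /GRing.scale/= ?mulr1; ring.
  have df := is_derive1_comp (is_derive_flat q _) dg.
  have dZ := is_deriveZ k df.
  apply: (is_derive_eq dZ); rewrite /g mul0r add0r /GRing.scale/=; ring.
split.
  move=> x.
  have ca : {for x, continuous (fun x : 'rV[R]_d => al * x ord0 i + c)}.
    apply: (@continuousD _ _ _ (fun x : 'rV[R]_d => al * x ord0 i) (cst c)).
      apply: (@continuousM _ _ (cst al) (fun x : 'rV[R]_d => x ord0 i)).
        exact: cst_continuous.
      exact: coord_continuous.
    exact: cst_continuous.
  apply: (@continuousM _ _ (cst k)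
    (fun x : 'rV[R]_d => flat q (al * x ord0 i + c))).
    exact: cst_continuous.
  apply: (@continuous_comp _ _ _ _ (flat q) x ca).
  apply/differentiable_continuous/derivable1_diffP.
  by have [] := is_derive_flat q (al * x ord0 i + c).
move=> j; split=> [x|]; first by have [] := D j x.
exists (k * (al * (j == i)%:R)), (flat_deriv q); apply/funext => x.
by rewrite /partial; have [_ ->] := D j x.
Qed.

End smooth.

(** * Lebesgue measure on R^n *)

Section fubini_rV.
Context {R : realType} {n : nat}.
Local Notation leb1 := (@lebesgue_measure R).
Local Notation leb := (@lebesgue_rV R).
Local Open Scope ereal_scope.

(* [lebesgue_measure] lives on [measurableTypeR R], whose display differs from
   that of [R]. *)
Let mcons : measurable_fun setT
    (@cons_rV R n : measurableTypeR R * 'rV[R]_n -> 'rV[R]_n.+1) :=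
  measurable_cons_rV.

(** [lebesgue_rV n.+1] is by definition the pushforward of a product measure under [cons_rV], so the
    abstract theorem can be transported. *)
Lemma tonelli_rV (f : 'rV[R]_n.+1 -> \bar R) : measurable_fun setT f ->
  (forall x, 0 <= f x) ->
  \int[leb n.+1]_x f x = \int[leb1]_t \int[leb n]_y f (cons_rV (t, y)).
Proof.
move=> mf f0.
transitivity (\int[pushforward (leb1 \x leb n) (@cons_rV R n)]_y f y).
  by [].
rewrite (ge0_integral_pushforward mcons (leb1 \x leb n)%E measurableT mf)//.
rewrite preimage_setT.
have mfc : measurable_fun setT (f \o @cons_rV R n :
  measurableTypeR R * 'rV[R]_n -> \bar R) by exact: measurableT_comp.
exact: (fubini_tonelli1 (m1 := leb1) (m2 := leb n) _ mfc (fun z => f0 _)).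
Qed.

Lemma tonelli_rV_swap (f : 'rV[R]_n.+1 -> \bar R) : measurable_fun setT f ->
  (forall x, 0 <= f x) ->
  \int[leb n.+1]_x f x = \int[leb n]_y \int[leb1]_t f (cons_rV (t, y)).
Proof.
move=> mf f0; rewrite tonelli_rV//.
have mfc : measurable_fun setT (f \o @cons_rV R n :
  measurableTypeR R * 'rV[R]_n -> \bar R) by exact: measurableT_comp.
exact: (fubini_tonelli (m1 := leb1) (m2 := leb n) _ mfc (fun z => f0 _)).
Qed.

Lemma integrable_cons_rV (f : 'rV[R]_n.+1 -> \bar R) :
  (leb n.+1).-integrable setT f ->
  (leb1 \x leb n)%E.-integrable setT (f \o @cons_rV R n).
Proof.
move=> /integrableP[mf If].
apply/integrableP; split; first exact: measurableT_comp.
have mf' : measurable_fun setT (abse \o f) by exact: measurableT_comp.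
have := ge0_integral_pushforward mcons (leb1 \x leb n)%E measurableT mf'
  (fun y _ => abse_ge0 _).
by rewrite preimage_setT => <-; exact: If.
Qed.

Lemma fubini_rV (f : 'rV[R]_n.+1 -> \bar R) : (leb n.+1).-integrable setT f ->
  \int[leb n.+1]_x f x = \int[leb1]_t \int[leb n]_y f (cons_rV (t, y)).
Proof.
move=> intf; have intc := integrable_cons_rV intf.
transitivity (\int[pushforward (leb1 \x leb n) (@cons_rV R n)]_y f y).
  by [].
rewrite (integral_pushforward mcons (mu := (leb1 \x leb n)%E))//.
- by rewrite preimage_setT -integral12_prod_meas1.
- by case/integrableP : intf.
Qed.

Lemma fubini_rV_swap (f : 'rV[R]_n.+1 -> \bar R) :
  (leb n.+1).-integrable setT f ->
  \int[leb n.+1]_x f x = \int[leb n]_y \int[leb1]_t f (cons_rV (t, y)).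
Proof.
move=> intf; rewrite fubini_rV//.
exact: (Fubini (integrable_cons_rV intf)).
Qed.

Lemma measurable_slice1 d' (T : measurableType d') (f : 'rV[R]_n.+1 -> T) (y : 'rV[R]_n) :
  measurable_fun setT f -> measurable_fun setT (fun t : R => f (cons_rV (t, y))).
Proof.
move=> mf; apply: (measurableT_comp (f := f \o cons_rV) (g := pair^~ y)).
  by apply: measurableT_comp => //; exact: measurable_cons_rV.
exact: pair2_measurable.
Qed.

Lemma measurable_slice2 d' (T : measurableType d') (f : 'rV[R]_n.+1 -> T) (t : R) :
  measurable_fun setT f -> measurable_fun setT (fun y : 'rV[R]_n => f (cons_rV (t, y))).
Proof.
move=> mf; apply: (measurableT_comp (f := f \o cons_rV) (g := pair t)).
  by apply: measurableT_comp => //; exact: measurable_cons_rV.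
exact: pair1_measurable.
Qed.

End fubini_rV.

Section lebesgue_rV_sets.
Context {R : realType}.
Local Notation leb1 := (@lebesgue_measure R).
Local Notation leb := (@lebesgue_rV R).
Local Open Scope ereal_scope.

Lemma lebesgue_rV_consX n (A : set R) (B : set 'rV[R]_n) :
  measurable A -> measurable B ->
  (leb1 \x leb n) (A `*` B) = leb1 A * leb n B.
Proof. by move=> mA mB; rewrite product_measure1E. Qed.

Lemma lebesgue_rV_ge n (A : set R) (B : set 'rV[R]_n) (U : set 'rV[R]_n.+1) :
  measurable A -> measurable B -> measurable U ->
  (forall t y, A t -> B y -> U (cons_rV (t, y))) ->
  leb1 A * leb n B <= leb n.+1 U.
Proof.
move=> mA mB mU AB; rewrite -lebesgue_rV_consX//=.
rewrite /lebesgue_step /pushforward; apply: le_measure.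
- by rewrite inE; exact: measurableX.
- rewrite inE -[X in measurable X]setTI; exact: measurable_cons_rV.
- by move=> [t y] [/= At By]; exact: AB.
Qed.

Lemma lebesgue_rV_le n (A : set R) (B : set 'rV[R]_n) (U : set 'rV[R]_n.+1) :
  measurable A -> measurable B -> measurable U ->
  (forall t y, U (cons_rV (t, y)) -> A t /\ B y) ->
  leb n.+1 U <= leb1 A * leb n B.
Proof.
move=> mA mB mU AB; rewrite -lebesgue_rV_consX//=.
rewrite /lebesgue_step /pushforward; apply: le_measure.
- rewrite inE -[X in measurable X]setTI; exact: measurable_cons_rV.
- by rewrite inE; exact: measurableX.
- by move=> [t y] /AB.
Qed.

Lemma rV0E (x y : 'rV[R]_0) : x = y.
Proof. by apply/rowP => -[]. Qed.

(** Induction on the dimension: a nonempty open set contains the product of an interval and a ball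
    of one dimension less. This positivity keeps essential infima over a nonempty open set below
    [+oo]. *)
Lemma lebesgue_rV_open_gt0 n (U : set 'rV[R]_n) : open U -> U !=set0 ->
  0 < leb n U.
Proof.
elim: n U => [|n ih] U oU [x Ux].
  by rewrite /= diracE (rV0E 0 x) mem_set// lte01.
move: Ux; rewrite -(uncons_rVK x) => Ux.
have [e e0 eU] := near_cons_rV oU Ux.
apply: (@lt_le_trans _ _
    (leb1 (ball (uncons_rV x).1 e) * leb n (ball (uncons_rV x).2 e))).
  rewrite mule_gt0//.
    by rewrite lebesgue_measure_ball ?lte_fin ?mulrn_wgt0// ltW.
  by apply: ih; [exact: ball_open|exists (uncons_rV x).2; exact: ballxx].
apply: lebesgue_rV_ge.
- exact: measurable_ball.
- by apply: open_measurable_rV; exact: ball_open.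
- exact: open_measurable_rV.
- by move=> t y ? ?; exact: eU.
Qed.

Lemma closed_measurable_rV n (F : set 'rV[R]_n) : closed F -> measurable F.
Proof.
move=> cF; rewrite -(setCK F); apply: measurableC.
by apply: open_measurable_rV; exact: closed_openC.
Qed.

Lemma continuous_measurable_rV n (u : 'rV[R]_n -> R) : continuous u ->
  measurable_fun setT u.
Proof.
move=> cu; apply: (measurability _ (RGenOpens.measurableE R)) => _ [_ [x [y ->]] <-].
rewrite setTI; apply: open_measurable_rV.
by apply: open_comp => [v _|]; [exact: cu|exact: interval_open].
Qed.

(** Cubes around the origin witness bounded supports, and every compact set lies in one. Membership
    splits along [cons_rV], which suits inductions on the dimension. *)
Definition box n (M : R) : set 'rV[R]_n :=
  [set x | forall i, (`|x ord0 i| <= M)%R].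

Lemma closed_box n (M : R) : closed (@box n M).
Proof.
rewrite (_ : box M = \bigcap_(i in setT) [set x | (`|x ord0 i| <= M)%R]); last first.
  by apply/seteqP; split=> [x xM i _|x xM i]; exact: xM.
apply: closed_bigI => i _.
apply: (@closed_comp _ _ (fun x : 'rV[R]_n => `|x ord0 i|%R) [set t | (t <= M)%R]); last first.
  exact: closed_le.
move=> x _; apply: (@continuous_comp _ _ _ (fun x : 'rV[R]_n => x ord0 i) Num.norm).
  exact: coord_continuous.
exact: norm_continuous.
Qed.

Lemma measurable_box n (M : R) : measurable (@box n M).
Proof. by apply: closed_measurable_rV; exact: closed_box. Qed.

Lemma box_cons n (M : R) t (y : 'rV[R]_n) :
  box M (cons_rV (t, y)) <-> (`|t| <= M)%R /\ box M y.
Proof.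
split=> [h|[h1 h2]].
  split.
    have := h ord0; rewrite mxE; case: splitP => // j _; by rewrite mxE.
  move=> i; have := h (lift ord0 i); rewrite mxE; case: splitP => /= j.
    by rewrite (ord1 j).
  rewrite /bump /= add1n add1n => -[ij].
  by rewrite (_ : i = j)//; exact: val_inj.
by move=> i; rewrite mxE; case: splitP => j _; [rewrite mxE|exact: h2].
Qed.

Lemma lebesgue_box_fin n (M : R) : leb n (box M) < +oo.
Proof.
elim: n => [|n ih]; first by rewrite /= diracE ltry.
apply: (@le_lt_trans _ _ (leb1 `[(- M)%R, M]%classic * leb n (box M))).
  apply: lebesgue_rV_le => //; [exact: measurable_box|exact: measurable_box|].
  by move=> t y /box_cons[tM yM]; split => //=; rewrite in_itv/= -ler_norml.
rewrite lte_mul_pinfty// lebesgue_measure_itv/=; case: ifP => //.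
Qed.

(** The first coordinate already confines a point to a null set. In dimension 0 the measure is a
    Dirac mass, hence the successor. Finite sets being null, distinct density points can be picked
    later. *)
Lemma lebesgue_rV_set1 n (x : 'rV[R]_n.+1) : leb n.+1 [set x] = 0.
Proof.
apply/eqP; rewrite eq_le measure_ge0 andbT.
pose B := [set (uncons_rV x).2].
have mB m (y : 'rV[R]_m) : measurable [set y].
  apply: closed_measurable_rV; apply: accessible_closed_set1.
  by apply: hausdorff_accessible; exact: norm_hausdorff.
rewrite (le_trans (@lebesgue_rV_le n [set (uncons_rV x).1] B _ _ _ _ _))//; first last.
- by rewrite lebesgue_measure_set1 mul0e.
- move=> t y E; have {}E : cons_rV (t, y) = x := E.
  by rewrite /B -E cons_rVK.
- exact: mB.
Qed.

Lemma compact_box n (M : R) : compact (@box n M).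
Proof.
rewrite (_ : box M = [set v | forall i, `[(- M)%R, M]%classic (v ord0 i)]).
  apply: (@rV_compact _ _ (fun=> `[(- M)%R, M]%classic)).
  by move=> i; exact: segment_compact.
by apply/seteqP; split => x h i; have := h i; rewrite /box /= ?in_itv/= ler_norml.
Qed.

Lemma compact_sub_box n (K : set 'rV[R]_n) : compact K -> exists M, K `<=` box M.
Proof.
move=> /compact_bounded[M [Mr /(_ (M + 1)%R)]]; rewrite ltrDl ltr01 => /(_ isT) KM.
exists (M + 1)%R => x /KM h i; apply: le_trans h.
by rewrite [leRHS]/Num.norm /= mx_normrE; apply/bigmax_geP; right => /=;
  exists (ord0, i).
Qed.

End lebesgue_rV_sets.

(** * Compactly supported C^1 functions, their slices and the integrals of their derivatives *)

Section compact_support.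
Context {R : realType} {n : nat}.
Implicit Types (u : 'rV[R]_n -> R) (i : 'I_n).
Local Notation e_ i := (delta_mx ord0 i : 'rV[R]_n).

(** Compactly supported C^1 functions in terms of partial derivatives only. One derivative is all
    that Gagliardo's inequality needs, and the class passes to slices, on which the inductions over
    the dimension rest. *)
Record c1c u : Prop := C1c {
  c1c_continuous : continuous u ;
  c1c_derivable : forall i x, derivable u x (e_ i) ;
  c1c_continuous_partial : forall i, continuous (partial i u) ;
  c1c_support : exists M, forall x, ~ box M x -> u x = 0 }.

Lemma partial_off_closed u i (F : set 'rV[R]_n) x : closed F ->
  (forall x, ~ F x -> u x = 0) -> ~ F x -> partial i u x = 0.
Proof.
move=> cF u0 Fx; rewrite /partial.
rewrite (@near_eq_derive _ _ _ u (cst 0)) ?derive_cst//.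
have : nbhs x (~` F) by apply: open_nbhs_nbhs; split => //; exact: closed_openC.
by apply: filterS => y; exact: u0.
Qed.

Lemma c1c_partial_support u i : c1c u ->
  exists M, forall x, ~ box M x -> partial i u x = 0.
Proof.
move=> /c1c_support[M uM]; exists M => x.
by apply: (@partial_off_closed u i (box M)) => //; exact: closed_box.
Qed.

Lemma smooth_c1c u : smooth u ->
  (exists M, forall x, ~ box M x -> u x = 0) -> c1c u.
Proof.
move=> su uM; split=> //; first exact: smooth_continuous.
- by move=> i x; exact: smooth_derivable.
- by move=> i; exact/smooth_continuous/smooth_partial.
Qed.

Lemma integrable_bounded_support u M : continuous u ->
  (forall x, ~ box M x -> u x = 0) ->
  (@lebesgue_rV R n).-integrable setT (EFin \o u).
Proof.
move=> cu uM.
have : (@lebesgue_rV R n).-integrable (box M) (EFin \o u).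
  apply: measurable_bounded_integrable.
  - exact: measurable_box.
  - exact: lebesgue_box_fin.
  - apply: measurable_funTS; exact: continuous_measurable_rV.
  - have : compact (u @` box M).
      apply: continuous_compact; last exact: compact_box.
      exact: continuous_subspaceT.
    move=> /compact_bounded[C [Cr uC]]; exists C; split => // y Cy x xM.
    by apply: uC => //; exists x.
move=> /(integrable_mkcond _ (measurable_box M)).
rewrite (_ : (EFin \o u) \_ _ = EFin \o u)//.
apply/funext => x; rewrite patchE; case: ifPn => // /negP xM.
by rewrite /= uM// => ?; apply: xM; exact: mem_set.
Qed.

Lemma c1c_integrable_partial u i : c1c u ->
  (@lebesgue_rV R n).-integrable setT (EFin \o partial i u).
Proof.
move=> cu; have [M uM] := c1c_partial_support i cu.
by apply: (integrable_bounded_support _ uM); exact: c1c_continuous_partial.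
Qed.

Lemma c1cZ (k : R) u : c1c u -> c1c (fun x => k * u x).
Proof.
have dZ i x : c1c u -> is_derive x (e_ i) (fun x => k * u x) (k * partial i u x).
  by move=> cu; apply: is_deriveZ; apply: derivableP; exact: c1c_derivable.
move=> cu; split.
- move=> x; apply: (@continuousM _ _ (cst k)); first exact: cst_continuous.
  exact: c1c_continuous.
- by move=> i x; have [] := dZ i x cu.
- move=> i; rewrite (_ : partial i _ = fun x => k * partial i u x).
    move=> x; apply: (@continuousM _ _ (cst k)); first exact: cst_continuous.
    exact: c1c_continuous_partial.
  by apply/funext => x; rewrite /partial; have [_ ->] := dZ i x cu.
- by have [M uM] := c1c_support cu; exists M => x /uM ->; rewrite mulr0.
Qed.

Lemma partialZ (k : R) u i x : c1c u ->
  partial i (fun x => k * u x) x = k * partial i u x.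
Proof. by move=> cu; apply: deriveZ; exact: c1c_derivable. Qed.

End compact_support.

Lemma continuous_pairl (U V : topologicalType) (y : V) :
  continuous (fun t : U => (t, y)).
Proof. by move=> t; apply: cvg_pair; [exact: cvg_id|exact: cvg_cst]. Qed.

Lemma continuous_pairr (U V : topologicalType) (t : U) :
  continuous (fun y : V => (t, y)).
Proof. by move=> y; apply: cvg_pair; [exact: cvg_cst|exact: cvg_id]. Qed.

Section slices.
Context {R : realType} {n : nat}.
Implicit Types (u : 'rV[R]_n.+1 -> R) (y : 'rV[R]_n) (t : R).
Local Notation e_ i := (delta_mx ord0 i).

Lemma cons_rV_shift0 (h t : R) y :
  h *: e_ (ord0 : 'I_n.+1) + cons_rV (t, y) = cons_rV (h + t, y).
Proof.
apply/rowP => i; rewrite !mxE eqxx/=.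
case: splitP => j ij; rewrite ?mxE.
  by rewrite (_ : i == ord0) ?mulr1//; apply/eqP/val_inj; rewrite /= ij ord1.
by rewrite (_ : i == ord0 = false) ?mulr0 ?add0r//; apply/eqP => i0; move: ij; rewrite i0.
Qed.

Lemma cons_rV_shiftS (h t : R) y (i : 'I_n) :
  h *: e_ (lift ord0 i) + cons_rV (t, y) = cons_rV (t, h *: e_ i + y).
Proof.
apply/rowP => j; rewrite !mxE eqxx/=.
case: splitP => k jk; rewrite ?mxE ?eqxx/=.
  rewrite (_ : j == _ = false) ?mulr0 ?add0r//; apply/eqP => jE; move: jk.
  by rewrite jE (ord1 k).
congr (h * _ + _); congr (nat_of_bool _)%:R.
apply/idP/idP => /eqP E; apply/eqP/val_inj.
  by move: jk; rewrite E /= /bump /= !add1n => -[].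
by rewrite /= jk E.
Qed.

Lemma continuous_cons_rV : continuous (@cons_rV R n).
Proof.
move=> u; apply/cvg_ballP => e e0; near=> v.
have [uv1 uv2] : ball u e v.
  by near: v; exact: (@nbhsx_ballx _ _ u e e0).
split => // i j; rewrite !mxE; case: splitP => k _; first by rewrite !mxE.
by case: uv2 => _; exact.
Unshelve. all: by end_near. Qed.

Lemma continuous_slice1 u y : continuous u -> continuous (fun t => u (cons_rV (t, y))).
Proof.
move=> cu t; apply: (@continuous_comp _ _ _ (fun t => cons_rV (t, y)) u); last exact: cu.
apply: (@continuous_comp _ _ _ (fun t => (t, y)) (@cons_rV R n)); last exact: continuous_cons_rV.
exact: continuous_pairl.
Qed.

Lemma continuous_slice2 u t : continuous u -> continuous (fun y => u (cons_rV (t, y))).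
Proof.
move=> cu y; apply: (@continuous_comp _ _ _ (fun y => cons_rV (t, y)) u); last exact: cu.
apply: (@continuous_comp _ _ _ (fun y => (t, y)) (@cons_rV R n)); last exact: continuous_cons_rV.
exact: continuous_pairr.
Qed.

Lemma is_derive_slice1 u y t : c1c u ->
  is_derive t 1 (fun t => u (cons_rV (t, y))) (partial ord0 u (cons_rV (t, y))).
Proof.
move=> cu; apply/is_derive_line.
rewrite (_ : (fun h => _) = fun h => u (h *: e_ ord0 + cons_rV (t, y))).
  apply: ((is_derive_line _ _ _ _).1); apply: derivableP.
  exact: c1c_derivable.
by apply/funext => h; rewrite cons_rV_shift0 [h%:A]mulr1.
Qed.

Lemma is_derive_slice2 u y t i : c1c u ->
  is_derive y (e_ i) (fun y => u (cons_rV (t, y)))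
    (partial (lift ord0 i) u (cons_rV (t, y))).
Proof.
move=> cu; apply/is_derive_line.
rewrite (_ : (fun h => _) = fun h => u (h *: e_ (lift ord0 i) + cons_rV (t, y))).
  apply: ((is_derive_line _ _ _ _).1); apply: derivableP.
  exact: c1c_derivable.
by apply/funext => h; rewrite cons_rV_shiftS.
Qed.

Lemma partial_slice2 u y t i : c1c u ->
  partial i (fun y => u (cons_rV (t, y))) y =
  partial (lift ord0 i) u (cons_rV (t, y)).
Proof. by move=> cu; have [_] := is_derive_slice2 y t i cu. Qed.

Lemma c1c_slice2 u t : c1c u -> c1c (fun y => u (cons_rV (t, y))).
Proof.
move=> cu; split.
- exact/continuous_slice2/c1c_continuous.
- by move=> i y; have [] := is_derive_slice2 y t i cu.
- move=> i; rewrite (_ : partial i _ = fun y => partial (lift ord0 i) u (cons_rV (t, y))).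
    exact/continuous_slice2/c1c_continuous_partial.
  by apply/funext => y; exact: partial_slice2.
- have [M uM] := c1c_support cu; exists M => y yM; apply: uM => /box_cons[_].
  exact: yM.
Qed.

End slices.

Section ftc.
Context {R : realType}.
Local Notation leb1 := (@lebesgue_measure R).
Variables (g g' : R -> R).
Hypothesis dg : forall t : R, is_derive t (1 : R) g (g' t).
Hypothesis cg' : continuous g'.

Lemma ftc_segment (a b : R) : a < b ->
  (\int[leb1]_(t in `[a, b]) (g' t)%:E)%E = (g b - g a)%:E.
Proof.
move=> ab; have cg : continuous g.
  move=> t; apply/differentiable_continuous/derivable1_diffP.
  by have [] := dg t.
rewrite (continuous_FTC2 (F := g) ab) ?EFinB//.
- exact: continuous_subspaceT.
- split.
  + by move=> t _; have [] := dg t.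
  + by apply: cvg_at_right_filter; exact: cg.
  + by apply: cvg_at_left_filter; exact: cg.
- by move=> t _; rewrite derive1E; have [_ ->] := dg t.
Qed.

Lemma integral_derive_eq0 M : (forall t, M < `|t| -> g t = 0) ->
  (\int[leb1]_t (g' t)%:E)%E = 0%E.
Proof.
(* The maximum with 0 makes [[-N, N]] nondegenerate, and the [+ 1] puts its endpoints strictly
   beyond [M], where [g] vanishes. *)
move=> g0; pose N := Num.max M 0 + 1.
have MN : M < N by rewrite /N ltr_pwDr// le_max lexx.
have N0 : 0 < N by rewrite /N ltr_pwDr// le_max lexx orbT.
have g'0 t : N < `|t| -> g' t = 0.
  move=> Nt; have [_ <-] := dg t.
  rewrite (@near_eq_derive _ _ _ g (cst 0)) ?derive_cst//.
  have : \forall s \near t, N < `|s|.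
    exact: (cvgr_gt _ (@norm_continuous _ _ t)).
  by apply: filterS => s /= /(lt_trans MN)/g0.
transitivity (\int[leb1]_(t in `[(- N)%R, N]) (g' t)%:E)%E.
  rewrite [RHS]integral_mkcond; apply: eq_integral => t _.
  rewrite patchE; case: ifPn => // /negP tN; rewrite g'0// ltNge.
  apply/negP => h; apply: tN; apply/mem_set.
  by rewrite /= in_itv/= -ler_norml.
have NN : - N < N by rewrite -subr_gt0 opprK addr_gt0.
by rewrite ftc_segment// !g0 ?subrr// ?normrN gtr0_norm.
Qed.

(** Integrate [g'] from a point [a] to the left of both the support and [t]: there [g] vanishes. *)
Lemma le_integral_derive M : (forall t, M < `|t| -> g t = 0) ->
  forall t, ((g t)%:E <= \int[leb1]_s (`|g' s|)%:E)%E.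
Proof.
move=> g0 t; pose a := Num.min (- (Num.max M 0 + 1)) (t - 1).
have ta : a < t.
  have : a <= t - 1 by rewrite /a ge_min lexx orbT.
  by move=> h; rewrite (le_lt_trans h)// gtrBl.
have ga : g a = 0.
  apply: g0.
  have h : a <= - (Num.max M 0 + 1) by rewrite /a ge_min lexx.
  have h2 : M < Num.max M 0 + 1 by rewrite ltr_pwDr// le_max lexx.
  have h3 : 0 < Num.max M 0 + 1 by rewrite ltr_pwDr// le_max lexx orbT.
  rewrite ltr0_norm; first by rewrite (lt_le_trans h2)// lerNr.
  by rewrite (le_lt_trans h)// oppr_lt0.
have mg' : measurable_fun setT g' by exact: continuous_measurable_fun.
rewrite -[g t]subr0 -{1}ga -ftc_segment//.
apply: (@le_trans _ _ (\int[leb1]_(s in `[a, t]) (`|g' s|)%:E)%E).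
  apply: (le_trans (lee_abs _)); apply: le_abse_integral => //.
  by apply/measurable_EFinP; exact: measurable_funTS.
apply: ge0_subset_integral => //.
by apply/measurable_EFinP; apply: measurableT_comp.
Qed.

End ftc.

Section integral_partial.
Context {R : realType}.
Local Open Scope ereal_scope.

(** If the differentiated coordinate is the first one, the swapped Fubini theorem integrates it
    first and the one-dimensional case applies; otherwise the induction hypothesis applies to the
    slices. *)
Lemma integral_partial_eq0 n (u : 'rV[R]_n -> R) (i : 'I_n) : c1c u ->
  \int[@lebesgue_rV R n]_x (partial i u x)%:E = 0.
Proof.
elim: n u i => [u []//|n ih u i cu].
have int_u := c1c_integrable_partial i cu.
have [->|[j ->]] : i = ord0 \/ exists j, i = lift ord0 j.
  by case: (unliftP ord0 i) => [j ->|->]; [right; exists j|left].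
  rewrite fubini_rV_swap; last exact: c1c_integrable_partial.
  have [M uM] := c1c_support cu.
  rewrite integral0_eq// => y _.
  apply: (@integral_derive_eq0 _ (fun t => u (cons_rV (t, y))) _ _ _ M).
  - by move=> t; exact: is_derive_slice1.
  - exact/continuous_slice1/c1c_continuous_partial.
  - by move=> t Mt; apply: uM => /box_cons[]; rewrite leNgt Mt.
rewrite fubini_rV; last exact: c1c_integrable_partial.
rewrite integral0_eq// => t _.
rewrite -[RHS](ih _ j (c1c_slice2 t cu)); apply: eq_integral => y _.
by rewrite partial_slice2.
Qed.

End integral_partial.

(** * The Gagliardo-Nirenberg-Sobolev inequality *)

Section gagliardo.
Context {R : realType}.
Local Notation leb1 := (@lebesgue_measure R).
Local Notation leb := (@lebesgue_rV R).
Local Open Scope ereal_scope.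

(** The l^1 norm of the gradient: dropping some of the directions only decreases it, so first
    coordinate and slices can be treated separately. *)
Definition grad1 n (u : 'rV[R]_n -> R) (x : 'rV[R]_n) : R :=
  (\sum_(i < n) `|partial i u x|)%R.

Lemma grad1_ge0 n (u : 'rV[R]_n -> R) x : (0 <= grad1 u x)%R.
Proof. exact: sumr_ge0. Qed.

Lemma c1c_measurable n (u : 'rV[R]_n -> R) : c1c u -> measurable_fun setT u.
Proof. by move=> cu; apply: continuous_measurable_rV; exact: c1c_continuous. Qed.

Lemma measurable_partial n (u : 'rV[R]_n -> R) i : c1c u ->
  measurable_fun setT (partial i u).
Proof. by move=> cu; apply: continuous_measurable_rV; exact: c1c_continuous_partial. Qed.

Lemma measurable_grad1 n (u : 'rV[R]_n -> R) : c1c u ->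
  measurable_fun setT (grad1 u).
Proof.
move=> cu; apply: measurable_sum => i.
by apply: measurableT_comp => //; exact: measurable_partial.
Qed.

Lemma integral_grad1_fin n (u : 'rV[R]_n -> R) : c1c u ->
  \int[leb n]_x (grad1 u x)%:E < +oo.
Proof.
move=> cu; under eq_integral do rewrite /grad1 -sumEFin.
rewrite ge0_integral_sum//; last first.
  move=> i; apply/measurable_EFinP; apply: measurableT_comp => //.
  exact: measurable_partial.
apply: lte_sum_pinfty => i _.
by have /integrableP[] := c1c_integrable_partial i cu.
Qed.

(** Both sides are homogeneous in [u], so only gradients of mass at most 1 need to be considered. *)
Lemma gagliardo_scale n (V : 'rV[R]_n -> R) : measurable_fun setT V ->
  (forall x, 0 <= V x)%R ->
  (forall u, c1c u -> (forall x, 0 <= u x)%R ->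
    \int[leb n]_x (grad1 u x)%:E <= 1 -> \int[leb n]_x (V x * u x)%:E <= 1) ->
  forall u, c1c u -> (forall x, 0 <= u x)%R ->
    \int[leb n]_x (V x * u x)%:E <= \int[leb n]_x (grad1 u x)%:E.
Proof.
move=> mV V0 H u cu u0.
have Nfin := integral_grad1_fin cu.
have N0 : 0 <= \int[leb n]_x (grad1 u x)%:E.
  by apply: integral_ge0 => x _; rewrite lee_fin grad1_ge0.
have mu : measurable_fun setT u by exact: c1c_measurable.
move: N0 Nfin; case E : (\int[leb n]_x (grad1 u x)%:E) => [N| |]// N0 _.
(* Dividing by [N + e] instead of [N] also covers a gradient whose integral is 0. *)
apply/lee_addgt0Pr => e e0; rewrite -EFinD.
have k0 : (0 < N + e)%R by rewrite ltr_wpDl.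
have := H (fun x => (N + e)^-1 * u x)%R.
have -> : \int[leb n]_x (V x * ((N + e)^-1 * u x))%:E =
    (N + e)^-1%:E * \int[leb n]_x (V x * u x)%:E.
  rewrite -ge0_integralZl_EFin//.
  - by apply: eq_integral => x _; rewrite -EFinM mulrCA.
  - by move=> x _; rewrite lee_fin mulr_ge0.
  - by apply/measurable_EFinP; exact: measurable_funM.
  - by rewrite invr_ge0 ltW.
have -> : \int[leb n]_x (grad1 (fun x => (N + e)^-1 * u x)%R x)%:E =
    (N + e)^-1%:E * \int[leb n]_x (grad1 u x)%:E.
  rewrite -ge0_integralZl_EFin//.
  - apply: eq_integral => x _; rewrite -EFinM /grad1 mulr_sumr; congr EFin.
    apply: eq_bigr => i _; rewrite partialZ// normrM gtr0_norm ?invr_gt0//.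
  - by move=> x _; rewrite lee_fin grad1_ge0.
  - by apply/measurable_EFinP; exact: measurable_grad1.
  - by rewrite invr_ge0 ltW.
rewrite E -EFinM lee_fin => /(_ (c1cZ _ cu)).
have -> : ((N + e)^-1 * N <= 1)%R by rewrite ler_pdivrMl// mulr1 lerDl ltW.
move=> /(_ _ isT) h.
rewrite -[leLHS]mul1e -(divff (lt0r_neq0 k0)) EFinM -muleA.
rewrite -[leRHS]mule1 lee_wpmul2l ?lee_fin ?(ltW k0)//.
by apply: h => x; rewrite mulr_ge0// invr_ge0 ltW.
Qed.

Lemma integrable_slice1 n (f : 'rV[R]_n.+1 -> R) M (y : 'rV[R]_n) :
  continuous f -> (forall x, ~ box M x -> f x = 0%R) ->
  \int[leb1]_t `|f (cons_rV (t, y))|%:E < +oo.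
Proof.
move=> cf fM.
have : leb1.-integrable `[(- M)%R, M] (EFin \o (fun t => f (cons_rV (t, y)))).
  apply: continuous_compact_integrable; first exact: segment_compact.
  by apply: continuous_subspaceT; exact: continuous_slice1.
move=> /integrableP[_].
rewrite integral_mkcond.
rewrite (_ : _ \_ _ = fun t => `|f (cons_rV (t, y))|%:E)//.
apply/funext => t; rewrite patchE; case: ifPn => // /negP tM.
rewrite fM ?normr0// => /box_cons[tM' _]; apply: tM; apply/mem_set => /=.
by rewrite in_itv/= -ler_norml.
Qed.

(** The bound on the right is independent of [t]; this uniformity in the first coordinate drives the
    induction in [gagliardo]. *)
Lemma le_slice1 n (u : 'rV[R]_n.+1 -> R) t (y : 'rV[R]_n) : c1c u ->
  (u (cons_rV (t, y)))%:E <= \int[leb1]_s `|partial ord0 u (cons_rV (s, y))|%:E.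
Proof.
move=> cu; have [M uM] := c1c_support cu.
apply: (@le_integral_derive R (fun t => u (cons_rV (t, y))) _ _ _ M).
- by move=> s; exact: is_derive_slice1.
- exact/continuous_slice1/c1c_continuous_partial.
- by move=> s Ms; apply: uM => /box_cons[]; rewrite leNgt Ms.
Qed.

Lemma integral_partial0_le n (u : 'rV[R]_n.+1 -> R) : c1c u ->
  \int[leb n]_y \int[leb1]_s `|partial ord0 u (cons_rV (s, y))|%:E <=
  \int[leb n.+1]_x (grad1 u x)%:E.
Proof.
move=> cu.
have mp : measurable_fun setT (fun x => `|partial ord0 u x|%:E).
  apply/measurable_EFinP; apply: measurableT_comp => //.
  exact: measurable_partial.
rewrite -(tonelli_rV_swap mp)//.
apply: ge0_le_integral => //.
- by apply/measurable_EFinP; exact: measurable_grad1.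
- by move=> x _; rewrite lee_fin /grad1 big_ord_recl lerDl sumr_ge0.
Qed.

Lemma measurable_int_partial0 n (u : 'rV[R]_n.+1 -> R) : c1c u ->
  measurable_fun setT
    (fun y : 'rV[R]_n => \int[leb1]_s `|partial ord0 u (cons_rV (s, y))|%:E).
Proof.
move=> cu.
pose f : measurableTypeR R * 'rV[R]_n -> \bar R :=
  fun z => `|partial ord0 u (cons_rV z)|%:E.
have mf : measurable_fun setT f.
  apply: (@measurableT_comp _ _ _ _ _ _ (fun x => `|partial ord0 u x|%:E)).
    apply/measurable_EFinP; apply: measurableT_comp => //.
    exact: measurable_partial.
  exact: measurable_cons_rV.
have f0 z : 0 <= f z by rewrite /f lee_fin.
exact: (@measurable_fun_fubini_tonelli_G _ _ _ _ R leb1 f mf f0).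
Qed.

Lemma integral_grad1_slice_le n (u : 'rV[R]_n.+1 -> R) : c1c u ->
  \int[leb1]_t \int[leb n]_y (grad1 (fun y => u (cons_rV (t, y))) y)%:E <=
  \int[leb n.+1]_x (grad1 u x)%:E.
Proof.
move=> cu.
pose h x := (\sum_(i < n) `|partial (lift ord0 i) u x|)%R.
have mh : measurable_fun setT (fun x => (h x)%:E).
  apply/measurable_EFinP; apply: measurable_sum => i.
  by apply: measurableT_comp => //; exact: measurable_partial.
have h0 x : 0 <= (h x)%:E by rewrite lee_fin sumr_ge0.
rewrite (_ : \int[leb1]_t _ = \int[leb n.+1]_x (h x)%:E).
  apply: ge0_le_integral => //.
  - by apply/measurable_EFinP; exact: measurable_grad1.
  - by move=> x _; rewrite lee_fin /grad1 big_ord_recl lerDr.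
rewrite (tonelli_rV mh h0); apply: eq_integral => t _; apply: eq_integral => y _.
by congr EFin; apply: eq_bigr => i _; rewrite partial_slice2.
Qed.

Lemma measurable_int_slice2 n (f : 'rV[R]_n.+1 -> \bar R) :
  measurable_fun setT f -> (forall x, 0 <= f x) ->
  measurable_fun setT
    (fun t : measurableTypeR R => \int[leb n]_y f (cons_rV (t, y))).
Proof.
move=> mf f0.
pose g : measurableTypeR R * 'rV[R]_n -> \bar R := fun z => f (cons_rV z).
have mg : measurable_fun setT g.
  by apply: measurableT_comp => //; exact: measurable_cons_rV.
exact: (@measurable_fun_fubini_tonelli_F _ _ _ _ R (leb n) g mg (fun z => f0 _)).
Qed.

Lemma integral_rV1 (f : 'rV[R]_1 -> \bar R) :
  measurable_fun setT f -> (forall x, 0 <= f x) ->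
  \int[leb 1]_x f x = \int[leb1]_t f (cons_rV (t, 0%R)).
Proof.
move=> mf f0; rewrite (tonelli_rV mf f0); apply: eq_integral => t _.
rewrite integral_dirac//; last exact: (measurable_slice2 t mf).
by rewrite diracT mul1e.
Qed.

(* Dual form of the embedding of W^{1,1} into L^q, q = N / (N - 1), where
   N = n + 1 is the dimension. Once the gradient of [u] is normalized, the
   induction hypothesis is applied to the slices [u (t, .)] with the weight
   [W = (int |d_0 u|)^{1/(N-1)}], which dominates [u^{q-1}]; this bounds
   [int u^q], and Young's inequality concludes. *)
Lemma gagliardo n (u V : 'rV[R]_n.+1 -> R) : c1c u -> (forall x, 0 <= u x)%R ->
  measurable_fun setT V -> (forall x, 0 <= V x)%R ->
  \int[leb n.+1]_x (V x ^+ n.+1)%:E <= 1 ->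
  \int[leb n.+1]_x (V x * u x)%:E <= \int[leb n.+1]_x (grad1 u x)%:E.
Proof.
elim: n u V => [|n ih] u V cu u0 mV V0 V1.
  have mu : measurable_fun setT u by exact: c1c_measurable.
  have mVu : measurable_fun setT (fun x => (V x * u x)%:E).
    by apply/measurable_EFinP; exact: measurable_funM.
  have Vu0 x : 0 <= (V x * u x)%:E by rewrite lee_fin mulr_ge0.
  have mg : measurable_fun setT (fun x => (grad1 u x)%:E).
    by apply/measurable_EFinP; exact: measurable_grad1.
  have g0 x : 0 <= (grad1 u x)%:E by rewrite lee_fin grad1_ge0.
  have mV' : measurable_fun setT (fun x => (V x ^+ 1)%:E).
    by under eq_fun do rewrite expr1; exact/measurable_EFinP.
  rewrite (integral_rV1 mg g0) (integral_rV1 mVu Vu0).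
  set G := (X in _ <= X).
  have G0 : 0 <= G by apply: integral_ge0 => t _; exact: g0.
  (* In dimension 1 the function is everywhere at most [G], the mass of its derivative, and [V] has
     mass at most 1. *)
  apply: (@le_trans _ _ (\int[leb1]_t (G * (V (cons_rV (t, 0%R)) ^+ 1)%:E))).
    apply: ge0_le_integral => //.
    - exact: (measurable_slice1 0%R mVu).
    - by apply: emeasurable_funM => //; exact: (measurable_slice1 0%R mV').
    - move=> t _; rewrite expr1 mulrC EFinM lee_wpmul2r ?lee_fin//.
      apply: (le_trans (le_slice1 t 0%R cu)).
      rewrite le_eqVlt; apply/orP; left; apply/eqP.
      by apply: eq_integral => s _; rewrite /grad1 big_ord1.
  rewrite ge0_integralZl//.
  - rewrite -[leRHS]mule1 lee_wpmul2l//.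
    have V1' x : 0 <= (V x ^+ 1)%:E by rewrite lee_fin expr1.
    by rewrite -(integral_rV1 mV' V1').
  - exact: (measurable_slice1 0%R mV').
  - by move=> t _; rewrite lee_fin expr1.
move: u cu u0; apply: gagliardo_scale => // u cu u0 u1.
have mu : measurable_fun setT u by exact: c1c_measurable.
(* The conjugate exponents N and N / (N - 1) for the dimension N = n + 2 of this step. *)
pose p : R := n.+2%:R; pose q : R := (n.+2%:R / n.+1%:R)%R.
pose G (y : 'rV[R]_n.+1) := \int[leb1]_s `|partial ord0 u (cons_rV (s, y))|%:E.
have G0 y : 0 <= G y by apply: integral_ge0 => s _; rewrite lee_fin.
have Gfin y : G y < +oo.
  have [M pM] := c1c_partial_support ord0 cu.
  by apply: (integrable_slice1 _ _ pM); exact: c1c_continuous_partial.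
have mG : measurable_fun setT G by exact: measurable_int_partial0.
pose W (y : 'rV[R]_n.+1) : R := (fine (G y) `^ (n.+1%:R^-1))%R.
have W0 y : (0 <= W y)%R by exact: powR_ge0.
have mW : measurable_fun setT W.
  apply: (@measurableT_comp _ _ _ _ _ _ (fun x : R => x `^ (n.+1%:R^-1))%R).
    exact: measurable_powR.
  by apply: measurableT_comp => //; exact: fine_measurable.
have WG y : (W y ^+ n.+1)%:E = G y.
  rewrite /W -powR_mulrn ?powR_ge0// -powRrM mulVf ?pnatr_eq0//.
  by rewrite powRr1 ?fine_ge0// fineK// ge0_fin_numE.
(* The normalization enters here: [W ^+ n.+1] is [G], whose mass is at most that of the gradient. *)
have W1 : \int[leb n.+1]_y (W y ^+ n.+1)%:E <= 1.
  under eq_integral do rewrite WG.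
  exact: le_trans (integral_partial0_le cu) u1.
have uq x : (u x `^ q = u x * u x `^ (n.+1%:R^-1))%R.
  have -> : q = (1 + n.+1%:R^-1)%R.
    by rewrite /q -[n.+2]addn1 natrD mulrDl divff ?pnatr_eq0// div1r.
  rewrite powRD ?powRr1//; apply/implyP.
  by rewrite paddr_eq0 ?invr_ge0// oner_eq0.
have Uq : \int[leb n.+2]_x (u x `^ q)%:E <= 1.
  have muq : measurable_fun setT (fun x => (u x `^ q)%:E).
    apply/measurable_EFinP.
    apply: (@measurableT_comp _ _ _ _ _ _ (fun x : R => x `^ q)%R).
      exact: measurable_powR.
    exact: mu.
  have uq0 x : 0 <= (u x `^ q)%:E by rewrite lee_fin powR_ge0.
  rewrite (tonelli_rV muq uq0).
  apply: le_trans (le_trans (integral_grad1_slice_le cu) u1).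
  apply: ge0_le_integral => //.
  - by move=> t _; apply: integral_ge0 => y _; rewrite lee_fin powR_ge0.
  - exact: (measurable_int_slice2 muq uq0).
  - rewrite (_ : (fun t => _) = fun t => \int[leb n.+1]_y
        (\sum_(i < n.+1) `|partial (lift ord0 i) u (cons_rV (t, y))|)%:E).
      apply: (measurable_int_slice2 (f := fun x =>
        (\sum_(i < n.+1) `|partial (lift ord0 i) u x|)%:E)).
        apply/measurable_EFinP; apply: measurable_sum => i.
        by apply: measurableT_comp => //; exact: measurable_partial.
      by move=> x; rewrite lee_fin sumr_ge0.
    apply/funext => t; apply: eq_integral => y _; congr EFin.
    by apply: eq_bigr => i _; rewrite partial_slice2.
  move=> t _.
  have cs := c1c_slice2 t cu.
  apply: le_trans (ih _ W cs (fun y => u0 _) mW W0 W1).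
  apply: ge0_le_integral => //.
  - exact: (measurable_slice2 t muq).
  - apply/measurable_EFinP; apply: measurable_funM => //.
    exact: (measurable_slice2 t mu).
  (* As q - 1 = 1 / (N - 1), raising u <= G to this power gives u^q <= W u, the integrand of the
     induction hypothesis. *)
  - move=> y _; rewrite lee_fin uq mulrC ler_wpM2r//.
    apply: ge0_ler_powR; rewrite ?nnegrE ?invr_ge0//.
      by rewrite fine_ge0.
    by rewrite -lee_fin fineK ?ge0_fin_numE//; exact: le_slice1.
have p0 : (0 < p)%R by rewrite ltr0n.
have q0 : (0 < q)%R by rewrite divr_gt0// ltr0n.
have pq : (p^-1 + q^-1 = 1)%R.
  rewrite /p /q invf_div -[X in (X + _)%R]div1r -mulrDl.
  by rewrite -[1%R]/(1%:R) -natrD add1n divff// pnatr_eq0.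
(* Split according to Young's inequality V u <= V^p / p + u^q / q, both integrals on the right being
   at most 1. *)
have -> : 1 = p^-1%:E * 1 + q^-1%:E * 1 :> \bar R by rewrite !mule1 -EFinD pq.
apply: (@le_trans _ _ (p^-1%:E * \int[leb n.+2]_x (V x ^+ n.+2)%:E +
   q^-1%:E * \int[leb n.+2]_x (u x `^ q)%:E)); last first.
  by apply: leeD; apply: lee_wpmul2l => //; rewrite lee_fin invr_ge0 ltW.
have mVp : measurable_fun setT (fun x => (V x ^+ n.+2)%:E).
  by apply/measurable_EFinP; exact: measurable_funX.
have muq : measurable_fun setT (fun x => (u x `^ q)%:E).
  apply/measurable_EFinP.
  apply: (@measurableT_comp _ _ _ _ _ _ (fun x : R => x `^ q)%R).
    exact: measurable_powR.
  exact: mu.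
rewrite -!ge0_integralZl_EFin ?invr_ge0 ?(ltW p0) ?(ltW q0)//; first last.
- by move=> x _; rewrite lee_fin exprn_ge0.
- by move=> x _; rewrite lee_fin powR_ge0.
rewrite -ge0_integralD//; first last.
- exact: measurable_funeM.
- by move=> x _; rewrite mule_ge0// lee_fin ?invr_ge0 ?(ltW q0)// powR_ge0.
- exact: measurable_funeM.
- by move=> x _; rewrite mule_ge0// lee_fin ?invr_ge0 ?(ltW p0)// exprn_ge0.
apply: ge0_le_integral => //.
- by move=> x _; rewrite lee_fin mulr_ge0.
- by apply/measurable_EFinP; exact: measurable_funM.
- by apply: emeasurable_funD; exact: measurable_funeM.
move=> x _; rewrite -!EFinM -EFinD lee_fin.
have := conjugate_powR (V0 x) (u0 x) p0 q0 pq.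
by rewrite powR_mulrn// => /le_trans; apply; rewrite ![(_^-1 * _)%R]mulrC.
Qed.

End gagliardo.

(** * Density of test functions in weighted L^1 *)

Section boxes.
Context {R : realType} {n : nat}.
Implicit Types (l r : 'I_n -> R).

(** The bounds are arbitrary, so a box may be empty. This makes the family closed under
    intersection, as a pi-system has to be. *)
Definition obox l r : set 'rV[R]_n :=
  [set x | forall i, l i < x ord0 i < r i].

Definition cbox l r : set 'rV[R]_n :=
  [set x | forall i, l i <= x ord0 i <= r i].

Lemma subset_obox_cbox l r : obox l r `<=` cbox l r.
Proof. by move=> x h i; have /andP[/ltW -> /ltW ->] := h i. Qed.

Lemma compact_cbox l r : compact (cbox l r).
Proof.
rewrite (_ : cbox l r = [set v | forall i, `[l i, r i]%classic (v ord0 i)]).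
  apply: (@rV_compact _ _ (fun i => `[l i, r i]%classic)).
  by move=> i; exact: segment_compact.
by apply/seteqP; split => x h i; have := h i; rewrite /= in_itv.
Qed.

Lemma closed_cbox l r : closed (cbox l r).
Proof. by apply: compact_closed; [exact: norm_hausdorff|exact: compact_cbox]. Qed.

Lemma ball_obox (x : 'rV[R]_n) (e : R) : 0 < e ->
  ball x e = obox (fun i => x ord0 i - e) (fun i => x ord0 i + e).
Proof.
move=> e0; apply/seteqP; split => y.
  by move=> [_ h] i; have := h ord0 i; rewrite /ball/= ltr_distlC.
by move=> h; split=> // i j; rewrite (ord1 i) /ball/= ltr_distlC; exact: h.
Qed.

Lemma obox_setI l1 r1 l2 r2 : obox l1 r1 `&` obox l2 r2 =
  obox (fun i => Num.max (l1 i) (l2 i)) (fun i => Num.min (r1 i) (r2 i)).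
Proof.
apply/seteqP; split => [x [h1 h2] i|x h].
  by rewrite gt_max lt_min; case/andP: (h1 i) (h2 i) => -> -> /andP[-> ->].
by split => i; have := h i; rewrite gt_max lt_min 
  => /andP[/andP[? ?] /andP[? ?]]; apply/andP.
Qed.

Lemma open_obox l r : open (obox l r).
Proof.
rewrite openE => x h.
exists (fun (_ : 'I_1) i => `]l i, r i[%classic).
  move=> /= i j; apply: open_nbhs_nbhs; split; first exact: interval_open.
  by rewrite /= in_itv/= (ord1 i); exact: h.
by move=> y /= hy i; have := hy ord0 i; rewrite in_itv.
Qed.

Lemma measurable_obox l r : measurable (obox l r).
Proof. by apply: open_measurable_rV; exact: open_obox. Qed.

(** A countable base of the topology, with rational centres and inverse integers as radii; being
    balls of the sup norm, its members are open boxes. *)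
Definition rat_ball (t : 'rV[rat]_n * nat) : set 'rV[R]_n :=
  ball (map_mx ratr t.1 : 'rV[R]_n) t.2.+1%:R^-1.

Lemma rat_ball_near (x : 'rV[R]_n) (e : R) : 0 < e ->
  exists2 t, rat_ball t x & rat_ball t `<=` ball x e.
Proof.
move=> e0.
have [k ke] : exists k : nat, k.+1%:R^-1 < e / 2.
  exists (Num.truncn (e / 2)^-1).
  rewrite invf_plt ?posrE ?divr_gt0 ?ltr0n//.
  exact: truncnS_gt.
have k0 : (0 : R) < k.+1%:R^-1 by rewrite invr_gt0 ltr0n.
have [q qx] := rat_near_rV x k0.
exists (q, k) => // y ty.
apply: (@ball_splitr _ _ (map_mx ratr q : 'rV[R]_n)).
  exact: le_ball (ltW ke) _ qx.
exact: le_ball (ltW ke) _ ty.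
Qed.

Lemma rat_ball_gt0 (k : nat) : (0 : R) < k.+1%:R^-1.
Proof. by rewrite invr_gt0 ltr0n. Qed.

Lemma open_bigcup_rat_ball (U : set 'rV[R]_n) : open U ->
  U = \bigcup_t (if `[< rat_ball t `<=` U >] then rat_ball t else set0).
Proof.
move=> oU; apply/seteqP; split => [x Ux|x [t _]]; last first.
  by case: ifPn => // /asboolP; exact.
have : nbhs x U by apply: open_nbhs_nbhs.
rewrite -nbhs_ballE => -[e/= e0 eU].
have [t tx te] := rat_ball_near x e0.
exists t => //; rewrite ifT//; apply/asboolP.
exact: subset_trans te eU.
Qed.

(** Every open set is a countable union of rational balls, which are boxes. The pi-lambda theorem
    can therefore start from boxes. *)
Lemma measurable_rV_obox : @measurable _ 'rV[R]_n =
  <<s [set A | exists l r, A = obox l r] >>.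
Proof.
rewrite eqEsubset; split.
  apply: smallest_sub; first exact: smallest_sigma_algebra.
  move=> U oU; rewrite (open_bigcup_rat_ball oU).
  pose T := g_sigma_algebraType [set A : set 'rV[R]_n | exists l r, A = obox l r].
  apply: (@countable_bigcupT_measurable _ T) => // t.
  case: ifPn => // _; apply: sub_sigma_algebra.
  by rewrite /rat_ball ball_obox ?rat_ball_gt0//; do 2 eexists.
apply: smallest_sub; first exact: sigma_algebra_measurable.
move=> _ [l [r ->]]; exact: measurable_obox.
Qed.

(** Lindelof's argument: the given balls may be shrunk to rational ones, of which there are only
    countably many. *)
Lemma locally_negligible (A : set 'rV[R]_n) :
  (forall x, A x -> exists2 e, 0 < e & (@lebesgue_rV R n).-negligible (A `&` ball x e)) ->
  (@lebesgue_rV R n).-negligible A.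
Proof.
move=> h.
pose F t := if pselect ((@lebesgue_rV R n).-negligible (A `&` rat_ball t))
  then A `&` rat_ball t else set0.
have AF : A `<=` \bigcup_t F t.
  move=> x Ax; have [e e0 xe] := h x Ax.
  have [t tx te] := rat_ball_near x e0.
  exists t => //; rewrite /F; case: pselect => //= nt; exfalso; apply: nt.
  by apply: negligibleS xe; exact: setIS.
apply: (negligibleS AF).
have [f fP] : exists f : nat -> 'rV[rat]_n * nat, forall t, exists k, f k = t.
  exists (fun k => odflt (0, 0%N) (unpickle k)) => t.
  by exists (pickle t); rewrite pickleK.
have -> : \bigcup_t F t = \bigcup_k F (f k).
  apply/seteqP; split => x [t _ Ft]; last by exists (f t).
  by have [k fk] := fP t; exists k => //; rewrite fk.
apply: negligible_bigcup => k; rewrite /F; case: pselect => // ?.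
exact: negligible_set0.
Qed.

End boxes.

Section bump.
Context {R : realType} {n : nat}.
Implicit Types (l r : 'I_n -> R).

(** One factor e^{-1/t} per face of the box, with t equal to [k.+1] times the signed distance to
    that face. Inside the box every t tends to infinity with [k], so the bumps converge to the
    indicator of the box. *)
Definition bump l r (k : nat) (x : 'rV[R]_n) : R :=
  \prod_(i < n) (flat 1 (k.+1%:R * x ord0 i + - (k.+1%:R * l i)) *
                 flat 1 (- k.+1%:R * x ord0 i + k.+1%:R * r i)).

Lemma smooth_bump l r k : smooth (bump l r k).
Proof.
apply: smooth_prod => i; apply: (@smoothM _ _
  (fun x : 'rV[R]_n => flat 1 (k.+1%:R * x ord0 i + - (k.+1%:R * l i)))
  (fun x : 'rV[R]_n => flat 1 (- k.+1%:R * x ord0 i + k.+1%:R * r i)));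
exact: smooth_flat.
Qed.

Lemma flat1_itv (t : R) : 0 <= flat 1 t <= 1.
Proof.
rewrite /flat; case: ifPn => t0; last by rewrite lexx ler01.
rewrite hornerC mul1r expR_ge0/= -expR0 ler_expR oppr_le0 invr_ge0 ltW//.
Qed.

Lemma bump_itv l r k x : 0 <= bump l r k x <= 1.
Proof.
have h i : 0 <= flat 1 (k.+1%:R * x ord0 i + - (k.+1%:R * l i)) *
                 flat 1 (- k.+1%:R * x ord0 i + k.+1%:R * r i) <= 1.
  have /andP[a0 a1] := flat1_itv (k.+1%:R * x ord0 i + - (k.+1%:R * l i)).
  have /andP[b0 b1] := flat1_itv (- k.+1%:R * x ord0 i + k.+1%:R * r i).
  by rewrite mulr_ge0//= mulr_ile1.
rewrite /bump prodr_ile1 ?andbT; last by move=> i _; exact: h.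
by apply: prodr_ge0 => i _; have /andP[] := h i.
Qed.

Lemma bump_off l r k x : ~ obox l r x -> bump l r k x = 0.
Proof.
move=> h; have [i hi] : exists i, ~ (l i < x ord0 i < r i) by exact/existsNP.
have k0 : (0 : R) < k.+1%:R by rewrite ltr0n.
apply/eqP; rewrite /bump prodf_seq_eq0; apply/hasP; exists i.
  by rewrite mem_index_enum.
have E1 : k.+1%:R * x ord0 i + - (k.+1%:R * l i) = k.+1%:R * (x ord0 i - l i).
  by rewrite mulrBr.
have E2 : - k.+1%:R * x ord0 i + k.+1%:R * r i = k.+1%:R * (r i - x ord0 i).
  by rewrite mulrBr mulNr addrC.
rewrite /= mulf_eq0 /flat E1 E2 !pmulr_rgt0// !subr_gt0.
move: hi; case: ifP; case: ifP => //=; rewrite ?eqxx ?orbT//.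
Qed.

Lemma flat1_cvg (c : R) : 0 < c -> flat 1 (k.+1%:R * c) @[k --> \oo] --> (1 : R).
Proof.
move=> c0.
have -> : (fun k => flat 1 (k.+1%:R * c)) = (fun k => expR (- (c^-1 * harmonic k))).
  apply/funext => k; rewrite /flat mulr_gt0 ?ltr0n// hornerC mul1r invfM.
  by rewrite mulrC.
have h : - (c^-1 * harmonic k) @[k --> \oo] --> (0 : R).
  rewrite -oppr0; apply: cvgN; rewrite -(mulr0 c^-1).
  by apply: cvgM; [exact: cvg_cst|exact: cvg_harmonic].
rewrite -[X in _ --> X]expR0.
exact: (cvg_comp _ _ h (@continuous_expR R 0)).
Qed.

Lemma bump_cvg l r x : obox l r x -> bump l r k x @[k --> \oo] --> (1 : R).
Proof.
move=> h; rewrite [X in _ --> X](_ : _ = \prod_(i < n) (1 : R)); last first.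
  by rewrite big1.
apply: cvg_big => [|i _].
  by move=> [a b]; apply: mul_continuous.
have /andP[h1 h2] := h i.
rewrite -[X in _ --> X]mulr1; apply: cvgM.
  under eq_cvg do rewrite -mulrBr.
  by apply: flat1_cvg; rewrite subr_gt0.
under eq_cvg do rewrite mulNr addrC -mulrBr.
by apply: flat1_cvg; rewrite subr_gt0.
Qed.

End bump.

Lemma cvge0_near_lt {R : realType} (u : nat -> \bar R) (e : R) :
  u k @[k --> \oo] --> 0%E -> 0 < e -> \forall k \near \oo, (u k < e%:E)%E.
Proof.
move=> /fine_cvgP[fu cu] e0; near=> k.
rewrite -(@fineK _ (u k)); last by near: k.
by rewrite lte_fin; near: k; exact: (cvgr_lt _ cu).
Unshelve. all: by end_near. Qed.

(** * Smooth approximation of indicator functions by the pi-lambda theorem *)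

Section density.
Context {R : realType} {n : nat}.
Local Notation leb := (@lebesgue_rV R n).
Variables (l r : 'I_n -> R).
Local Notation U := (obox l r).
Variable g : 'rV[R]_n -> R.
Hypothesis ig : leb.-integrable U (EFin \o g).
Implicit Types (f phi : 'rV[R]_n -> R) (E : set 'rV[R]_n).

Let mU : measurable U. Proof. exact: measurable_obox. Qed.

Let mg : measurable_fun U g.
Proof. by have /integrableP[/measurable_EFinP] := ig. Qed.

(** A squared norm of L^2 with weight [|g|]. Applied to 1_E - phi it controls both errors in
    [dense_test], the one of [phi] and the one of [phi ^+ 2], without any uniform bound on [phi]. *)
Definition wsq f : \bar R := (\int[leb]_(x in U) (`|g x| * f x ^+ 2)%:E)%E.

Lemma measurable_wsq f : measurable_fun U f ->
  measurable_fun U (fun x => (`|g x| * f x ^+ 2)%:E).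
Proof.
move=> mf; apply/measurable_EFinP; apply: measurable_funM.
  exact: measurableT_comp.
exact: measurable_funX.
Qed.

(** The quarters come from (s + t)^2 <= 2 s^2 + 2 t^2, which replaces the triangle inequality. *)
Lemma wsqD_lt f1 f2 f (e : R) : measurable_fun U f1 -> measurable_fun U f2 ->
  measurable_fun U f -> (forall x, U x -> `|f x| <= `|f1 x| + `|f2 x|) ->
  (wsq f1 < (e / 4)%:E)%E -> (wsq f2 < (e / 4)%:E)%E -> (wsq f < e%:E)%E.
Proof.
move=> m1 m2 m h w1 w2.
apply: (@le_lt_trans _ _ (2%:E * wsq f1 + 2%:E * wsq f2)%E); last first.
  have -> : e%:E = (2%:E * (e / 4)%:E + 2%:E * (e / 4)%:E)%E.
    by rewrite -!EFinM -EFinD; congr EFin; lra.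
  by apply: lteD; rewrite lte_pmul2l// lte_fin.
have h0 (f' : 'rV[R]_n -> R) x : U x -> (0 <= (`|g x| * f' x ^+ 2)%:E)%E.
  by move=> _; rewrite lee_fin mulr_ge0// sqr_ge0.
rewrite /wsq -!ge0_integralZl_EFin//; try exact: measurable_wsq; try exact: h0.
rewrite -ge0_integralD//; first last.
- by apply: measurable_funeM; exact: measurable_wsq.
- by move=> x Ux; rewrite mule_ge0//; exact: h0.
- by apply: measurable_funeM; exact: measurable_wsq.
- by move=> x Ux; rewrite mule_ge0//; exact: h0.
apply: ge0_le_integral => //.
- exact: h0.
- exact: measurable_wsq.
- by apply: emeasurable_funD; apply: measurable_funeM; exact: measurable_wsq.
move=> x Ux; rewrite -!EFinM -EFinD lee_fin.
have := h x Ux; rewrite -(real_normK (num_real (f x))).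
rewrite -(real_normK (num_real (f1 x))) -(real_normK (num_real (f2 x))).
move: (normr_ge0 (g x)) (normr_ge0 (f x)) (normr_ge0 (f1 x)) (normr_ge0 (f2 x)).
move: `|g x| `|f x| `|f1 x| `|f2 x| => G F F1 F2 G0 H0 H1 H2 HF.
have : F ^+ 2 <= 2 * F1 ^+ 2 + 2 * F2 ^+ 2.
  by have := sqr_ge0 (F1 - F2); nra.
by move=> /(ler_wpM2l G0); lra.
Qed.

Lemma wsq_cvg0 (f : nat -> 'rV[R]_n -> R) :
  (forall k, measurable_fun U (f k)) ->
  (forall k x, U x -> `|f k x| <= 1) ->
  (forall x, U x -> f k x @[k --> \oo] --> (0 : R)) ->
  forall e : R, 0 < e -> exists k, (wsq (f k) < e%:E)%E.
Proof.
move=> mf f1 f0 e e0.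
have ag : leb.-integrable U (EFin \o (fun x => `|g x|)).
  exact: (integrable_abse ig).
have mf' k := measurable_wsq (mf k).
have cv : {ae leb, forall x, U x ->
    (`|g x| * f k x ^+ 2)%:E @[k --> \oo] --> (cst 0%E x : \bar R)}.
  apply: aeW => x Ux; apply: cvg_EFin; first exact: nearW.
  rewrite -(mulr0 `|g x|); apply: cvgM; first exact: cvg_cst.
  by rewrite -(mulr0 0); apply: cvgM; exact: f0.
have dom : {ae leb, forall x k, U x ->
    (`|(`|g x| * f k x ^+ 2)%:E| <= (`|g x|)%:E)%E}.
  apply: aeW => x k Ux; rewrite lee_fin normrM normr_id ler_piMr//.
  by rewrite normrX exprn_ile1//; exact: f1.
have [_ _] := dominated_convergence mU mf' (measurable_cst _) cv ag dom.
rewrite integral0 => /cvge0_near_lt/(_ e0)[N _ /(_ N)/= wN].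
by exists N; exact: wN.
Qed.

(** The class to which the pi-lambda theorem is applied; the approximants must vanish off [U] so
    that they are supported in a fixed compact box. *)
Definition dense_set : set (set 'rV[R]_n) := [set E | measurable E /\
  forall e : R, 0 < e -> exists phi, [/\ smooth phi,
    forall x, ~ U x -> phi x = 0 & (wsq (fun x => (\1_E x - phi x)%R) < e%:E)%E]].

Lemma dense_set_obox l' r' : dense_set (obox l' r').
Proof.
split; first exact: measurable_obox.
move=> e e0.
(* Since the approximants have to vanish off [U], the bumps are taken on the intersection with [U],
   which is again a box. *)
pose l2 i := Num.max (l' i) (l i); pose r2 i := Num.min (r' i) (r i).
have E : obox l2 r2 = obox l' r' `&` U by rewrite obox_setI.
have [k ke] : exists k, (wsq (fun x => (\1_(obox l' r') x - bump l2 r2 k x)%R) < e%:E)%E.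
  apply: wsq_cvg0 => //.
  - move=> k; apply: measurable_funB; first exact: measurable_indic (measurable_obox _ _).
    by apply: measurable_funTS; apply: continuous_measurable_rV; exact/smooth_continuous/smooth_bump.
  - move=> k x Ux; rewrite indicE; have /andP[b0 b1] := bump_itv l2 r2 k x.
    have [xQ|xQ] := boolP (x \in obox l' r').
      by rewrite ger0_norm ?subr_ge0// lerBlDr lerDl.
    by rewrite bump_off ?subrr ?normr0// E => -[xQ' _]; rewrite mem_set in xQ.
  - move=> x Ux; rewrite indicE; have [xQ|xQ] := boolP (x \in obox l' r').
      rewrite -(subrr (1 : R)); apply: cvgB; first exact: cvg_cst.
      by apply: bump_cvg; rewrite E; split => //; exact: set_mem.
    have b0 k : bump l2 r2 k x = 0.
      by rewrite bump_off// E => -[xQ' _]; rewrite mem_set in xQ.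
    by under eq_cvg do rewrite b0 subr0; exact: cvg_cst.
exists (bump l2 r2 k); split => //; first exact: smooth_bump.
by move=> x Ux; apply: bump_off; rewrite E => -[].
Qed.

Lemma dense_set_lambda : lambda_system setT dense_set.
Proof.
have mB E phi : measurable E -> smooth phi ->
    measurable_fun U (fun x => \1_E x - phi x).
  move=> mE sp; apply: measurable_funB; first exact: measurable_indic.
  by apply: measurable_funTS; apply: continuous_measurable_rV; exact/smooth_continuous.
split => //.
(* On [U] the indicator of the whole space and that of the box [U] coincide. *)
- split => // e e0; have [_ /(_ e e0)[phi [sp p0 pe]]] := dense_set_obox l r.
  exists phi; split => //; move: pe; congr (_ < _)%E.
  apply: eq_integral => x xU; rewrite !indicE in_setT.
  by rewrite (_ : x \in U)// xU.
- move=> A B BA [mA hA] [mB' hB]; split; first exact: measurableD.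
  move=> e e0; have e40 : 0 < e / 4 by rewrite divr_gt0.
  have [p1 [s1 p10 w1]] := hA _ e40; have [p2 [s2 p20 w2]] := hB _ e40.
  exists (fun x => p1 x - p2 x); split.
  + exact: smoothD s1 (smoothN s2).
  + by move=> x Ux; rewrite p10// p20// subrr.
  + apply: (wsqD_lt _ _ _ _ w1 w2); try exact: mB.
      by apply: mB; [exact: measurableD|exact: smoothD s1 (smoothN s2)].
    move=> x Ux.
    rewrite (_ : \1_(A `\` B) x = \1_A x - \1_B x).
      apply: le_trans (ler_normB _ _); rewrite le_eqVlt; apply/orP; left.
      by apply/eqP; congr (`|_|); lra.
    rewrite !indicE in_setD; case: (boolP (x \in B)) => xB.
      by rewrite (mem_set (BA _ (set_mem xB)))/= subrr.
    by rewrite /= andbT subr0.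
- move=> F ndF hF.
  have mF k : measurable (F k) by have [] := hF k.
  have mUF : measurable (\bigcup_i F i) by exact: bigcup_measurable.
  split => // e e0; have e40 : 0 < e / 4 by rewrite divr_gt0.
  (* The indicators of the [F k] converge pointwise and their errors are at most 1, so by dominated
     convergence a single [F k] is already close to the union. *)
  have [k wk] : exists k,
      (wsq (fun x => (\1_(\bigcup_i F i) x - \1_(F k) x)%R) < (e / 4)%:E)%E.
    apply: wsq_cvg0 => //.
    + by move=> k; apply: measurable_funB; exact: measurable_indic.
    + move=> k x _; rewrite !indicE; do 2 case: (_ \in _); rewrite /= ?subrr ?subr0 ?normr0 ?normr1// sub0r normrN normr1//.
    + move=> x _; have [xF|xF] := pselect ((\bigcup_i F i) x).
        have [N _ FN] := xF.
        apply: cvg_near_cst; exists N => // k /= Nk.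
        rewrite !indicE (mem_set xF) (mem_set _) ?subrr//.
        by apply/subsetPset: FN; apply: ndF.
      under eq_cvg => k.
        rewrite !indicE (memNset xF) (memNset _) ?subrr; last first.
          by move=> Fk; apply: xF; exists k.
        over.
      exact: cvg_cst.
  have [phi [sp p0 pe]] := (hF k).2 _ e40.
  exists phi; split => //.
  apply: (wsqD_lt _ _ _ _ wk pe).
  + by apply: measurable_funB; exact: measurable_indic.
  + exact: mB.
  + exact: mB.
  + move=> x _; apply: le_trans (ler_normD _ _); rewrite le_eqVlt; apply/orP; left.
    by apply/eqP; congr (`|_|); lra.
Qed.

Lemma dense_wsq E : measurable E -> forall e : R, 0 < e -> exists phi,
  [/\ smooth phi, forall x, ~ U x -> phi x = 0 &
      (wsq (fun x => (\1_E x - phi x)%R) < e%:E)%E].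
Proof.
move=> mE; suff [] : dense_set E by [].
pose G : set (set 'rV[R]_n) := [set A | exists l r, A = obox l r].
have GI : setI_closed G.
  by move=> _ _ [l1 [r1 ->]] [l2 [r2 ->]]; rewrite obox_setI; do 2 eexists.
have GH : G `<=` dense_set by move=> _ [l' [r' ->]]; exact: dense_set_obox.
apply: (lambda_system_subset GI dense_set_lambda GH) => //.
by rewrite /G -measurable_rV_obox.
Qed.

(** Put s = 1_E - phi. Since 1_E is idempotent, 1_E - phi^2 = 2 1_E s - s^2. With 2 |s| <= de + s^2
    / de, both |s| and |1_E - phi^2| are at most de + (1 + 1/de) s^2, which [wsq] controls. *)
Lemma dense_test E (e : R) : measurable E -> 0 < e -> exists phi,
  [/\ smooth phi, forall x, ~ U x -> phi x = 0,
      (\int[leb]_(x in U) (`|g x| * `|\1_E x - phi x|)%:E < e%:E)%E &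
      (\int[leb]_(x in U) (`|g x| * `|\1_E x - phi x ^+ 2|)%:E < e%:E)%E].
Proof.
move=> mE e0.
have : (\int[leb]_(x in U) (`|g x|)%:E < +oo)%E by have /integrableP[] := ig.
have : (0 <= \int[leb]_(x in U) (`|g x|)%:E)%E by exact: integral_ge0.
case NE : (\int[leb]_(x in U) (`|g x|)%:E)%E => [N| |]// N0 _.
(* Half of [e] pays for [de * N], the other half for the term with [wsq]; the [+ 1] keeps the
   denominator positive when [N = 0]. *)
pose de := e / (2 * (N + 1)).
have N10 : 0 < N + 1 by rewrite ltr_wpDl.
have de0 : 0 < de by rewrite divr_gt0// mulr_gt0.
have c0 : 0 < 1 + de^-1 by rewrite addr_gt0// invr_gt0.
have [phi [sp p0 pe]] := dense_wsq mE (divr_gt0 e0 (mulr_gt0 (ltr0n _ 2) c0)).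
exists phi.
have ms : measurable_fun U (fun x => \1_E x - phi x).
  apply: measurable_funB; first exact: measurable_indic.
  by apply: measurable_funTS; apply: continuous_measurable_rV; exact/smooth_continuous.
have key (f : 'rV[R]_n -> R) : measurable_fun U f -> (forall x, U x ->
    `|f x| <= de + (1 + de^-1) * (\1_E x - phi x) ^+ 2) ->
    (\int[leb]_(x in U) (`|g x| * `|f x|)%:E < e%:E)%E.
  move=> mf hf.
  apply: (@le_lt_trans _ _ (de%:E * \int[leb]_(x in U) (`|g x|)%:E +
    (1 + de^-1)%:E * wsq (fun x => (\1_E x - phi x)%R))%E).
    have mabs : measurable_fun U (fun x => (`|g x|)%:E).
      by apply/measurable_EFinP; exact: measurableT_comp.
    have mw := measurable_wsq ms.
    have w0 x : U x -> (0 <= (`|g x| * (\1_E x - phi x) ^+ 2)%:E)%E.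
      by move=> _; rewrite lee_fin mulr_ge0// sqr_ge0.
    rewrite /wsq -(ge0_integralZl_EFin _ _ _ _ (ltW de0))//.
    rewrite -(ge0_integralZl_EFin _ _ _ _ (ltW c0))//.
    rewrite -ge0_integralD//; first last.
    - by apply: measurable_funeM; exact: measurable_wsq.
    - by move=> x Ux; apply: mule_ge0; [rewrite lee_fin ltW|exact: w0].
    - exact: measurable_funeM.
    - by move=> x Ux; apply: mule_ge0; rewrite lee_fin// ltW.
    apply: ge0_le_integral => //.
    - by apply/measurable_EFinP; apply: measurable_funM; exact: measurableT_comp.
    - apply: emeasurable_funD; apply: measurable_funeM; last exact: measurable_wsq.
      by apply/measurable_EFinP; exact: measurableT_comp.
    - move=> x Ux; rewrite -!EFinM -EFinD lee_fin.
      apply: (@le_trans _ _ (`|g x| * (de + (1 + de^-1) * (\1_E x - phi x) ^+ 2))).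
        by apply: ler_wpM2l => //; exact: hf.
      by rewrite le_eqVlt; apply/orP; left; apply/eqP; ring.
  rewrite NE.
  have -> : e%:E = ((e / 2)%:E + (1 + de^-1)%:E * (e / (2 * (1 + de^-1)))%:E)%E.
    rewrite -EFinM -EFinD; congr EFin.
    have -> : (1 + de^-1) * (e / (2 * (1 + de^-1))) = e / 2.
      by move: (1 + de^-1) (lt0r_neq0 c0) => c cn; field.
    lra.
  apply: lee_ltD => //.
  - have deE : de * (2 * (N + 1)) = e.
      by rewrite /de divfK// mulf_neq0// lt0r_neq0.
    by rewrite lee_fin; move: deE de0; move: (de) => x xE x0; nra.
  - by rewrite lte_pmul2l.
have amgm (s : R) : 2 * `|s| <= de + de^-1 * s ^+ 2.
  rewrite -(real_normK (num_real s)) -subr_ge0.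
  have -> : de + de^-1 * `|s| ^+ 2 - 2 * `|s| = de^-1 * (`|s| - de) ^+ 2.
    by field; rewrite lt0r_neq0.
  by rewrite mulr_ge0 ?sqr_ge0// invr_ge0 ltW.
split => //.
- apply: key => // x _; move: (\1_E x - phi x) => s.
  have := amgm s; have := normr_ge0 s; have := sqr_ge0 s; lra.
- apply: key => [|x _].
    apply: measurable_funB; first exact: measurable_indic.
    apply: measurable_funX; apply: measurable_funTS.
    by apply: continuous_measurable_rV; exact/smooth_continuous.
  have -> : \1_E x - phi x ^+ 2 = 2 * \1_E x * (\1_E x - phi x) - (\1_E x - phi x) ^+ 2.
    have : (\1_E x : R) = \1_E x ^+ 2.
      by rewrite indicE; case: (_ \in _); rewrite ?expr1n ?expr0n.
    by move: (\1_E x) (phi x) => a b ab; rewrite {1}ab; ring.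
  move: (\1_E x - phi x) => s.
  have s0 := normr_ge0 s; have ss := sqr_ge0 s; have as' := amgm s.
  have h1 : `|2 * \1_E x * s| <= 2 * `|s|.
    rewrite indicE; case: (_ \in _); rewrite ?mulr1 ?mulr0 ?mul0r ?normr0 ?mulr_ge0//.
    by rewrite normrM gtr0_norm.
  have h2 : `|2 * \1_E x * s - s ^+ 2| <= `|2 * \1_E x * s| + s ^+ 2.
    by apply: le_trans (ler_normB _ _) _; rewrite [`|s ^+ 2|]ger0_norm.
  lra.
Qed.

End density.

(** * Test functions, L^2 and weak derivatives *)

Section complex_facts.
Context {R : realType}.
Local Notation C := R[i].
Local Notation Re := (@complex.Re R).
Local Notation Im := (@complex.Im R).
Implicit Types (z w : C).

(** The squared modulus as a polynomial in the real and imaginary parts: smoothness and inequalities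
    then need no square root. *)
Definition sqmod z : R := Re z ^+ 2 + Im z ^+ 2.

Lemma normc2E z : Normc.normc z ^+ 2 = sqmod z.
Proof. by case: z => a b; rewrite /= sqr_sqrtr// addr_ge0// sqr_ge0. Qed.

Lemma sqmod_ge0 z : 0 <= sqmod z.
Proof. by rewrite addr_ge0// sqr_ge0. Qed.

Lemma complexReM z w : Re (z * w) = Re z * Re w - Im z * Im w.
Proof. by case: z; case: w. Qed.

Lemma complexImM z w : Im (z * w) = Re z * Im w + Im z * Re w.
Proof. by case: z; case: w. Qed.

Lemma complexReD z w : Re (z + w) = Re z + Re w.
Proof. by case: z; case: w. Qed.

Lemma complexImD z w : Im (z + w) = Im z + Im w.
Proof. by case: z; case: w. Qed.

Lemma complexReB z w : Re (z - w) = Re z - Re w.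
Proof. by case: z; case: w. Qed.

Lemma complexImB z w : Im (z - w) = Im z - Im w.
Proof. by case: z; case: w. Qed.

Lemma complexReN z : Re (- z) = - Re z. Proof. by case: z. Qed.
Lemma complexImN z : Im (- z) = - Im z. Proof. by case: z. Qed.

Lemma complex_eq z w : Re z = Re w -> Im z = Im w -> z = w.
Proof. by case: z w => a b [c d] /= -> ->. Qed.

Lemma sqmod_triangle z w : sqmod z <= 2 * sqmod w + 2 * sqmod (z - w).
Proof.
rewrite /sqmod complexReB complexImB; move: (Re z) (Im z) (Re w) (Im w) => a b c e.
by have := sqr_ge0 (2 * c - a); have := sqr_ge0 (2 * e - b); nra.
Qed.

Lemma sqmodB_triangle z w : sqmod (z - w) <= 2 * sqmod z + 2 * sqmod w.
Proof.
rewrite /sqmod complexReB complexImB; move: (Re z) (Im z) (Re w) (Im w) => a b c e.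
by have := sqr_ge0 (a + c); have := sqr_ge0 (b + e); nra.
Qed.

Lemma Re_conjM z : Re (conjc z * z) = sqmod z.
Proof. by case: z => a b; rewrite /sqmod /= mulNr opprK !expr2. Qed.

Lemma Re_conjMr (a : R) z : Re (conjc z * (a%:C%C * z)) = a * sqmod z.
Proof. by case: z => x y; rewrite /sqmod /=; ring. Qed.

Lemma sqmodZ z w : sqmod (z * w) = sqmod z * sqmod w.
Proof. by rewrite /sqmod complexReM complexImM; ring. Qed.

Lemma sqmod_real (a : R) : sqmod a%:C%C = a ^+ 2.
Proof. by rewrite /sqmod /= expr0n addr0. Qed.

Lemma sqmod_eq0 z : sqmod z = 0 -> z = 0.
Proof.
move=> /eqP; rewrite /sqmod paddr_eq0 ?sqr_ge0// !sqrf_eq0 => /andP[/eqP a /eqP b].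
exact: complex_eq.
Qed.

End complex_facts.

Section test_functions.
Context {R : realType} {d : nat} (Omega : set 'rV[R]_d).
Local Notation C := R[i].
Local Notation Re := (@complex.Re R).
Local Notation Im := (@complex.Im R).
Implicit Types (phi eta : 'rV[R]_d -> C).

(** Any compact set off which the function vanishes may replace the exact support; sums and
    derivatives are then immediate. *)
Lemma test_functionP phi : test_function Omega phi <->
  [/\ smooth (Re \o phi), smooth (Im \o phi) & exists2 K, compact K &
      K `<=` Omega /\ forall x, ~ K x -> phi x = 0].
Proof.
split=> [[sr si cK KO]|[sr si [K cK [KO K0]]]].
  split => //; exists (closure [set x | phi x != 0]) => //; split => // x xK.
  by apply/eqP/negPn/negP => px; apply: xK; exact: subset_closure.
have clK : closure [set x | phi x != 0] `<=` K.
  rewrite [X in _ `<=` X](closure_id _).1; last first.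
    by apply: compact_closed => //; exact: norm_hausdorff.
  apply: closureS => x /= px; apply: contrapT => /K0 p0.
  by rewrite p0 eqxx in px.
split => //; last exact: subset_trans clK KO.
by apply: subclosed_compact clK => //; exact: closed_closure.
Qed.

Lemma test_function_off phi x : test_function Omega phi -> ~ Omega x -> phi x = 0.
Proof. by move=> /test_functionP[_ _ [K _ [KO K0]]] xO; apply: K0 => /KO. Qed.

Lemma test_function_box phi : test_function Omega phi ->
  exists M, forall x, ~ box M x -> phi x = 0.
Proof.
move=> /test_functionP[_ _ [K cK [_ K0]]].
have [M KM] := compact_sub_box cK.
by exists M => x xM; apply: K0 => /KM.
Qed.

Lemma test_function_real l r (f : 'rV[R]_d -> R) : smooth f ->
  cbox l r `<=` Omega -> (forall x, ~ obox l r x -> f x = 0) ->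
  test_function Omega (fun x => (f x)%:C%C).
Proof.
move=> sf lrO f0; apply/test_functionP; split; [exact: sf|exact: smooth_cst|].
exists (cbox l r); first exact: compact_cbox.
split=> // x xlr; rewrite f0// => ?; apply: xlr; exact: subset_obox_cbox.
Qed.

Lemma test_function0 : test_function Omega (cst 0).
Proof.
apply/test_functionP; split; [exact: smooth_cst|exact: smooth_cst|].
by exists set0; [exact: compact0|split].
Qed.

Lemma test_functionD (c : C) phi eta : test_function Omega phi ->
  test_function Omega eta -> test_function Omega (fun x => c * phi x + eta x).
Proof.
move=> /test_functionP[rp ip [K cK [KO K0]]] /test_functionP[re ie [K' cK' [KO' K0']]].
apply/test_functionP; split.
- rewrite (_ : _ \o _ = (fun x => (Re c * Re (phi x) + - (Im c * Im (phi x))) + Re (eta x))).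
    exact: smoothD (smoothD (smoothZ _ rp) (smoothN (smoothZ _ ip))) re.
  by apply/funext => x; rewrite /= complexReD complexReM.
- rewrite (_ : _ \o _ = (fun x => (Re c * Im (phi x) + Im c * Re (phi x)) + Im (eta x))).
    exact: smoothD (smoothD (smoothZ _ ip) (smoothZ _ rp)) ie.
  by apply/funext => x; rewrite /= complexImD complexImM.
- exists (K `|` K'); first exact: compactU.
  split=> [x [/KO|/KO']//|x /not_orP[xK xK']].
  by rewrite K0// K0'// mulr0 addr0.
Qed.

Lemma test_function_cpartial phi i : test_function Omega phi ->
  test_function Omega (cpartial i phi).
Proof.
move=> /test_functionP[rp ip [K cK [KO K0]]].
apply/test_functionP; split; try exact: smooth_partial.
exists K => //; split => // x xK.
have clK : closed K by apply: compact_closed => //; exact: norm_hausdorff.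
by rewrite /cpartial !(@partial_off_closed _ _ _ _ K)// => y yK;
  rewrite /= K0.
Qed.

Lemma cpartialD i (c : C) phi eta x : test_function Omega phi ->
  test_function Omega eta ->
  cpartial i (fun x => c * phi x + eta x) x = c * cpartial i phi x + cpartial i eta x.
Proof.
move=> [rp ip _ _] [re ie _ _]; apply: complex_eq; rewrite /= ?(complexReD, complexImD, complexReM, complexImM)/=.
- rewrite (_ : _ \o _ = (fun x => (Re c * Re (phi x) + - (Im c * Im (phi x))) + Re (eta x))).
    have rp' := smoothZ (Re c) rp; have ip' := smoothN (smoothZ (Im c) ip).
    rewrite (smooth_partialD _ _ (smoothD rp' ip') re) (smooth_partialD _ _ rp' ip').
    by rewrite (smooth_partialN _ _ (smoothZ (Im c) ip)) (smooth_partialZ _ _ _ rp)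
      (smooth_partialZ _ _ _ ip).
  by apply/funext => y; rewrite /= complexReD complexReM.
- rewrite (_ : _ \o _ = (fun x => (Re c * Im (phi x) + Im c * Re (phi x)) + Im (eta x))).
    have rp' := smoothZ (Re c) ip; have ip' := smoothZ (Im c) rp.
    rewrite (smooth_partialD _ _ (smoothD rp' ip') ie) (smooth_partialD _ _ rp' ip').
    by rewrite (smooth_partialZ _ _ _ rp) (smooth_partialZ _ _ _ ip).
  by apply/funext => y; rewrite /= complexImD complexImM.
Qed.

End test_functions.

(** * Square-integrable functions and integration by parts *)

Section L2_theory.
Context {R : realType} {d : nat} (Omega : set 'rV[R]_d).
Hypothesis oOmega : open Omega.
Local Notation leb := (@lebesgue_rV R d).
Local Notation C := R[i].
Local Notation Re := (@complex.Re R).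
Local Notation Im := (@complex.Im R).
Implicit Types (f g h phi eta : 'rV[R]_d -> C) (u v w : 'rV[R]_d -> R).

Let mOmega : measurable Omega. Proof. exact: open_measurable_rV. Qed.

Definition cmeasurable f :=
  measurable_fun Omega (Re \o f) /\ measurable_fun Omega (Im \o f).

Definition wnorm w f : \bar R := (\int[leb]_(x in Omega) (w x * sqmod (f x))%:E)%E.

Lemma L2_cmeasurable f : L2 Omega f -> cmeasurable f. Proof. by case. Qed.

Lemma cmeasurableB f g : cmeasurable f -> cmeasurable g ->
  cmeasurable (fun x => f x - g x).
Proof.
move=> [f1 f2] [g1 g2]; split.
  rewrite (_ : _ \o _ = (fun x => (Re \o f) x - (Re \o g) x)); first exact: measurable_funB.
  by apply/funext => x; rewrite /= complexReB.
rewrite (_ : _ \o _ = (fun x => (Im \o f) x - (Im \o g) x)); first exact: measurable_funB.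
by apply/funext => x; rewrite /= complexImB.
Qed.

Lemma measurable_sqmod f : cmeasurable f ->
  measurable_fun Omega (fun x => sqmod (f x)).
Proof. by move=> [f1 f2]; apply: measurable_funD; exact: measurable_funX. Qed.

Lemma sqnormE f : sqnorm Omega f = (\int[leb]_(x in Omega) (sqmod (f x))%:E)%E.
Proof. by apply: eq_integral => x _; rewrite normc2E. Qed.

Lemma wnorm1 f : wnorm (cst 1) f = sqnorm Omega f.
Proof. by rewrite sqnormE; apply: eq_integral => x _; rewrite mul1r. Qed.

Lemma sqnorm_ge0 f : (0 <= sqnorm Omega f)%E.
Proof. by apply: integral_ge0 => x _; rewrite lee_fin sqr_ge0. Qed.

Lemma measurable_wsqmod w f : measurable_fun Omega w -> cmeasurable f ->
  measurable_fun Omega (fun x => (w x * sqmod (f x))%:E).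
Proof.
move=> mw mf; apply/measurable_EFinP; apply: measurable_funM => //.
exact: measurable_sqmod.
Qed.

(** Takes the place of Minkowski's inequality for squared norms; the lost factors 2 are compensated
    later by the choice of constants. *)
Lemma wnorm_le2 w f g h : measurable_fun Omega w ->
  (forall x, Omega x -> 0 <= w x) ->
  cmeasurable f -> cmeasurable g -> cmeasurable h ->
  (forall x, Omega x -> sqmod (f x) <= 2 * sqmod (g x) + 2 * sqmod (h x)) ->
  (wnorm w f <= 2%:E * wnorm w g + 2%:E * wnorm w h)%E.
Proof.
move=> mw w0 mf mg mh fgh.
have w0' f' x : Omega x -> (0 <= (w x * sqmod (f' x))%:E)%E.
  by move=> Ox; rewrite lee_fin mulr_ge0 ?sqmod_ge0//; exact: w0.
have mw' f' := @measurable_wsqmod w f' mw.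
have two0 : 0 <= 2 :> R by [].
rewrite /wnorm -(ge0_integralZl_EFin _ _ _ (mw' _ mg) two0)//; last exact: w0'.
rewrite -(ge0_integralZl_EFin _ _ _ (mw' _ mh) two0)//; last exact: w0'.
rewrite -ge0_integralD//; first last.
- by apply: measurable_funeM; exact: mw'.
- by move=> x Ox; apply: mule_ge0 => //; exact: w0'.
- by apply: measurable_funeM; exact: mw'.
- by move=> x Ox; apply: mule_ge0 => //; exact: w0'.
apply: ge0_le_integral => //.
- exact: w0'.
- exact: mw'.
- by apply: emeasurable_funD; apply: measurable_funeM; exact: mw'.
move=> x Ox; rewrite -!EFinM -EFinD lee_fin.
apply: (@le_trans _ _ (w x * (2 * sqmod (g x) + 2 * sqmod (h x)))).
  by apply: ler_wpM2l; [exact: w0|exact: fgh].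
by rewrite le_eqVlt; apply/orP; left; apply/eqP; ring.
Qed.

Lemma sqnorm_le2 f g h : cmeasurable f -> cmeasurable g -> cmeasurable h ->
  (forall x, Omega x -> sqmod (f x) <= 2 * sqmod (g x) + 2 * sqmod (h x)) ->
  (sqnorm Omega f <= 2%:E * sqnorm Omega g + 2%:E * sqnorm Omega h)%E.
Proof. by move=> mf mg mh H; rewrite -!wnorm1; apply: wnorm_le2 => //; exact: measurable_cst. Qed.

Lemma L2B f g : L2 Omega f -> L2 Omega g -> L2 Omega (fun x => f x - g x).
Proof.
move=> Lf Lg; have mf := L2_cmeasurable Lf; have mg := L2_cmeasurable Lg.
have mB := cmeasurableB mf mg; case: (mB) => m1 m2; split => //.
apply: le_lt_trans (sqnorm_le2 mB mf mg _) _.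
  by move=> x _; exact: sqmodB_triangle.
by case: Lf Lg => _ _ f2 [_ _ g2]; apply: lte_add_pinfty; rewrite lte_mul_pinfty// ?lee_fin.
Qed.

Lemma L2_Re_fin f : L2 Omega f ->
  leb.-integrable Omega (EFin \o (fun x => Re (f x) ^+ 2)).
Proof.
move=> Lf; have [m1 m2 fin] := Lf.
apply: (@le_integrable _ _ _ _ _ mOmega _ (EFin \o (fun x => sqmod (f x)))) => //.
- by apply/measurable_EFinP; apply: measurable_funX.
- move=> x _; rewrite /= lee_fin !ger0_norm ?sqr_ge0 ?sqmod_ge0//.
  by rewrite lerDl sqr_ge0.
apply/integrableP; split.
  by apply/measurable_EFinP; exact: measurable_sqmod.
under eq_integral do rewrite /= ger0_norm ?sqmod_ge0//.
by rewrite -sqnormE.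
Qed.

Lemma L2_Im_fin f : L2 Omega f ->
  leb.-integrable Omega (EFin \o (fun x => Im (f x) ^+ 2)).
Proof.
move=> Lf; have [m1 m2 fin] := Lf.
apply: (@le_integrable _ _ _ _ _ mOmega _ (EFin \o (fun x => sqmod (f x)))) => //.
- by apply/measurable_EFinP; apply: measurable_funX.
- move=> x _; rewrite /= lee_fin !ger0_norm ?sqr_ge0 ?sqmod_ge0//.
  by rewrite lerDr sqr_ge0.
apply/integrableP; split.
  by apply/measurable_EFinP; exact: measurable_sqmod.
under eq_integral do rewrite /= ger0_norm ?sqmod_ge0//.
by rewrite -sqnormE.
Qed.

Lemma integrable_mul u v : measurable_fun Omega u -> measurable_fun Omega v ->
  leb.-integrable Omega (EFin \o (fun x => u x ^+ 2)) ->
  leb.-integrable Omega (EFin \o (fun x => v x ^+ 2)) ->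
  leb.-integrable Omega (EFin \o (fun x => u x * v x)).
Proof.
move=> mu mv iu iv.
apply: (le_integrable mOmega _ _ (integrableD mOmega iu iv)).
  by apply/measurable_EFinP; exact: measurable_funM.
move=> x _ /=; rewrite lee_fin [leRHS]ger0_norm ?addr_ge0 ?sqr_ge0//.
rewrite normrM -(real_normK (num_real (u x))) -(real_normK (num_real (v x))).
have := sqr_ge0 (`|u x| - `|v x|); have := normr_ge0 (u x); have := normr_ge0 (v x).
move: `|u x| `|v x| => s t; nra.
Qed.

Definition cintegrable f := leb.-integrable Omega (EFin \o (fun x => Re (f x))) /\
  leb.-integrable Omega (EFin \o (fun x => Im (f x))).

Lemma cintegrable_mul f g : L2 Omega f -> L2 Omega g ->
  cintegrable (fun x => f x * g x).
Proof.
move=> Lf Lg; have [mRf mIf _] := Lf; have [mRg mIg _] := Lg.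
have fr := L2_Re_fin Lf; have fi := L2_Im_fin Lf.
have gr := L2_Re_fin Lg; have gi := L2_Im_fin Lg.
split.
- have := @integrableB _ _ _ _ _ mOmega _ _ (integrable_mul mRf mRg fr gr) (integrable_mul mIf mIg fi gi).
  by apply: eq_integrable => // x _; rewrite /= complexReM EFinB.
- have := integrableD mOmega (integrable_mul mRf mIg fr gi) (integrable_mul mIf mRg fi gr).
  by apply: eq_integrable => // x _; rewrite /= complexImM EFinD.
Qed.

Lemma cintegralB f g : cintegrable f -> cintegrable g ->
  cintegral Omega (fun x => f x - g x) = cintegral Omega f - cintegral Omega g.
Proof.
move=> [fr fi] [gr gi]; apply: complex_eq; rewrite /= ?complexReB ?complexImB /=.
  rewrite -RintegralB//; apply: eq_Rintegral => x _; by rewrite complexReB.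
rewrite -RintegralB//; apply: eq_Rintegral => x _; by rewrite complexImB.
Qed.

Lemma test_function_L2 phi : test_function Omega phi -> L2 Omega phi.
Proof.
move=> tp; have [sr si _ _] := tp.
have m1 : measurable_fun Omega (Re \o phi).
  by apply: measurable_funTS; apply: continuous_measurable_rV; exact: smooth_continuous sr.
have m2 : measurable_fun Omega (Im \o phi).
  by apply: measurable_funTS; apply: continuous_measurable_rV; exact: smooth_continuous si.
split => //; rewrite sqnormE.
have [M pM] := test_function_box tp.
pose u x := (Re \o phi) x * (Re \o phi) x + (Im \o phi) x * (Im \o phi) x.
have su : smooth u by exact: smoothD (smoothM sr sr) (smoothM si si).
have := integrable_bounded_support (smooth_continuous su) (M := M).
have u0 x : ~ box M x -> u x = 0 by move=> /pM p0; rewrite /u /= p0 mulr0 addr0.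
move=> /(_ u0)/integrableP[mu iu].
apply: le_lt_trans iu.
apply: (@le_trans _ _ (\int[leb]_(x in Omega) (`|u x|)%:E)%E).
  rewrite le_eqVlt; apply/orP; left; apply/eqP; apply: eq_integral => x _.
  by rewrite /u /sqmod /= -!expr2 ger0_norm// addr_ge0// sqr_ge0.
apply: ge0_subset_integral => //.
by apply/measurable_EFinP; apply: measurableT_comp => //; exact/measurable_EFinP.
Qed.

(** The integral of the partial derivative of u v vanishes, because u v has bounded support. *)
Lemma test_integral_parts u v i : smooth u -> smooth v ->
  (exists M, forall x, ~ box M x -> u x = 0) ->
  (exists M, forall x, ~ box M x -> v x = 0) ->
  (\int[leb]_x (u x * partial i v x) = - \int[leb]_x (partial i u x * v x))%R.
Proof.
move=> su sv [M uM] [N vN].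
have cu : c1c u by apply: smooth_c1c => //; exists M.
have cv : c1c v by apply: smooth_c1c => //; exists N.
have cuv : c1c (fun x => u x * v x).
  by apply: smooth_c1c; [exact: smoothM|exists M => x /uM ->; rewrite mul0r].
have i1 : leb.-integrable setT (EFin \o (fun x => u x * partial i v x)).
  apply: (@integrable_bounded_support _ _ _ M).
    exact: smooth_continuous (smoothM su (smooth_partial i sv)).
  by move=> x /uM ->; rewrite mul0r.
have i2 : leb.-integrable setT (EFin \o (fun x => partial i u x * v x)).
  apply: (@integrable_bounded_support _ _ _ N).
    exact: smooth_continuous (smoothM (smooth_partial i su) sv).
  by move=> x /vN ->; rewrite mulr0.
apply/eqP; rewrite -subr_eq0 opprK -RintegralD//; apply/eqP.
rewrite /Rintegral.
have -> : (\int[leb]_x (u x * partial i v x + partial i u x * v x)%:E = 0)%E; last by [].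
rewrite -[RHS](integral_partial_eq0 i cuv); apply: eq_integral => x _.
by rewrite smooth_partialM// [v x * _]mulrC.
Qed.

Lemma test_function_weak_partial phi i : test_function Omega phi ->
  is_weak_partial Omega i phi (cpartial i phi).
Proof.
move=> tp eta te.
have [sr si _ _] := tp; have [er ei _ _] := te.
have [M pM] := test_function_box tp; have [N eN] := test_function_box te.
(* Functions vanishing off [Omega] may be integrated over the whole space. The complex identity then
   follows from four real ones, for the real and imaginary parts. *)
have IBP (u v : 'rV[R]_d -> R) : smooth u -> smooth v ->
    (forall x, ~ box M x -> u x = 0) -> (forall x, ~ box N x -> v x = 0) ->
    (forall x, ~ Omega x -> u x = 0) -> (forall x, ~ Omega x -> v x = 0) ->
    (\int[leb]_(x in Omega) (u x * partial i v x) =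
    - \int[leb]_(x in Omega) (partial i u x * v x))%R.
  move=> su sv uM vN uO vO.
  rewrite Rintegral_mkcond [in RHS]Rintegral_mkcond.
  have E (f : 'rV[R]_d -> R) : (forall x, ~ Omega x -> f x = 0) -> f \_ Omega = f.
    move=> f0; apply/funext => x; rewrite patchE; case: ifPn => // /negP xO.
    by rewrite f0// => ?; apply: xO; exact: mem_set.
  rewrite (E (fun x => u x * partial i v x)); last by move=> x /uO ->; rewrite mul0r.
  rewrite (E (fun x => partial i u x * v x)); last by move=> x /vO ->; rewrite mulr0.
  by apply: test_integral_parts => //; [exists M|exists N].
have pO x : ~ Omega x -> phi x = 0 by exact: test_function_off.
have eO x : ~ Omega x -> eta x = 0 by exact: test_function_off.
have off (F : C -> R) (f : 'rV[R]_d -> C) (D : set 'rV[R]_d) : F 0 = 0 ->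
    (forall x, ~ D x -> f x = 0) -> forall x, ~ D x -> (F \o f) x = 0.
  by move=> F0 f0 x /f0 /= ->.
have Lp := test_function_L2 tp; have Le := test_function_L2 te.
have Lpp := test_function_L2 (test_function_cpartial i tp).
have Lee := test_function_L2 (test_function_cpartial i te).
have I u v := @integrable_mul u v.
have rr := IBP _ _ sr er (off _ _ _ _ pM) (off _ _ _ _ eN) (off _ _ _ _ pO) (off _ _ _ _ eO).
have ri := IBP _ _ sr ei (off _ _ _ _ pM) (off _ _ _ _ eN) (off _ _ _ _ pO) (off _ _ _ _ eO).
have ir := IBP _ _ si er (off _ _ _ _ pM) (off _ _ _ _ eN) (off _ _ _ _ pO) (off _ _ _ _ eO).
have ii := IBP _ _ si ei (off _ _ _ _ pM) (off _ _ _ _ eN) (off _ _ _ _ pO) (off _ _ _ _ eO).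
have [mp1 mp2 _] := Lp; have [me1 me2 _] := Le.
have [mpp1 mpp2 _] := Lpp; have [mee1 mee2 _] := Lee.
have fp1 := L2_Re_fin Lp; have fp2 := L2_Im_fin Lp.
have fe1 := L2_Re_fin Le; have fe2 := L2_Im_fin Le.
have fpp1 := L2_Re_fin Lpp; have fpp2 := L2_Im_fin Lpp.
have fee1 := L2_Re_fin Lee; have fee2 := L2_Im_fin Lee.
rewrite /cintegral; apply: complex_eq => /=.
- under eq_Rintegral do rewrite complexReM.
  under [in RHS]eq_Rintegral do rewrite complexReM.
  rewrite RintegralB//; try exact: I.
  rewrite RintegralB//; try exact: I.
  by rewrite rr// ii// opprB opprK addrC.
- under eq_Rintegral do rewrite complexImM.
  under [in RHS]eq_Rintegral do rewrite complexImM.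
  rewrite RintegralD//; try exact: I.
  rewrite RintegralD//; try exact: I.
  by rewrite ri// ir// opprD.
Qed.

End L2_theory.

Section bounded.
Context {R : realType} {d : nat}.
Local Notation leb := (@lebesgue_rV R d).

Lemma continuous_bounded (u : 'rV[R]_d -> R) (K : set 'rV[R]_d) : continuous u ->
  compact K -> (forall x, ~ K x -> u x = 0) ->
  exists2 M, 0 <= M & forall x, `|u x| <= M.
Proof.
move=> cu cK u0.
have : compact (u @` K).
  by apply: continuous_compact => //; exact: continuous_subspaceT.
move=> /compact_bounded[M [Mr uM]].
exists (Num.max (M + 1) 0); first by rewrite le_max lexx orbT.
move=> x; rewrite le_max; have [Kx|/u0 ->] := pselect (K x); last by rewrite normr0 lexx orbT.
by apply/orP; left; apply: uM; [rewrite ltrDl|exists x].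
Qed.

Lemma integrableM_bounded (D : set 'rV[R]_d) (u v : 'rV[R]_d -> R) M : measurable D ->
  leb.-integrable D (EFin \o u) -> measurable_fun D v ->
  (forall x, D x -> `|v x| <= M) ->
  leb.-integrable D (EFin \o (fun x => u x * v x)).
Proof.
move=> mD iu mv vM.
have mu : measurable_fun D u by have /integrableP[/measurable_EFinP] := iu.
have iM := integrableZl mD M iu.
apply: (le_integrable mD _ _ iM).
  by apply/measurable_EFinP; exact: measurable_funM.
move=> x Dx; rewrite /= lee_fin !normrM mulrC ler_wpM2r//.
exact: le_trans (vM x Dx) (ler_norm _).
Qed.

End bounded.

(** * The fundamental lemma of the calculus of variations and weak derivatives *)

Section weak_uniqueness.
Context {R : realType} {d : nat} (Omega : set 'rV[R]_d).
Hypothesis oOmega : open Omega.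
Local Notation leb := (@lebesgue_rV R d).
Local Notation C := R[i].
Local Notation Re := (@complex.Re R).
Local Notation Im := (@complex.Im R).
Implicit Types (f g h phi eta : 'rV[R]_d -> C) (u v w : 'rV[R]_d -> R).

Let mOmega : measurable Omega. Proof. exact: open_measurable_rV. Qed.

Lemma obox_near x : Omega x -> exists l r : 'I_d -> R,
  [/\ cbox l r `<=` Omega, obox l r x & exists2 e, 0 < e & obox l r = ball x e].
Proof.
move=> Ox.
have : nbhs x Omega by apply: open_nbhs_nbhs.
rewrite -nbhs_ballE => -[e/= e0 eO].
(* Half the radius keeps the closed box inside [Omega], so that functions vanishing off the open box
   are test functions. *)
have e20 : 0 < e / 2 by rewrite divr_gt0.
exists (fun i => x ord0 i - e / 2), (fun i => x ord0 i + e / 2); split.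
- move=> y h; apply: eO; rewrite ball_obox// => i.
  have /andP[h1 h2] := h i; apply/andP; split.
    by apply: lt_le_trans h1; lra.
  by apply: le_lt_trans h2 _; lra.
- by move=> i; rewrite ltrBlDr ltrDl e20.
- by exists (e / 2) => //; rewrite ball_obox.
Qed.

(** On a small box the indicator of {u > 0} is approximated by smooth functions orthogonal to [u];
    hence the positive part of [u] has integral 0 there, and being null is a local property. *)
Lemma real_vanish u : measurable_fun Omega u ->
  (forall l r, cbox l r `<=` Omega -> leb.-integrable (obox l r) (EFin \o u)) ->
  (forall l r (phi : 'rV[R]_d -> R), cbox l r `<=` Omega -> smooth phi ->
     (forall x, ~ obox l r x -> phi x = 0) ->
     \int[leb]_(x in obox l r) (u x * phi x) = 0) ->
  leb.-negligible [set x | Omega x /\ 0 < u x].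
Proof.
move=> mu iu u0; pose E := [set x | Omega x /\ 0 < u x].
have mE : measurable E.
  rewrite (_ : E = Omega `&` u @^-1` [set t | 0 < t]) //.
  apply: mu => //; rewrite (_ : [set t | _] = `]0, +oo[%classic) //.
  by apply/seteqP; split => t /=; rewrite in_itv/= andbT.
apply: locally_negligible => x [Ox ux].
have [l [r [lrO lrx [e e0 Ue]]]] := obox_near Ox.
exists e => //; rewrite -Ue.
have mU : measurable (obox l r) by exact: measurable_obox.
have iU := iu _ _ lrO.
have mu' : measurable_fun (obox l r) u by have /integrableP[/measurable_EFinP] := iU.
have m1 : measurable_fun (obox l r) (\1_E : _ -> R) by exact: measurable_indic.
pose v x := u x * \1_E x.
have iv : leb.-integrable (obox l r) (EFin \o v).
  apply: (le_integrable mU _ _ iU).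
    by apply/measurable_EFinP; exact: measurable_funM.
  move=> y _; rewrite /= lee_fin normrM ler_piMr// indicE.
  by case: (_ \in _); rewrite ?normr1 ?normr0.
have v0 y : obox l r y -> 0 <= v y.
  move=> Uy; rewrite /v indicE; have [yE|] := boolP (y \in E); last by rewrite mulr0.
  by rewrite mulr1; have [_ /ltW] := set_mem yE.
have : (\int[leb]_(y in obox l r) `|(EFin \o v) y| = 0)%E.
  apply/eqP; rewrite eq_le integral_ge0// andbT.
  apply/lee_addgt0Pr => e1 e10; rewrite add0e.
  have [phi [sp p0 + _]] := dense_test iU mE e10.
  move=> /ltW; apply: le_trans.
  have mp : measurable_fun (obox l r) phi.
    by apply: measurable_funTS; apply: continuous_measurable_rV; exact: smooth_continuous sp.
  have iup : leb.-integrable (obox l r) (EFin \o (fun y => u y * phi y)).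
    have [M M0 phiM] := continuous_bounded (smooth_continuous sp) (@compact_cbox _ _ l r)
      (fun x xlr => p0 x (fun Ux => xlr (subset_obox_cbox Ux))).
    by apply: (integrableM_bounded mU iU mp (M := M)) => y _; exact: phiM.
  (* As [u] is orthogonal to [phi], the integral of the nonnegative [v] is that of u (1_E - phi),
     which the choice of [phi] makes at most [e1]. *)
  have -> : (\int[leb]_(y in obox l r) `|(EFin \o v) y| =
      `| \int[leb]_(y in obox l r) (u y * (\1_E y - phi y))%:E |)%E.
    transitivity (\int[leb]_(y in obox l r) (v y)%:E)%E.
      by apply: eq_integral => y /set_mem Uy; rewrite /= ger0_norm// v0.
    rewrite -[LHS]gee0_abs; last by apply: integral_ge0 => y Uy; rewrite lee_fin v0.
    have -> : (\int[leb]_(y in obox l r) (u y * (\1_E y - phi y))%:E =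
       \int[leb]_(y in obox l r) (v y)%:E - \int[leb]_(y in obox l r) (u y * phi y)%:E)%E.
      rewrite -integralB_EFin//; apply: eq_integral => y _.
      by rewrite /v -EFinB; congr EFin; ring.
    rewrite [X in (_ - X)%E](_ : _ = 0%E) ?sube0//.
    have H : fine (\int[leb]_(x in obox l r) (u x * phi x)%:E)%E = 0 :=
      u0 _ _ _ lrO sp p0.
    by rewrite -[LHS]fineK ?H// integrable_fin_num.
  apply: le_trans (le_abse_integral _ _ _) _ => //.
    by apply/measurable_EFinP; apply: measurable_funM => //; exact: measurable_funB.
  rewrite le_eqVlt; apply/orP; left; apply/eqP; apply: eq_integral => y _.
  by rewrite /= normrM.
have mv : measurable_fun (obox l r) (EFin \o v) by have /integrableP[] := iv.
move=> /(ae_eq_integral_abs _ mU mv); apply: negligibleS.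
move=> y [[Oy uy] Uy] /(_ Uy)/= [].
by rewrite /v indicE mem_set// mulr1 => u00; rewrite u00 ltxx in uy.
Qed.

Lemma subset_cbox_box l r : exists M, @obox R d l r `<=` box M.
Proof.
have [M lrM] := compact_sub_box (@compact_cbox R d l r).
by exists M; apply: subset_trans lrM; exact: subset_obox_cbox.
Qed.

(** On a set of finite measure |u| <= 1 + u^2 is enough. *)
Lemma integrable_obox_sqr u l r : measurable_fun Omega u ->
  leb.-integrable Omega (EFin \o (fun x => u x ^+ 2)) ->
  cbox l r `<=` Omega -> leb.-integrable (obox l r) (EFin \o u).
Proof.
move=> mu iu lrO.
have mU : measurable (obox l r) by exact: measurable_obox.
have UO : obox l r `<=` Omega by apply: subset_trans lrO; exact: subset_obox_cbox.
have i1 : leb.-integrable (obox l r) (EFin \o cst 1).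
  apply: measurable_bounded_integrable => //; last first.
    by exists 1; split => // y y1 x _; rewrite /= normr1 ltW.
  have [M lrM] := subset_cbox_box l r.
  apply: le_lt_trans (lebesgue_box_fin d M).
  by apply: le_measure => //; rewrite inE//; exact: measurable_box.
have i2 := integrableS mOmega mU UO iu.
apply: (le_integrable mU _ _ (integrableD mU i1 i2)).
  by apply/measurable_EFinP; exact: measurable_funS mu.
move=> x _; rewrite /= lee_fin [leRHS]ger0_norm ?addr_ge0 ?sqr_ge0//.
rewrite -(real_normK (num_real (u x))).
by have := sqr_ge0 (`|u x| - 1); have := normr_ge0 (u x); move: `|u x| => s; nra.
Qed.

Lemma weak_zero g : L2 Omega g ->
  (forall eta, test_function Omega eta ->
    cintegral Omega (fun x => g x * eta x) = 0) ->
  ae_eq leb Omega g (cst 0).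
Proof.
move=> Lg g0; have [m1 m2 _] := Lg.
have i1 := L2_Re_fin oOmega Lg; have i2 := L2_Im_fin oOmega Lg.
(* The one-sided [real_vanish] is applied to [s * u] with s = 1 and s = -1, for [u] the real and the
   imaginary part of [g]. *)
have H (s : R) u : (forall l r (phi : 'rV[R]_d -> R), cbox l r `<=` Omega -> smooth phi ->
      (forall x, ~ obox l r x -> phi x = 0) -> \int[leb]_(x in Omega) (u x * phi x) = 0) ->
    measurable_fun Omega u -> leb.-integrable Omega (EFin \o (fun x => u x ^+ 2)) ->
    leb.-negligible [set x | Omega x /\ 0 < s * u x].
  move=> u0 mu iu; apply: real_vanish.
  - exact: measurable_funM.
  - move=> l r lrO; have := integrable_obox_sqr mu iu lrO.
    by move=> /(integrableZl (measurable_obox l r) s).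
  - move=> l r phi lrO sp p0; rewrite -[RHS](mulr0 s) -(u0 _ _ _ lrO sp p0).
    have mU : measurable (obox l r) by exact: measurable_obox.
    have [M M0 phiM] := continuous_bounded (smooth_continuous sp) (@compact_cbox _ _ l r)
      (fun x xlr => p0 x (fun Ux => xlr (subset_obox_cbox Ux))).
    have mp D : measurable_fun D phi.
      by apply: measurable_funTS; apply: continuous_measurable_rV; exact: smooth_continuous sp.
    have iup : leb.-integrable (obox l r) (EFin \o (fun y => u y * phi y)).
      apply: (integrableM_bounded mU _ (mp _) (M := M)) => [|y _]; last exact: phiM.
      exact: integrable_obox_sqr.
    transitivity (s * \int[leb]_(x in obox l r) (u x * phi x)).
      by rewrite -RintegralZl//; apply: eq_Rintegral => x _; rewrite mulrA.
    congr (s * _); rewrite Rintegral_mkcond [RHS]Rintegral_mkcond.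
    apply: eq_Rintegral => x _; rewrite !patchE.
    have UO : obox l r `<=` Omega by apply: subset_trans lrO; exact: subset_obox_cbox.
    case: ifPn => [/set_mem/UO Ox|/negP xU]; first by rewrite mem_set.
    by rewrite p0 ?mulr0 ?if_same// => Ux; apply: xU; exact: mem_set.
have HR l r (phi : 'rV[R]_d -> R) : cbox l r `<=` Omega -> smooth phi ->
    (forall x, ~ obox l r x -> phi x = 0) ->
    cintegral Omega (fun x => g x * (phi x)%:C%C) = 0.
  by move=> lrO sp p0; apply: g0; exact: test_function_real sp lrO p0.
have Re0 s := H s (Re \o g).
have Im0 s := H s (Im \o g).
have {}Re0 s : leb.-negligible [set x | Omega x /\ 0 < s * (Re \o g) x].
  apply: Re0 => // l r phi lrO sp p0.
  have := congr1 Re (HR _ _ _ lrO sp p0); rewrite /= => E; rewrite -[RHS]E.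
  by apply: eq_Rintegral => x _; rewrite complexReM /= mulr0 subr0.
have {}Im0 s : leb.-negligible [set x | Omega x /\ 0 < s * (Im \o g) x].
  apply: Im0 => // l r phi lrO sp p0.
  have := congr1 Im (HR _ _ _ lrO sp p0); rewrite /= => E; rewrite -[RHS]E.
  by apply: eq_Rintegral => x _; rewrite complexImM /= mulr0 add0r.
have := negligibleU (negligibleU (Re0 1) (Re0 (- 1))) (negligibleU (Im0 1) (Im0 (- 1))).
apply: negligibleS => x /= /not_implyP[Ox gx].
apply: contrapT => /not_orP[/not_orP[h1 h2] /not_orP[h3 h4]]; apply: gx.
have nz (t : R) : ~ (Omega x /\ 0 < 1 * t) -> ~ (Omega x /\ 0 < - 1 * t) -> t = 0.
  move=> a b; apply/eqP; rewrite eq_le; apply/andP; split.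
    by rewrite leNgt; apply/negP => t0; apply: a; rewrite mul1r.
  by rewrite leNgt; apply/negP => t0; apply: b; rewrite mulN1r oppr_gt0.
by apply: complex_eq; exact: nz.
Qed.

Lemma weak_partial_unique i f g h : L2 Omega g -> L2 Omega h ->
  is_weak_partial Omega i f g -> is_weak_partial Omega i f h ->
  ae_eq leb Omega g h.
Proof.
move=> Lg Lh wg wh.
have : ae_eq leb Omega (fun x => g x - h x) (cst 0).
  apply: weak_zero; first exact: L2B.
  move=> eta te; have Le := test_function_L2 oOmega te.
  rewrite (_ : (fun x => _) = fun x => g x * eta x - h x * eta x); last first.
    by apply/funext => x; rewrite mulrBl.
  rewrite cintegralB//; try exact: cintegrable_mul.
  have := wg _ te; rewrite (wh _ te) => /oppr_inj <-.
  by rewrite subrr.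
by apply: filterS => x H Ox; apply/subr0_eq; exact: H.
Qed.

Lemma weak_partialP i f : H1 Omega f ->
  L2 Omega (weak_partial Omega i f) /\ is_weak_partial Omega i f (weak_partial Omega i f).
Proof.
move=> [_ /(_ i)[g Lg wg]].
exact: (xgetPex (cst 0) (ex_intro [set g | L2 Omega g /\ is_weak_partial Omega i f g] g (conj Lg wg))).
Qed.

(** [weak_partial] is an arbitrary choice; uniqueness identifies it with any derivative known
    explicitly, in particular the classical one. *)
Lemma weak_partial_ae i f g : L2 Omega g -> is_weak_partial Omega i f g ->
  ae_eq leb Omega (weak_partial Omega i f) g.
Proof.
move=> Lg wg.
have [L w] := xgetPex (cst 0) (ex_intro [set g | L2 Omega g /\ is_weak_partial Omega i f g] g (conj Lg wg)).
exact: weak_partial_unique w wg.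
Qed.

Lemma is_weak_partialB i f f' g g' : L2 Omega f -> L2 Omega f' ->
  L2 Omega g -> L2 Omega g' ->
  is_weak_partial Omega i f g -> is_weak_partial Omega i f' g' ->
  is_weak_partial Omega i (fun x => f x - f' x) (fun x => g x - g' x).
Proof.
move=> Lf Lf' Lg Lg' w w' eta te.
have Le := test_function_L2 oOmega te.
have Ldi := test_function_L2 oOmega (test_function_cpartial i te).
rewrite (_ : (fun x => _) = fun x => f x * cpartial i eta x - f' x * cpartial i eta x); last first.
  by apply/funext => x; rewrite mulrBl.
rewrite [in RHS](_ : (fun x => _) = fun x => g x * eta x - g' x * eta x); last first.
  by apply/funext => x; rewrite mulrBl.
rewrite cintegralB//; try exact: cintegrable_mul.
rewrite cintegralB//; try exact: cintegrable_mul.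
by rewrite w// w'// opprB opprK addrC.
Qed.

Lemma test_function_H1 phi : test_function Omega phi -> H1 Omega phi.
Proof.
move=> tp; split; first exact: test_function_L2.
move=> i; exists (cpartial i phi).
  exact: test_function_L2 (test_function_cpartial i tp).
exact: test_function_weak_partial.
Qed.

Lemma H1B f g : H1 Omega f -> H1 Omega g -> H1 Omega (fun x => f x - g x).
Proof.
move=> Hf Hg; have [Lf _] := Hf; have [Lg _] := Hg; split; first exact: L2B.
move=> i; have [Lf' wf] := weak_partialP i Hf; have [Lg' wg] := weak_partialP i Hg.
exists (fun x => weak_partial Omega i f x - weak_partial Omega i g x); first exact: L2B.
exact: is_weak_partialB.
Qed.

Lemma weak_partialB i f g : H1 Omega f -> H1 Omega g ->
  ae_eq leb Omega (weak_partial Omega i (fun x => f x - g x))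
    (fun x => weak_partial Omega i f x - weak_partial Omega i g x).
Proof.
move=> Hf Hg; have [Lf _] := Hf; have [Lg _] := Hg.
have [Lf' wf] := weak_partialP i Hf; have [Lg' wg] := weak_partialP i Hg.
by apply: weak_partial_ae; [exact: L2B|exact: is_weak_partialB].
Qed.

Lemma weak_partial_test i phi : test_function Omega phi ->
  ae_eq leb Omega (weak_partial Omega i phi) (cpartial i phi).
Proof.
move=> tp; apply: weak_partial_ae; last exact: test_function_weak_partial.
exact: test_function_L2 (test_function_cpartial i tp).
Qed.

Lemma sqnorm_ae f g : cmeasurable Omega f -> cmeasurable Omega g ->
  ae_eq leb Omega f g -> sqnorm Omega f = sqnorm Omega g.
Proof.
move=> mf mg fg; rewrite !(sqnormE Omega); apply: ae_eq_integral => //.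
- by apply/measurable_EFinP; exact: measurable_sqmod.
- by apply/measurable_EFinP; exact: measurable_sqmod.
- by apply: filterS fg => x H Ox; rewrite H.
Qed.

End weak_uniqueness.

(** * Relative form bound for a potential in L^d *)

Section form_bound.
Context {R : realType} {n : nat}.
Local Notation d := n.+1.
Variable Omega : set 'rV[R]_d.
Hypothesis oOmega : open Omega.
Local Notation leb := (@lebesgue_rV R d).
Local Notation C := R[i].
Local Notation Re := (@complex.Re R).
Local Notation Im := (@complex.Im R).
Implicit Types (f g h phi eta psi : 'rV[R]_d -> C) (u v w V : 'rV[R]_d -> R).

Let mOmega : measurable Omega. Proof. exact: open_measurable_rV. Qed.

Lemma integral_test_setT (F : 'rV[R]_d -> R) phi : test_function Omega phi ->
  (forall x, phi x = 0 -> F x = 0) ->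
  (\int[leb]_(x in Omega) (F x)%:E = \int[leb]_x (F x)%:E)%E.
Proof.
move=> tp F0; rewrite integral_mkcond; apply: eq_integral => x _.
rewrite patchE; case: ifPn => // /negP xO; rewrite F0//.
by apply: (test_function_off tp) => Ox; apply: xO; exact: mem_set.
Qed.

Definition sqnorm_grad phi : \bar R :=
  (\sum_(i < d) sqnorm Omega (cpartial i phi))%E.

Lemma measurable_test phi D : test_function Omega phi ->
  measurable_fun D (fun x => sqmod (phi x)).
Proof.
move=> tp; have [sr si _ _] := tp; apply: measurable_funTS.
apply: continuous_measurable_rV; apply: smooth_continuous.
exact: (smoothD (smoothM sr sr) (smoothM si si)).
Qed.

(** Gagliardo's inequality for |phi|^2 and the normalized weight V / K. A small [de] makes the
    gradient term small at the price of [de^-1]; the factor [d] arises by summing the zeroth-order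
    term over the directions. *)
Lemma sobolev_test V (K : R) : 0 < K -> measurable_fun setT V ->
  (forall x, 0 <= V x) -> (\int[leb]_x (V x ^+ d)%:E <= (K ^+ d)%:E)%E ->
  forall (de : R) phi, 0 < de -> test_function Omega phi ->
  (wnorm Omega V phi <=
    (K * de)%:E * sqnorm_grad phi + (K * de^-1 * d%:R)%:E * sqnorm Omega phi)%E.
Proof.
move=> K0 mV V0 VK de phi de0 tp; have [sr si _ _] := tp.
pose u x : R := sqmod (phi x).
have su : smooth u by exact: (smoothD (smoothM sr sr) (smoothM si si)).
have u0 x : 0 <= u x by exact: sqmod_ge0.
have cu : c1c u.
  apply: smooth_c1c => //; have [M pM] := test_function_box tp.
  by exists M => x /pM; rewrite /u => ->; rewrite sqmod_real expr0n.
have du i x : `|partial i u x| <= de * sqmod (cpartial i phi x) + de^-1 * sqmod (phi x).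
  (* The squares of [s - de * t] and [s + de * t] bound the two signs. *)
  have key (s t : R) : `|2 * s * t| <= de * t ^+ 2 + de^-1 * s ^+ 2.
    have H1 : de * t ^+ 2 + de^-1 * s ^+ 2 - 2 * s * t = de^-1 * (s - de * t) ^+ 2.
      by field; rewrite lt0r_neq0.
    have H2 : de * t ^+ 2 + de^-1 * s ^+ 2 + 2 * s * t = de^-1 * (s + de * t) ^+ 2.
      by field; rewrite lt0r_neq0.
    have q0 (r : R) : 0 <= de^-1 * r ^+ 2.
      by rewrite mulr_ge0 ?sqr_ge0// invr_ge0 ltW.
    rewrite ler_norml; apply/andP; split; rewrite -subr_ge0 ?H1 ?opprK//.
    by rewrite addrC H2.
  have -> : partial i u x = 2 * Re (phi x) * partial i (Re \o phi) x +
      2 * Im (phi x) * partial i (Im \o phi) x.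
    rewrite (smooth_partialD _ _ (smoothM sr sr) (smoothM si si)).
    by rewrite (smooth_partialM _ _ sr sr) (smooth_partialM _ _ si si) /=; ring.
  apply: le_trans (ler_normD _ _) _.
  apply: le_trans (lerD (key _ _) (key _ _)) _.
  by rewrite /sqmod /= le_eqVlt; apply/orP; left; apply/eqP; ring.
have mu : measurable_fun setT u by exact: c1c_measurable.
have mK : measurable_fun setT (fun x => K^-1 * V x) by exact: measurable_funM.
have VK0 x : 0 <= K^-1 * V x by rewrite mulr_ge0// invr_ge0 ltW.
have VK1 : (\int[leb]_x ((K^-1 * V x) ^+ d)%:E <= 1)%E.
  under eq_integral do rewrite exprMn EFinM.
  rewrite ge0_integralZl_EFin//.
  - apply: (@le_trans _ _ ((K^-1 ^+ d)%:E * (K ^+ d)%:E)%E).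
      by apply: lee_wpmul2l => //; rewrite lee_fin exprn_ge0// invr_ge0 ltW.
    by rewrite -EFinM -exprMn mulVf ?expr1n// lt0r_neq0.
  - by move=> x _; rewrite lee_fin exprn_ge0.
  - by apply/measurable_EFinP; exact: measurable_funX.
  - by rewrite exprn_ge0// invr_ge0 ltW.
have := gagliardo cu u0 mK VK0 VK1.
have -> : (\int[leb]_x (K^-1 * V x * u x)%:E = K^-1%:E * wnorm Omega V phi)%E.
  rewrite /wnorm (integral_test_setT (F := fun x => V x * sqmod (phi x)) tp); last first.
    by move=> x ->; rewrite sqmod_real expr0n mulr0.
  rewrite -ge0_integralZl_EFin ?invr_ge0 ?(ltW K0)//.
  - by apply: eq_integral => x _; rewrite -EFinM mulrA.
  - by move=> x _; rewrite lee_fin mulr_ge0// u0.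
  - by apply/measurable_EFinP; exact: measurable_funM.
move=> gag.
have : (\int[leb]_x (grad1 u x)%:E <=
    de%:E * sqnorm_grad phi + (de^-1 * d%:R)%:E * sqnorm Omega phi)%E.
  have Lp := test_function_L2 oOmega tp.
  have LD i := test_function_L2 oOmega (test_function_cpartial i tp).
  under eq_integral do rewrite /grad1 -sumEFin.
  rewrite ge0_integral_sum//; last first.
    move=> i; apply/measurable_EFinP; apply: measurableT_comp => //.
    exact: measurable_partial.
  apply: (@le_trans _ _ (\sum_(i < d) (de%:E * sqnorm Omega (cpartial i phi) +
      de^-1%:E * sqnorm Omega phi))%E).
    apply: lee_sum => i _.
    have e0 : 0 <= de^-1 by rewrite invr_ge0 ltW.
    rewrite !(sqnormE Omega).
    rewrite (integral_test_setT (F := fun x => sqmod (phi x)) tp); last first.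
      by move=> x ->; rewrite sqmod_real expr0n.
    rewrite (integral_test_setT (F := fun x => sqmod (cpartial i phi x))
      (test_function_cpartial i tp)); last first.
      by move=> x ->; rewrite sqmod_real expr0n.
    have m1 : measurable_fun setT (fun x => (sqmod (phi x))%:E).
      by apply/measurable_EFinP; exact: measurable_test.
    have m2 : measurable_fun setT (fun x => (sqmod (cpartial i phi x))%:E).
      by apply/measurable_EFinP; apply: measurable_test; exact: test_function_cpartial.
    have sq0 (z : C) : (0 <= (sqmod z)%:E)%E by rewrite lee_fin sqmod_ge0.
    rewrite -!ge0_integralZl_EFin ?(ltW de0)//.
    rewrite -ge0_integralD//; first last.
    - exact: measurable_funeM.
    - by move=> x _; apply: mule_ge0.
    - exact: measurable_funeM.
    - by move=> x _; apply: mule_ge0 => //; rewrite lee_fin ltW.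
    apply: ge0_le_integral => //.
    - apply/measurable_EFinP; apply: measurableT_comp => //.
      exact: measurable_partial.
    - by apply: emeasurable_funD; exact: measurable_funeM.
    - by move=> x _; rewrite -!EFinM -EFinD lee_fin; exact: du.
  rewrite big_split/= -ge0_sume_distrr; last by move=> i _; exact: sqnorm_ge0.
  apply: leeD => //.
  have : (sqnorm Omega phi < +oo)%E by case: Lp.
  have := sqnorm_ge0 Omega phi; case: (sqnorm Omega phi) => [s| |]// s0 _.
  rewrite -EFinM sumEFin -EFinM lee_fin sumr_const card_ord -mulr_natr.
  by rewrite le_eqVlt; apply/orP; left; apply/eqP; ring.
move=> /(le_trans gag) H.
have KK : K * K^-1 = 1 by rewrite divff// lt0r_neq0.
have -> : wnorm Omega V phi = (K%:E * (K^-1%:E * wnorm Omega V phi))%E.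
  by rewrite muleA -EFinM KK mul1e.
apply: (@le_trans _ _ (K%:E * (de%:E * sqnorm_grad phi + (de^-1 * d%:R)%:E * sqnorm Omega phi))%E).
  by apply: lee_wpmul2l => //; rewrite lee_fin ltW.
rewrite le_eqVlt; apply/orP; left; apply/eqP.
rewrite ge0_muleDr.
- by rewrite muleA -EFinM muleA -EFinM !mulrA.
- apply: mule_ge0; first by rewrite lee_fin ltW.
  by apply: sume_ge0 => i _; exact: sqnorm_ge0.
- apply: mule_ge0; last exact: sqnorm_ge0.
  by rewrite lee_fin mulr_ge0// invr_ge0 ltW.
Qed.

Lemma sqmodBC (z w : C) : sqmod (z - w) = sqmod (w - z).
Proof. by rewrite /sqmod !complexReB !complexImB; ring. Qed.

Definition sqnorm_wgrad psi : \bar R :=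
  (\sum_(i < d) sqnorm Omega (weak_partial Omega i psi))%E.

Lemma sqnorm_wgrad_ge0 psi : (0 <= sqnorm_wgrad psi)%E.
Proof. by apply: sume_ge0 => i _; exact: sqnorm_ge0. Qed.

Lemma sqnorm_wgrad_fin psi : H1 Omega psi -> (sqnorm_wgrad psi < +oo)%E.
Proof.
move=> Hp; apply: lte_sum_pinfty => i _.
by have [[]] := weak_partialP i Hp.
Qed.

(** The classical derivatives of a test function represent its weak ones, so the difference with
    [psi] can be taken in H^1. *)
Lemma sqnorm_grad_le phi psi : test_function Omega phi -> H1 Omega psi ->
  (sqnorm_grad phi <= 2%:E * sqnorm_wgrad psi +
     2%:E * sqnorm_wgrad (fun x => (phi x - psi x)%R))%E.
Proof.
move=> tp Hp; have Hphi := test_function_H1 oOmega tp.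
have D f : (\sum_(i < d) 2%:E * sqnorm Omega (weak_partial Omega i f) <=
    2%:E * sqnorm_wgrad f)%E.
  rewrite le_eqVlt; apply/orP; left; apply/eqP/esym.
  by apply: ge0_sume_distrr => i _; exact: sqnorm_ge0.
apply: (@le_trans _ _ (\sum_(i < d) (2%:E * sqnorm Omega (weak_partial Omega i psi) +
  2%:E * sqnorm Omega (weak_partial Omega i (fun x => (phi x - psi x)%R))))%E); last first.
  by rewrite big_split; apply: leeD; exact: D.
apply: lee_sum => i _.
have [Lp _] := weak_partialP i Hp.
have LD := test_function_L2 oOmega (test_function_cpartial i tp).
have LB := L2B oOmega LD Lp.
have [Lw _] := weak_partialP i (H1B oOmega Hphi Hp).
have E : sqnorm Omega (weak_partial Omega i (fun x => phi x - psi x)) =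
    sqnorm Omega (fun x => cpartial i phi x - weak_partial Omega i psi x).
  apply: sqnorm_ae => //; [exact: L2_cmeasurable Lw|exact: L2_cmeasurable LB|].
  have := weak_partial_test oOmega i tp; have := weak_partialB oOmega i Hphi Hp.
  by apply: filterS2 => x h1 h2 Ox; rewrite h1// h2.
rewrite E; apply: sqnorm_le2 => //; [exact: L2_cmeasurable LD|exact: L2_cmeasurable Lp
  |exact: L2_cmeasurable LB|].
by move=> x _; exact: sqmod_triangle.
Qed.

(** The untruncated estimate is available for [phi] only. Truncating at [N] bounds the weighted norm
    of [phi - psi] by [N] times its L^2 norm squared, which vanishes in the limit. Each 4 is 2 times
    2: one factor from splitting [psi], one from bounding [phi] by [psi] again. *)
Lemma truncated_bound V (K de : R) (N : R) phi psi (g s e : R) : 0 < K -> 0 < de ->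
  measurable_fun setT V -> (forall x, 0 <= V x) ->
  (\int[leb]_x (V x ^+ d)%:E <= (K ^+ d)%:E)%E -> 0 <= N ->
  test_function Omega phi -> H1 Omega psi ->
  sqnorm_wgrad psi = g%:E -> sqnorm Omega psi = s%:E ->
  (sqnorm_H1 Omega (fun x => (phi x - psi x)%R) <= e%:E)%E ->
  (wnorm Omega (fun x => Num.min (V x) N) psi <=
   (4 * (K * de) * g + 4 * (K * de^-1 * d%:R) * s +
    (4 * (K * de) + 4 * (K * de^-1 * d%:R) + 2 * N) * e)%:E)%E.
Proof.
move=> K0 de0 mV V0 VK N0 tp Hp gE sE eE.
have Hphi := test_function_H1 oOmega tp.
have [Lp _] := Hp; have [Lphi _] := Hphi.
have LB := L2B oOmega Lphi Lp.
have mp := L2_cmeasurable Lp; have mphi := L2_cmeasurable Lphi.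
have mB := L2_cmeasurable LB.
have e1 : (sqnorm_wgrad (fun x => (phi x - psi x)%R) <= e%:E)%E.
  by apply: le_trans eE; rewrite /sqnorm_H1 leeDl// sqnorm_ge0.
have e2 : (sqnorm Omega (fun x => (phi x - psi x)%R) <= e%:E)%E.
  by apply: le_trans eE; rewrite /sqnorm_H1 leeDr// sqnorm_wgrad_ge0.
have two0 : (0 <= 2%:E :> \bar R)%E by rewrite lee_fin.
have G : (sqnorm_grad phi <= (2 * g + 2 * e)%:E)%E.
  apply: le_trans (sqnorm_grad_le tp Hp) _; rewrite gE.
  have -> : (2 * g + 2 * e)%:E = (2%:E * g%:E + 2%:E * e%:E)%E by rewrite -!EFinM -EFinD.
  by apply: leeD => //; exact: lee_wpmul2l.
have S : (sqnorm Omega phi <= (2 * s + 2 * e)%:E)%E.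
  apply: (@le_trans _ _ (2%:E * sqnorm Omega psi +
      2%:E * sqnorm Omega (fun x => (phi x - psi x)%R))%E).
    by apply: sqnorm_le2 => // x _; exact: sqmod_triangle.
  have -> : (2 * s + 2 * e)%:E = (2%:E * s%:E + 2%:E * e%:E)%E by rewrite -!EFinM -EFinD.
  by rewrite sE; apply: leeD => //; exact: lee_wpmul2l.
have mVN : measurable_fun setT (fun x => Num.min (V x) N).
  by apply: measurable_minr => //; exact: measurable_cst.
have VN0 x : 0 <= Num.min (V x) N by rewrite le_min V0 N0.
have h1 : (wnorm Omega (fun x => Num.min (V x) N) phi <= wnorm Omega V phi)%E.
  apply: ge0_le_integral => //.
  - by move=> x _; rewrite lee_fin mulr_ge0// sqmod_ge0.
  - by apply: measurable_wsqmod => //; exact: measurable_funTS.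
  - by apply: measurable_wsqmod => //; exact: measurable_funTS.
  - by move=> x _; rewrite lee_fin ler_wpM2r ?sqmod_ge0// ge_min lexx.
have h2 f : cmeasurable Omega f ->
    (wnorm Omega (fun x => Num.min (V x) N) f <= N%:E * sqnorm Omega f)%E.
  move=> mf; rewrite sqnormE -ge0_integralZl_EFin//.
  - apply: ge0_le_integral => //.
    + by move=> x _; rewrite lee_fin mulr_ge0// sqmod_ge0.
    + by apply: measurable_wsqmod => //; exact: measurable_funTS.
    + apply: measurable_funeM; apply/measurable_EFinP; exact: measurable_sqmod.
    + by move=> x _; rewrite -EFinM lee_fin ler_wpM2r ?sqmod_ge0// ge_min lexx orbT.
  - by move=> x _; rewrite lee_fin sqmod_ge0.
  - by apply/measurable_EFinP; exact: measurable_sqmod.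
have h3 : (wnorm Omega V phi <=
    (K * de * (2 * g + 2 * e) + K * de^-1 * d%:R * (2 * s + 2 * e))%:E)%E.
  apply: le_trans (sobolev_test K0 mV V0 VK de0 tp) _.
  rewrite EFinD !(EFinM _ (2 * _ + _)); apply: leeD; apply: lee_wpmul2l => //.
    by rewrite lee_fin mulr_ge0// ltW.
  by rewrite lee_fin !mulr_ge0// ?invr_ge0 ltW.
apply: (@le_trans _ _ (2%:E * wnorm Omega V phi +
    2%:E * (N%:E * sqnorm Omega (fun x => (phi x - psi x)%R)))%E).
  apply: (@le_trans _ _ (2%:E * wnorm Omega (fun x => Num.min (V x) N) phi +
    2%:E * wnorm Omega (fun x => Num.min (V x) N) (fun x => (phi x - psi x)%R))%E).
    apply: (wnorm_le2 oOmega) => //; first exact: measurable_funTS.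
    by move=> x _; rewrite sqmodBC; exact: sqmod_triangle.
  by apply: leeD; apply: lee_wpmul2l => //; exact: h2.
apply: (@le_trans _ _ (2%:E * (K * de * (2 * g + 2 * e) +
    K * de^-1 * d%:R * (2 * s + 2 * e))%:E + 2%:E * (N%:E * e%:E))%E).
  apply: leeD; apply: lee_wpmul2l => //; apply: lee_wpmul2l => //.
rewrite -!EFinM -EFinD lee_fin le_eqVlt; apply/orP; left; apply/eqP.
by move: (K * de) (K * de^-1 * d%:R) => x y; ring.
Qed.

(** All that the form bound needs to know of the form domain. It involves neither the potentials nor
    [mu], whence a constant independent of [mu]. *)
Definition H1_limit psi := H1 Omega psi /\
  exists phi : nat -> 'rV[R]_d -> C, (forall k, test_function Omega (phi k)) /\
    sqnorm_H1 Omega (fun x => phi k x - psi x) @[k --> \oo] --> 0%E.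

Lemma form_bound V : measurable_fun setT V -> (forall x, 0 <= V x) ->
  (\int[leb]_x (V x ^+ d)%:E < +oo)%E ->
  exists2 c : R, 0 <= c & forall psi, H1_limit psi ->
    (wnorm Omega V psi <= sqnorm_wgrad psi + c%:E * sqnorm Omega psi)%E.
Proof.
move=> mV V0 Vfin.
have : (0 <= \int[leb]_x (V x ^+ d)%:E)%E.
  by apply: integral_ge0 => x _; rewrite lee_fin exprn_ge0.
move: Vfin; case VA : (\int[leb]_x _)%E => [A| |]// _ A0.
have K0 : 0 < A + 1 by rewrite ltr_wpDl.
have VK : (\int[leb]_x (V x ^+ d)%:E <= ((A + 1) ^+ d)%:E)%E.
  rewrite VA lee_fin; apply: (@le_trans _ _ (A + 1)); first by rewrite lerDl.
  by rewrite exprS ler_peMr ?(ltW K0)// exprn_ege1// lerDr.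
move: K0 VK; move: (A + 1) => K K0 VK {VA A0 A}.
(* Chosen so that the gradient coefficient [4 * (K * de)] of [truncated_bound] is exactly 1. *)
pose de := (4 * K)^-1.
have de0 : 0 < de by rewrite invr_gt0 mulr_gt0.
have Kd : 4 * (K * de) = 1 by rewrite mulrA divff// lt0r_neq0// mulr_gt0.
have c0 : 0 <= 4 * (K * de^-1 * d%:R).
  apply: mulr_ge0 => //; apply: mulr_ge0 => //.
  by apply: mulr_ge0; [exact: ltW|rewrite invr_ge0; exact: ltW].
exists (4 * (K * de^-1 * d%:R)) => // psi [Hp [phi [tphi cvg0]]].
have [[mp1 mp2 Sfin] _] := Hp; have mp : cmeasurable Omega psi by [].
move: (sqnorm_wgrad_ge0 psi) (sqnorm_wgrad_fin Hp).
case gE : (sqnorm_wgrad psi) => [g| |]// _ _.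
move: (sqnorm_ge0 Omega psi) Sfin; case sE : (sqnorm Omega psi) => [s| |]// s0 _.
(* First limit: for fixed [N] the approximation error enters with the factor [L], so a test function
   at squared H^1 distance below [eta / L] suffices. *)
have trunc (N : nat) : (wnorm Omega (fun x => Num.min (V x) N%:R) psi <=
    (g + 4 * (K * de^-1 * d%:R) * s)%:E)%E.
  apply/lee_addgt0Pr => eta eta0.
  pose L := 4 * (K * de) + 4 * (K * de^-1 * d%:R) + 2 * N%:R.
  have L0 : 0 < L by rewrite /L Kd -addrA ltr_pwDl// addr_ge0.
  have [k _ /(_ k (leqnn k))/= ek] := cvge0_near_lt cvg0 (divr_gt0 eta0 L0).
  apply: le_trans (truncated_bound K0 de0 mV V0 VK _ (tphi k) Hp gE sE (ltW ek)) _.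
    by [].
  have LE : L * (eta / L) = eta by rewrite mulrCA divff ?mulr1// lt0r_neq0.
  by rewrite -EFinD lee_fin -/L LE Kd mul1r.
have mVN (N : nat) : measurable_fun Omega (fun x => Num.min (V x) N%:R).
  by apply: measurable_funTS; apply: measurable_minr => //; exact: measurable_cst.
have VN0 (N : nat) x : 0 <= Num.min (V x) N%:R by rewrite le_min V0 ler0n.
have p0 (N : nat) x : Omega x -> (0 <= (Num.min (V x) N%:R * sqmod (psi x))%:E)%E.
  by move=> _; rewrite lee_fin mulr_ge0// sqmod_ge0.
have nd x : Omega x -> {homo (fun N : nat => (Num.min (V x) N%:R * sqmod (psi x))%:E) :
    m k / (m <= k)%N >-> (m <= k)%E}.
  move=> _ m k mk; rewrite lee_fin ler_wpM2r ?sqmod_ge0//.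
  by rewrite le_min ge_min lexx/= ge_min ler_nat mk orbT.
(* Second limit: min(V, N) increases to V, being equal to it at each point for large [N]. *)
have mc := @cvg_monotone_convergence _ _ _ leb _ mOmega _
  (fun N => measurable_wsqmod (mVN N) mp) p0 nd.
have E : (wnorm Omega V psi = \int[leb]_(x in Omega)
   (fun x => limn (fun N : nat => (Num.min (V x) N%:R * sqmod (psi x))%:E)) x)%E.
  apply: eq_integral => x _; apply/esym/cvg_lim => //.
  apply: cvg_EFin; first exact: nearW.
  apply: cvg_near_cst; exists (Num.truncn (V x)).+1 => // N /= VN.
  rewrite min_l//; apply: (le_trans (ltW (truncnS_gt _))).
  by rewrite ler_nat.
rewrite E -EFinM -EFinD.
rewrite -(cvg_lim _ mc)//.
apply: lime_le; first by apply/cvg_ex; eexists; exact: mc.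
by apply: nearW => N; exact: trunc.
Qed.

End form_bound.

(** * Lower bound for the Rayleigh quotients *)

Section ess_inf_on_facts.
Context {R : realType} {d : nat} (Omega : set 'rV[R]_d).
Hypothesis oOmega : open Omega.
Local Notation leb := (@lebesgue_rV R d).
Implicit Types a : 'rV[R]_d -> R.

Lemma ess_inf_on_le a : {ae leb, forall x, Omega x -> (ess_inf_on Omega a <= (a x)%:E)%E}.
Proof.
have := ess_inf_le leb (patch (cst +oo%E) Omega (EFin \o a)).
by apply: filterS => x; rewrite /patch => + Ox; rewrite mem_set.
Qed.

Lemma ess_inf_on_lty a : Omega !=set0 -> (ess_inf_on Omega a < +oo)%E.
Proof.
move=> O0; rewrite ltey; apply/negP => /eqP /ess_inf_eqyP H.
have : leb.-negligible Omega.
  apply: negligibleS H => x Ox /=; rewrite /patch mem_set//=.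
move=> /negligibleP -/(_ (open_measurable_rV oOmega)) O00.
by have := lebesgue_rV_open_gt0 oOmega O0; rewrite O00 ltxx.
Qed.

Lemma ess_inf_on_lt a (al : R) : (ess_inf_on Omega a < al%:E)%E ->
  ~ leb.-negligible [set x | Omega x /\ a x < al].
Proof.
move=> lt_al N; move: lt_al; apply/negP; rewrite -leNgt; apply/ess_infP.
apply: negligibleS N => x /=; rewrite /patch; case: ifPn => [/set_mem Ox|_].
  by move=> /negP; rewrite lee_fin -ltNge.
by move=> []; exact: leey.
Qed.

End ess_inf_on_facts.

Section Lp_split.
Context {R : realType} {n : nat}.
Local Notation d := n.+1.
Variable Omega : set 'rV[R]_d.
Hypothesis oOmega : open Omega.
Local Notation leb := (@lebesgue_rV R d).

(** For finite p, keep in [V] only the part of |b| above height 1, where |b|^d <= |b|^p because d <=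
    p. For p infinite, [b] is essentially bounded and [V = 0]. *)
Lemma Lp_split p (b : 'rV[R]_d -> R) : (d%:R%:E <= p)%E -> Lp Omega p b ->
  exists (V : 'rV[R]_d -> R) (M : R), [/\ measurable_fun setT V, forall x, 0 <= V x,
    (\int[leb]_x (V x ^+ d)%:E < +oo)%E, 0 <= M &
    {ae leb, forall x, Omega x -> `|b x| <= V x + M}].
Proof.
move=> dp [mb]; rewrite unlock; pose B := b \_ Omega.
have mB : measurable_fun setT B.
  exact/(measurable_restrictT _ (open_measurable_rV oOmega)).
have BO x : Omega x -> B x = b x by move=> Ox; rewrite /B patchE mem_set.
have mnB : measurable_fun setT (fun x => `|B x|) by exact: measurableT_comp.
case: p dp => [r| |]// dr Bfin.
- rewrite lee_fin in dr.
  have r0 : 0 < r by rewrite (lt_le_trans _ dr)// ltr0n.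
  (* The norm is the power [r^-1] of this integral and would be infinite with it. *)
  have Ifin : (\int[leb]_x (`|B x| `^ r)%:E < +oo)%E.
    move: Bfin; rewrite -/B !ltey; apply: contraNneq => ->.
    by rewrite poweRyr// invr_eq0 gt_eqF.
  pose E := [set x | 1 < `|B x|].
  have mE : measurable E.
    rewrite -[E]setTI (_ : setT `&` E = setT `&` (fun x => `|B x|) @^-1` `]1, +oo[%classic).
      exact: mnB.
    by apply/seteqP; split => x [_ /=]; rewrite in_itv/= andbT.
  exists (fun x => `|B x| * \1_E x), 1; split => //.
  + by apply: measurable_funM => //; exact: measurable_indic.
  + apply: le_lt_trans Ifin; apply: ge0_le_integral => //.
    * apply/measurable_EFinP; apply: measurable_funX.
      by apply: measurable_funM; [exact: mnB|exact: measurable_indic].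
    * apply/measurable_EFinP.
      apply: (@measurableT_comp _ _ _ _ _ _ (fun x : R => x `^ r)%R).
        exact: measurable_powR.
      exact: mnB.
    * move=> x _; rewrite lee_fin indicE; have [xE|xE] := boolP (x \in E).
        rewrite mulr1 -powR_mulrn//; apply: ler_powR => //.
        by apply: ltW; exact: (set_mem xE).
      by rewrite mulr0 expr0n/= powR_ge0.
  + apply: aeW => x Ox; rewrite -(BO x Ox) indicE; have [xE|xE] := boolP (x \in E).
      by rewrite mulr1 lerDl.
    rewrite mulr0 add0r leNgt; apply/negP => h; move/negP: xE; apply.
    exact: mem_set.
- have leb0 : (0 < leb setT)%E.
    by apply: lebesgue_rV_open_gt0; [exact: openT|exists 0].
  move: Bfin; rewrite leb0; set e := ess_sup _ _ => efin.
  (* The maximum with 0 covers [e = -oo] and provides [0 <= M]. *)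
  have eM : (e <= (Num.max (fine e) 0)%:E)%E.
    case: e efin => [s| |]// _; first by rewrite lee_fin le_max lexx.
    by rewrite leNye.
  exists (cst 0), (Num.max (fine e) 0); split => //.
  + by under eq_integral do rewrite expr0n/=; rewrite integral0.
  + by rewrite le_max lexx orbT.
  + have /ess_supP := eM; apply: filterS => x /= + Ox.
    by rewrite -/B -(BO x Ox) lee_fin add0r.
Qed.

End Lp_split.

(** * Integrals of signed weights against |f|^2 *)

Section weighted_integrability.
Context {R : realType} {d : nat} (Omega : set 'rV[R]_d).
Hypothesis oOmega : open Omega.
Local Notation leb := (@lebesgue_rV R d).
Local Notation C := R[i].
Local Notation Re := (@complex.Re R).
Implicit Types (f g phi psi : 'rV[R]_d -> C) (u v w : 'rV[R]_d -> R).

Let mOmega : measurable Omega. Proof. exact: open_measurable_rV. Qed.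

(** Carried along explicitly for signed [u], because the real-valued integral returns 0 when the
    extended one is infinite. *)
Definition wintegrable u f :=
  leb.-integrable Omega (EFin \o (fun x => u x * sqmod (f x))).

Lemma wintegrableD u v f : wintegrable u f -> wintegrable v f ->
  wintegrable (fun x => u x + v x) f.
Proof.
move=> iu iv; have := integrableD mOmega iu iv.
by apply: eq_integrable => // x _; rewrite /= -EFinD mulrDl.
Qed.

Lemma wintegrableZ (k : R) u f : wintegrable u f -> wintegrable (fun x => k * u x) f.
Proof.
move=> iu; have := integrableZl mOmega k iu.
by apply: eq_integrable => // x _; rewrite /= -EFinM mulrA.
Qed.

Lemma wintegrable_wnorm u f : measurable_fun Omega u -> cmeasurable Omega f ->
  (forall x, Omega x -> 0 <= u x) -> (wnorm Omega u f < +oo)%E -> wintegrable u f.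
Proof.
move=> mu mf u0 fin; apply/integrableP; split; first exact: measurable_wsqmod.
apply: le_lt_trans fin; rewrite le_eqVlt; apply/orP; left; apply/eqP.
apply: eq_integral => x /set_mem Ox; rewrite /= ger0_norm// mulr_ge0 ?sqmod_ge0//.
exact: u0.
Qed.

Lemma wintegrable_ae_le u v f : measurable_fun Omega u -> cmeasurable Omega f ->
  wintegrable v f -> {ae leb, forall x, Omega x -> `|u x| <= v x} ->
  wintegrable u f.
Proof.
move=> mu mf /integrableP[mv iv] uv; apply/integrableP; split.
  exact: measurable_wsqmod.
have ma w : measurable_fun Omega (fun x => (w x * sqmod (f x))%:E) ->
    measurable_fun Omega (fun x => `|(w x * sqmod (f x))%:E|%E).
  by move=> mw; exact: measurableT_comp.
apply: le_lt_trans iv; apply: ae_ge0_le_integral => //.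
- by apply: ma; exact: measurable_wsqmod.
- exact: ma.
- apply: filterS uv => x + Ox => /(_ Ox) uvx.
  rewrite /= lee_fin !normrM ler_wpM2r//.
  exact: le_trans uvx (ler_norm _).
Qed.

Lemma wintegrable1 f : L2 Omega f -> wintegrable (cst 1) f.
Proof.
move=> Lf; apply: wintegrable_wnorm => //; first exact: L2_cmeasurable.
by rewrite wnorm1; case: Lf.
Qed.

Lemma wintegrable_cst (c : R) f : L2 Omega f -> wintegrable (cst c) f.
Proof.
move=> /wintegrable1/(wintegrableZ c).
by apply: eq_integrable => // x _; rewrite /= mulr1.
Qed.

(** |phi|^2 is bounded and vanishes off a compact subset of [Omega], on which [u] is integrable. *)
Lemma wintegrable_L1loc u phi : L1loc Omega u -> test_function Omega phi ->
  wintegrable u phi.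
Proof.
move=> [mu iu] tp; have [sr si [K cK [KO K0]]] := (test_functionP _ _).1 tp.
have ss : smooth (fun x => sqmod (phi x)).
  exact: (smoothD (smoothM sr sr) (smoothM si si)).
have sK x : ~ K x -> sqmod (phi x) = 0 by move=> /K0 ->; rewrite sqmod_real expr0n.
have [M M0 sM] := continuous_bounded (smooth_continuous ss) cK sK.
have mK : measurable K.
  by apply: closed_measurable_rV; apply: compact_closed => //; exact: norm_hausdorff.
have : leb.-integrable K (EFin \o (fun x => u x * sqmod (phi x))).
  apply: (integrableM_bounded mK (iu _ cK KO) _ (M := M)) => [|x _]; last exact: sM.
  by apply: measurable_funTS; apply: continuous_measurable_rV; exact: smooth_continuous ss.
rewrite /wintegrable => /(integrable_mkcond _ mK) H; apply/(integrable_mkcond _ mOmega).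
move: H; apply: eq_integrable => // x _; rewrite !patchE.
case: ifPn => [/set_mem/KO Ox|/negP xK]; first by rewrite mem_set.
by case: ifPn => //= _; rewrite sK ?mulr0// => Kx; apply: xK; exact: mem_set.
Qed.

Lemma wintegrable_abs u f : wintegrable u f -> wintegrable (fun x => `|u x|) f.
Proof.
move=> /integrable_abse; apply: eq_integrable => // x _.
by rewrite /= normrM [`|sqmod _|]ger0_norm// sqmod_ge0.
Qed.

Lemma wintegrable_lty u f : wintegrable u f -> (wnorm Omega u f < +oo)%E.
Proof.
move=> iu; have fin := integrable_fin_num mOmega iu.
by rewrite /wnorm; move: fin; rewrite fin_numElt => /andP[].
Qed.

(** The chosen weak derivative of [f - f] is 0 only almost everywhere, hence the detour through
    [weak_partialB]. Thanks to this, a test function is approximated by its own constant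
    sequence. *)
Lemma sqnorm_H1_subrr f : H1 Omega f -> sqnorm_H1 Omega (fun x => f x - f x) = 0%E.
Proof.
move=> Hf; have z : sqnorm Omega (fun x => f x - f x) = 0%E.
  rewrite sqnormE; under eq_integral do rewrite subrr sqmod_real expr0n.
  by rewrite integral0.
rewrite /sqnorm_H1 z adde0 big1// => i _.
have [Lw _] := weak_partialP i (H1B oOmega Hf Hf).
have [L _] := weak_partialP i Hf.
rewrite (@sqnorm_ae _ _ _ oOmega _ (fun x => weak_partial Omega i f x - weak_partial Omega i f x)).
- rewrite sqnormE; under eq_integral do rewrite subrr sqmod_real expr0n.
  by rewrite integral0.
- exact: L2_cmeasurable Lw.
- by apply: cmeasurableB; exact: L2_cmeasurable L.
- exact: weak_partialB.
Qed.

Lemma wRintegral_ae_le u v f : cmeasurable Omega f ->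
  wintegrable u f -> wintegrable v f ->
  {ae leb, forall x, Omega x -> u x <= v x} ->
  \int[leb]_(x in Omega) (u x * sqmod (f x)) <=
  \int[leb]_(x in Omega) (v x * sqmod (f x)).
Proof.
move=> mf iu iv uv.
have [mu _] := integrableP _ _ _ iu; have [mv _] := integrableP _ _ _ iv.
(* Monotonicity of the real integral asks for a pointwise inequality: [m] equals the left integrand
   almost everywhere and lies below the right one everywhere. *)
pose m x := Num.min (u x * sqmod (f x)) (v x * sqmod (f x)).
have mm : measurable_fun Omega (EFin \o m).
  by apply/measurable_EFinP; apply: measurable_minr; exact/measurable_EFinP.
have E : ae_eq leb Omega (EFin \o (fun x => u x * sqmod (f x))) (EFin \o m).
  apply: filterS uv => x + Ox => /(_ Ox) uvx.
  by rewrite /= /m min_l// ler_wpM2r// sqmod_ge0.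
have im : leb.-integrable Omega (EFin \o m).
  apply/integrableP; split => //.
  have /integrableP[_] := iu; apply: le_lt_trans.
  rewrite le_eqVlt; apply/orP; left; apply/eqP.
  apply: ae_eq_integral => //; [exact: measurableT_comp|exact: measurableT_comp|].
  by apply: filterS E => x + Ox => /(_ Ox) ->.
have -> : \int[leb]_(x in Omega) (u x * sqmod (f x)) = \int[leb]_(x in Omega) m x.
  by rewrite /Rintegral; congr fine; exact: ae_eq_integral E.
apply: le_Rintegral => // x _; rewrite /m ge_min lexx orbT//.
Qed.

Lemma wRintegralD u v f : wintegrable u f -> wintegrable v f ->
  \int[leb]_(x in Omega) ((u x + v x) * sqmod (f x)) =
  \int[leb]_(x in Omega) (u x * sqmod (f x)) + \int[leb]_(x in Omega) (v x * sqmod (f x)).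
Proof.
by move=> iu iv; rewrite -RintegralD//; apply: eq_Rintegral => x _; rewrite mulrDl.
Qed.

Lemma wRintegralZ (k : R) u f : wintegrable u f ->
  \int[leb]_(x in Omega) (k * u x * sqmod (f x)) =
  k * \int[leb]_(x in Omega) (u x * sqmod (f x)).
Proof.
by move=> iu; rewrite -RintegralZl//; apply: eq_Rintegral => x _; rewrite mulrA.
Qed.

Lemma wRintegral_cst (c : R) f : L2 Omega f ->
  \int[leb]_(x in Omega) (c * sqmod (f x)) = c * fine (sqnorm Omega f).
Proof.
move=> Lf; have := wRintegralZ c (wintegrable1 Lf).
rewrite -wnorm1 => <-; apply: eq_Rintegral => x _; by rewrite mulr1.
Qed.

Lemma wRintegral_fin u f : wintegrable u f ->
  (\int[leb]_(x in Omega) (u x * sqmod (f x)))%:E = wnorm Omega u f.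
Proof. by move=> iu; rewrite /Rintegral fineK//; exact: integrable_fin_num. Qed.

Lemma sqnorm_gt0 f : L2 Omega f -> ~ ae_eq leb Omega f (cst 0) ->
  0 < fine (sqnorm Omega f).
Proof.
move=> Lf f0; have [_ _ fin] := Lf.
rewrite fine_gt0// fin andbT lt0e sqnorm_ge0 andbT; apply/eqP => s0.
apply: f0; have ms := measurable_sqmod (L2_cmeasurable Lf).
have : ae_eq leb Omega (EFin \o (fun x => sqmod (f x))) (cst 0%E).
  apply/(ae_eq_integral_abs _ mOmega); first exact/measurable_EFinP.
  rewrite -s0 sqnormE; apply: eq_integral => x _.
  by rewrite /= ger0_norm// sqmod_ge0.
by apply: filterS => x + Ox => /(_ Ox)/= [] /sqmod_eq0.
Qed.

Lemma Re_inner_mul u f : Re (inner Omega f (fun x => (u x)%:C%C * f x)) =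
  \int[leb]_(x in Omega) (u x * sqmod (f x)).
Proof. by apply: eq_Rintegral => x _; rewrite Re_conjMr. Qed.

Lemma Re_inner_self f : Re (inner Omega f f) = fine (sqnorm Omega f).
Proof.
by rewrite sqnormE; apply: eq_Rintegral => x _; rewrite Re_conjM.
Qed.

Lemma Re_form a b (mu : R) psi : Re (Defs.form Omega a b mu psi psi) =
  \sum_(i < d) fine (sqnorm Omega (weak_partial Omega i psi)) +
  mu * \int[leb]_(x in Omega) (a x * sqmod (psi x)) +
  \int[leb]_(x in Omega) (b x * sqmod (psi x)).
Proof.
have ReZ (k : R) z : Re (k%:C%C * z) = k * Re z.
  by case: z => x y /=; rewrite mul0r subr0.
rewrite /Defs.form !complexReD ReZ !Re_inner_mul; congr (_ + _ + _).
rewrite (big_morph Re complexReD (erefl _)).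
by apply: eq_bigr => i _; exact: Re_inner_self.
Qed.

End weighted_integrability.

Section lower_bound.
Context {R : realType} {n : nat}.
Local Notation d := n.+1.
Variable Omega : set 'rV[R]_d.
Hypotheses (oOmega : open Omega) (Omega0 : Omega !=set0).
Local Notation leb := (@lebesgue_rV R d).
Local Notation C := R[i].
Local Notation Re := (@complex.Re R).
Variables a b b1 b2 : 'rV[R]_d -> R.
Hypotheses (ha : L1loc Omega a) (hb : L1loc Omega b) (hb1 : L1loc Omega b1).
Hypothesis ha_min : (-oo < ess_inf_on Omega a)%E.
Hypothesis hb12 : ae_eq leb Omega b (fun x => b1 x + b2 x).
Hypothesis hb1_min : (-oo < ess_inf_on Omega b1)%E.
Variable p : \bar R.
Hypotheses (hp : (d%:R%:E <= p)%E) (hb2 : Lp Omega p b2).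

Let mOmega : measurable Omega. Proof. exact: open_measurable_rV. Qed.
Let am := fine (ess_inf_on Omega a).
Let bm := fine (ess_inf_on Omega b1).

Lemma fine_ess_inf_on_le (f : 'rV[R]_d -> R) : (-oo < ess_inf_on Omega f)%E ->
  {ae leb, forall x, Omega x -> fine (ess_inf_on Omega f) <= f x}.
Proof.
move=> f0; have := ess_inf_on_le Omega f; apply: filterS => x + Ox => /(_ Ox).
rewrite -{1}(fineK (x := ess_inf_on Omega f)) ?lee_fin// fin_numE -ltNye f0.
by rewrite -ltey ess_inf_on_lty.
Qed.

(** The squared form norm dominates its H^1 part, so the same sequence converges in H^1. *)
Lemma form_domain_H1_limit mu psi :
  form_domain Omega a b1 b2 mu psi -> H1_limit Omega psi.
Proof.
move=> [Hp [phi [tp cv]]]; split => //; exists phi; split => //.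
apply: (squeeze_cvge _ _ cv).
  apply: nearW => k; rewrite /sqnorm_form leeDl ?sqnorm_ge0// andbT.
  by apply: adde_ge0; [exact: sqnorm_wgrad_ge0|exact: sqnorm_ge0].
exact: cvg_cst.
Qed.

Lemma rayleigh_ge : exists c : R, forall mu psi, 0 < mu ->
  form_domain Omega a b1 b2 mu psi -> ~ ae_eq leb Omega psi (cst 0) ->
  mu * am - c <= rayleigh Omega a b mu psi.
Proof.
have [V [M [mV V0 Vfin M0 b2V]]] := Lp_split oOmega hp hb2.
have [c c0 bound] := form_bound oOmega mV V0 Vfin.
(* [c] is the zeroth-order cost of [V], [M] bounds the rest of [b2], and [bm] is the lower bound of
   [b1]; none of them involves [mu]. *)
exists (c + M - bm) => mu psi mu0 Dpsi npsi.
have Hlim := form_domain_H1_limit Dpsi.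
have [Hp [phi [tphi cv]]] := Dpsi.
have [Lp _] := Hp; have mp := L2_cmeasurable Lp.
have [ma _] := ha; have [mb _] := hb; have [mb1 _] := hb1; have [mb2 _] := hb2.
have aele := fine_ess_inf_on_le ha_min; have b1le := fine_ess_inf_on_le hb1_min.
pose W := form_weight Omega a b1 b2 mu.
have mW : measurable_fun Omega W.
  apply: measurable_funD.
    apply: measurable_funB; last exact: measurable_cst.
    apply: measurable_funD => //; apply: measurable_funM => //.
    by apply: measurable_funB.
  by apply: measurable_maxr => //; exact: measurable_cst.
(* The form weight is nonnegative only almost everywhere, and [Num.sqrt] sends negative numbers to
   0. The weighted part of the form norm is therefore literally the one with weight [Wp]. *)
pose Wp x := Num.max (W x) 0.
have mWp : measurable_fun Omega Wp.
  by apply: measurable_maxr => //; exact: measurable_cst.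
have Wp0 x : 0 <= Wp x by rewrite le_max lexx orbT.
have mVO : measurable_fun Omega V by exact: measurable_funTS.
have iVtest f : test_function Omega f -> wintegrable Omega V f.
  move=> tf; apply: wintegrable_wnorm => //.
    exact: L2_cmeasurable (test_function_L2 oOmega tf).
  have Hf := test_function_H1 oOmega tf.
  apply: le_lt_trans (bound f _) _.
    split => //; exists (fun=> f); split => //.
    by rewrite sqnorm_H1_subrr//; exact: cvg_cst.
  apply: lte_add_pinfty; first exact: sqnorm_wgrad_fin.
  by apply: lte_mul_pinfty; rewrite ?lee_fin//; have [[]] := Hf.
have WpE f : sqnorm Omega (fun x => (Num.sqrt (W x))%:C%C * f x) = wnorm Omega Wp f.
  rewrite sqnormE; apply: eq_integral => x _; rewrite sqmodZ sqmod_real /Wp.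
  have [w0|w0] := leP 0 (W x); first by rewrite sqr_sqrtr// max_l.
  by rewrite ltr0_sqrtr// expr0n.
have iWp_test f : test_function Omega f -> wintegrable Omega Wp f.
  move=> tf; have Lf := test_function_L2 oOmega tf.
  have iabs u : L1loc Omega u -> wintegrable Omega (fun x => `|u x|) f.
    by move=> lu; apply: (wintegrable_abs oOmega); exact: (wintegrable_L1loc oOmega lu tf).
  apply: (wintegrable_ae_le oOmega mWp (L2_cmeasurable Lf)
    (wintegrableD oOmega (wintegrableD oOmega (wintegrableD oOmega
      (wintegrableZ oOmega mu (iabs a ha)) (iabs b1 hb1)) (iVtest f tf))
      (wintegrable_cst oOmega (mu * `|am| + `|bm| + M) Lf))).
  apply: filterS b2V => x + Ox => /(_ Ox) h.
  rewrite ger0_norm// /Wp ge_max; apply/andP; split; last first.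
    by rewrite !addr_ge0 ?mulr_ge0// ltW.
  rewrite /W /form_weight -/am -/bm /=.
  have m2 : Num.max (b2 x) 0 <= `|b2 x| by rewrite ge_max ler_norm normr_ge0.
  have la := ler_norm (a x); have lb := ler_norm (b1 x).
  have la' : - am <= `|am| by rewrite -normrN ler_norm.
  have lb' : - bm <= `|bm| by rewrite -normrN ler_norm.
  have := ler_wpM2l (ltW mu0) (lerD la la'); rewrite !mulrDr mulrN; lra.
have iWp : wintegrable Omega Wp psi.
  (* [psi] lies at finite form distance from some test function, whose own weighted norm is
     finite. *)
  have [k _ /(_ k (leqnn k))/= ek] := cvge0_near_lt cv ltr01.
  apply: wintegrable_wnorm => //.
  have Lk := test_function_L2 oOmega (tphi k).
  have LB := L2B oOmega Lk Lp.
  apply: (@le_lt_trans _ _ (2%:E * wnorm Omega Wp (phi k) +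
      2%:E * wnorm Omega Wp (fun x => (phi k x - psi x)%R))%E).
    apply: (wnorm_le2 oOmega) => //.
    - exact: L2_cmeasurable Lk.
    - exact: L2_cmeasurable LB.
    - by move=> x _; rewrite sqmodBC; exact: sqmod_triangle.
  apply: lte_add_pinfty; apply: lte_mul_pinfty; rewrite ?lee_fin//.
    by apply: wintegrable_lty => //; exact: iWp_test.
  rewrite -WpE; apply: le_lt_trans (lt_trans ek (ltry 1)).
  rewrite /sqnorm_form leeDr//.
  by apply: adde_ge0; [exact: sqnorm_wgrad_ge0|exact: sqnorm_ge0].
have i1 (k : R) := wintegrable_cst oOmega k Lp.
have iV : wintegrable Omega V psi.
  apply: wintegrable_wnorm => //; apply: le_lt_trans (bound _ Hlim) _.
  apply: lte_add_pinfty; first exact: sqnorm_wgrad_fin.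
  by apply: lte_mul_pinfty; rewrite ?lee_fin//; case: Lp.
(* The summands of the weight are nonnegative almost everywhere, so each is dominated by the whole.
   This recovers the integrability of [a] and of [b1] against |psi|^2 separately. *)
have Wge : {ae leb, forall x, Omega x ->
    0 <= mu * (a x - am) <= Wp x /\ 0 <= b1 x - bm <= Wp x}.
  apply: filterS2 aele b1le => x + + Ox => /(_ Ox) h1 /(_ Ox) h2.
  have h3 : 0 <= mu * (a x - am) by rewrite mulr_ge0 ?subr_ge0// ltW.
  have h4 : 0 <= b1 x - bm by rewrite subr_ge0.
  have h5 : 0 <= Num.max (b2 x) 0 by rewrite le_max lexx orbT.
  have WE : W x = mu * (a x - am) + (b1 x - bm) + Num.max (b2 x) 0.
    by rewrite /W /form_weight addrA.
  by rewrite h3 h4 /Wp !le_max WE; split; apply/orP; left; lra.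
have ia : wintegrable Omega a psi.
  apply: (wintegrable_ae_le oOmega ma mp
    (wintegrableD oOmega (wintegrableZ oOmega mu^-1 iWp) (i1 `|am|))).
  apply: filterS Wge => x + Ox => /(_ Ox)[/andP[h1 h2] _].
  have h3 : 0 <= a x - am by rewrite -(pmulr_rge0 _ mu0).
  have h4 : a x - am <= mu^-1 * Wp x by rewrite ler_pdivlMl.
  rewrite -{1}(subrK am (a x)); apply: le_trans (ler_normD _ _) _.
  by rewrite ger0_norm// lerD2r.
have ib1 : wintegrable Omega b1 psi.
  apply: (wintegrable_ae_le oOmega mb1 mp (wintegrableD oOmega iWp (i1 `|bm|))).
  apply: filterS Wge => x + Ox => /(_ Ox)[_ /andP[h1 h2]].
  rewrite -{1}(subrK bm (b1 x)); apply: le_trans (ler_normD _ _) _.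
  by rewrite ger0_norm// lerD2r.
have ib : wintegrable Omega b psi.
  apply: (wintegrable_ae_le oOmega mb mp
    (wintegrableD oOmega (wintegrable_abs oOmega ib1) (wintegrableD oOmega iV (i1 M)))).
  apply: filterS2 hb12 b2V => x + + Ox => /(_ Ox) -> /(_ Ox) h.
  by apply: le_trans (ler_normD _ _) _; rewrite lerD2l.
pose S := fine (sqnorm Omega psi).
have S0 : 0 < S by exact: sqnorm_gt0.
have le_a : am * S <= \int[leb]_(x in Omega) (a x * sqmod (psi x)).
  rewrite -wRintegral_cst//; apply: wRintegral_ae_le => //; exact: i1.
(* Almost everywhere b = b1 + b2 >= bm - M - V. *)
have le_b : (bm - M) * S - \int[leb]_(x in Omega) (V x * sqmod (psi x)) <=
    \int[leb]_(x in Omega) (b x * sqmod (psi x)).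
  rewrite -[in leLHS](wRintegral_cst oOmega)// -[X in _ - X]mul1r -mulNr.
  rewrite -(wRintegralZ oOmega _ iV) -(wRintegralD oOmega (i1 _) (wintegrableZ oOmega _ iV)).
  apply: (wRintegral_ae_le oOmega mp _ ib).
    exact: wintegrableD (i1 _) (wintegrableZ oOmega _ iV).
  apply: filterS3 hb12 b2V b1le => x + + + Ox => /(_ Ox) -> /(_ Ox) h /(_ Ox) h'.
  move: h; rewrite ler_norml => /andP[h _]; move: h'; rewrite -/bm => h'.
  by change (bm - M + - 1 * V x <= b1 x + b2 x); lra.
have le_V : \int[leb]_(x in Omega) (V x * sqmod (psi x)) <=
    \sum_(i < d) fine (sqnorm Omega (weak_partial Omega i psi)) + c * S.
  rewrite -lee_fin (wRintegral_fin oOmega iV); apply: le_trans (bound _ Hlim) _.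
  have Sfin : sqnorm Omega psi \is a fin_num.
    by rewrite ge0_fin_numE ?sqnorm_ge0//; case: Lp.
  rewrite EFinD EFinM /S (fineK Sfin) leeD2r// -sumEFin; apply: lee_sum => i _.
  rewrite fineK// ge0_fin_numE ?sqnorm_ge0//.
  by have [[]] := weak_partialP i Hp.
(* The gradient terms cancel: what [V] takes away is at most the gradient part of the form plus
   [c * S]. *)
rewrite /rayleigh Re_form ler_pdivlMr// -/S.
have := ler_wpM2l (ltW mu0) le_a.
nra.
Qed.

End lower_bound.

(** * Upper bound for the min-max values *)

Section finite_family.
Context {R : realType} {d : nat}.
Variable Omega : set 'rV[R]_d.
Hypothesis oOmega : open Omega.
Local Notation leb := (@lebesgue_rV R d).
Local Notation C := R[i].
Local Notation Re := (@complex.Re R).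
Local Notation Im := (@complex.Im R).

Let mOmega : measurable Omega. Proof. exact: open_measurable_rV. Qed.

Lemma Rintegral_lin (I : Type) (s : seq I) (k : I -> R) (u : I -> 'rV[R]_d -> R) :
  (forall i, leb.-integrable Omega (EFin \o u i)) ->
  leb.-integrable Omega (EFin \o (fun x => \sum_(i <- s) k i * u i x)) /\
  \int[leb]_(x in Omega) (\sum_(i <- s) k i * u i x) =
    \sum_(i <- s) k i * \int[leb]_(x in Omega) u i x.
Proof.
move=> iu; elim: s => [|i s [is_ Es]].
  split.
    rewrite (_ : _ \o _ = cst 0%E); first exact: integrable0.
    by apply/funext => x; rewrite /= big_nil.
  rewrite big_nil /Rintegral (_ : (\int[leb]_(x in Omega) _ = 0)%E)//.
  by rewrite integral0_eq// => x _; rewrite big_nil.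
have iZ : leb.-integrable Omega (EFin \o (fun x => k i * u i x)).
  by have := integrableZl mOmega (k i) (iu i).
split.
  have := integrableD mOmega iZ is_.
  by apply: eq_integrable => // x _; rewrite /= big_cons EFinD.
under eq_Rintegral do rewrite big_cons.
by rewrite RintegralD// RintegralZl// Es big_cons.
Qed.

Let eq_lexx (x y : R) : x = y -> x <= y. Proof. by move=> ->. Qed.

(** A crude constant is enough: it will only affect the part of the upper bound that is independent
    of [mu]. *)
Lemma sqmod_sum_le (I : Type) (s : seq I) (z : I -> C) :
  sqmod (\sum_(i <- s) z i) <= 2 ^+ size s * \sum_(i <- s) sqmod (z i).
Proof.
elim: s => [|i s ih]; first by rewrite !big_nil sqmod_real expr0n mulr0.
rewrite !big_cons /=.
set w := \sum_(j <- s) z j; set W := \sum_(j <- s) sqmod (z j).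
have h : sqmod (z i + w) <= 2 * sqmod (z i) + 2 * sqmod w.
  have := sqmodB_triangle (z i) (- w); rewrite opprK => /le_trans; apply.
  by rewrite /sqmod complexReN complexImN !sqrrN.
have p1 : 1 <= 2 ^+ size s :> R by rewrite exprn_ege1// ler1n.
have z0 := sqmod_ge0 (z i).
apply: (le_trans h); rewrite exprS; have := ler_wpM2r z0 p1; rewrite mul1r.
move: ih; rewrite -/w -/W; nra.
Qed.

Variables (m : nat) (F : 'I_m -> 'rV[R]_d -> C).
Hypothesis tF : forall i, test_function Omega (F i).
Hypothesis disj : forall i j x, i != j -> F i x = 0 \/ F j x = 0.
Hypothesis F0 : forall i, ~ ae_eq leb Omega (F i) (cst 0).

Definition comb (c : 'I_m -> C) (x : 'rV[R]_d) : C := \sum_(i < m) c i * F i x.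

Lemma comb_test c : test_function Omega (comb c).
Proof.
rewrite /comb; elim: (index_enum _) => [|i s ih].
  by under eq_fun do rewrite big_nil; exact: test_function0.
by under eq_fun do rewrite big_cons; exact: test_functionD.
Qed.

Lemma cpartial_comb c j x : cpartial j (comb c) x = \sum_(i < m) c i * cpartial j (F i) x.
Proof.
suff [_ ->] : test_function Omega (fun y => \sum_(i <- index_enum 'I_m) c i * F i y) /\
    cpartial j (fun y => \sum_(i <- index_enum 'I_m) c i * F i y) x =
    \sum_(i <- index_enum 'I_m) c i * cpartial j (F i) x by [].
elim: (index_enum _) => [|i s [tih ih]].
  split; first by under eq_fun do rewrite big_nil; exact: test_function0.
  rewrite big_nil; under eq_fun do rewrite big_nil.
  by apply: complex_eq; exact: derive_cst.
have E : (fun y => \sum_(k <- i :: s) c k * F k y) =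
  (fun y => c i * F i y + \sum_(k <- s) c k * F k y).
  by apply/funext => y; rewrite big_cons.
rewrite E; split; first exact: test_functionD.
by rewrite big_cons (cpartialD _ _ _ (tF i) tih) ih.
Qed.

(** At each point at most one summand survives, so there are no cross terms and weighted integrals
    become diagonal in the coefficients. *)
Lemma sqmod_comb c x : sqmod (comb c x) = \sum_(i < m) sqmod (c i) * sqmod (F i x).
Proof.
have [h|/existsNP[i Fi]] := pselect (forall i, F i x = 0).
  rewrite /comb !big1 ?sqmod_real ?expr0n// => i _; rewrite h ?mulr0//.
  by rewrite sqmod_real expr0n mulr0.
have Fj j : j != i -> F j x = 0 by move=> ji; have [] := disj x ji.
rewrite /comb (bigD1 i)//= big1 => [|j ji]; last by rewrite Fj// mulr0.
rewrite [RHS](bigD1 i)//= big1 => [|j ji]; last by rewrite Fj// sqmod_real expr0n mulr0.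
by rewrite !addr0 sqmodZ.
Qed.

Lemma wRintegral_comb (u : 'rV[R]_d -> R) c :
  (forall i, wintegrable Omega u (F i)) ->
  \int[leb]_(x in Omega) (u x * sqmod (comb c x)) =
  \sum_(i < m) sqmod (c i) * \int[leb]_(x in Omega) (u x * sqmod (F i x)).
Proof.
move=> iu; have [_ <-] := Rintegral_lin (index_enum 'I_m) (fun i => sqmod (c i)) iu.
apply: eq_Rintegral => x _; rewrite sqmod_comb mulr_sumr.
by apply: eq_bigr => i _; rewrite mulrCA.
Qed.

Lemma sqnorm_comb c : fine (sqnorm Omega (comb c)) =
  \sum_(i < m) sqmod (c i) * fine (sqnorm Omega (F i)).
Proof.
have E f : fine (sqnorm Omega f) = \int[leb]_(x in Omega) (cst 1 x * sqmod (f x)).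
  by rewrite -wnorm1.
rewrite E wRintegral_comb => [|i]; last by apply: wintegrable1; exact: test_function_L2.
by apply: eq_bigr => i _; rewrite E.
Qed.

(** [disj] speaks of values, not of derivatives; [sqmod_sum_le] avoids discussing the latter and
    costs only the factor [2 ^+ m]. *)
Lemma sqnorm_cpartial_comb c j : fine (sqnorm Omega (cpartial j (comb c))) <=
  \sum_(i < m) sqmod (c i) * (2 ^+ m * fine (sqnorm Omega (cpartial j (F i)))).
Proof.
have LD f : test_function Omega f -> L2 Omega (cpartial j f).
  by move=> tf; apply: test_function_L2 => //; exact: test_function_cpartial.
have i1 i := wintegrable1 (LD _ (tF i)).
have E f : fine (sqnorm Omega f) = \int[leb]_(x in Omega) (cst 1 x * sqmod (f x)).
  by rewrite -wnorm1.
have [il El] := Rintegral_lin (index_enum 'I_m) (fun i => 2 ^+ m * sqmod (c i)) i1.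
have -> : \sum_(i < m) sqmod (c i) * (2 ^+ m * fine (sqnorm Omega (cpartial j (F i)))) =
    \int[leb]_(x in Omega) (\sum_(i < m) 2 ^+ m * sqmod (c i) *
      (cst 1 x * sqmod (cpartial j (F i) x))).
  apply: (etrans _ (esym El)); apply: eq_bigr => i _.
  by rewrite mulrCA mulrA; congr (_ * _); exact: (E (cpartial j (F i))).
apply: (le_trans (eq_lexx (E (cpartial j (comb c))))).
apply: le_Rintegral => //; first exact: wintegrable1 (LD _ (comb_test c)).
move=> x _; rewrite /= mul1r cpartial_comb; apply: le_trans (sqmod_sum_le _ _) _.
rewrite /index_enum -enumT size_enum_ord mulr_sumr; apply: ler_sum => i _.
by rewrite sqmodZ mul1r mulrA.
Qed.

Lemma minmax_le_of_family a b b1 b2 (t : R) :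
  L1loc Omega a -> L1loc Omega b ->
  (forall i, \int[leb]_(x in Omega) (a x * sqmod (F i x)) <= t * fine (sqnorm Omega (F i))) ->
  exists c : R, forall mu, 0 < mu ->
    (minmax Omega a b b1 b2 mu m <= (mu * t + c)%:E)%E.
Proof.
move=> ha hb at_.
pose N i := fine (sqnorm Omega (F i)).
have N0 i : 0 < N i by apply: sqnorm_gt0 => //; exact: test_function_L2.
pose B i := \int[leb]_(x in Omega) (b x * sqmod (F i x)).
pose G i := \sum_(j < d) 2 ^+ m * fine (sqnorm Omega (cpartial j (F i))).
(* The sum bounds each of its ratios, whose absolute values are taken because [B i] has no sign. *)
pose c := \sum_(i < m) `|G i + B i| / N i.
have c_ge i : `|G i + B i| / N i <= c.
  rewrite /c (bigD1 i)//= lerDl; apply: sumr_ge0 => k _.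
  by rewrite divr_ge0// ltW.
exists c => mu mu0.
pose L : set ('rV[R]_d -> C) := [set f | exists k, f = comb k].
have ray k : ~ ae_eq leb Omega (comb k) (cst 0) ->
    rayleigh Omega a b mu (comb k) <= mu * t + c.
  move=> k0; have tk := comb_test k; have Lk := test_function_L2 oOmega tk.
  rewrite /rayleigh Re_form ler_pdivrMr; last exact: sqnorm_gt0.
  rewrite !wRintegral_comb; try by move=> i; exact: wintegrable_L1loc.
  have -> : \sum_(i < d) fine (sqnorm Omega (weak_partial Omega i (comb k))) =
      \sum_(i < d) fine (sqnorm Omega (cpartial i (comb k))).
    apply: eq_bigr => j _; congr fine; apply: sqnorm_ae => //.
    - have [Lw _] := weak_partialP j (test_function_H1 oOmega tk).
      exact: L2_cmeasurable Lw.
    - by apply: L2_cmeasurable; apply: test_function_L2 => //; exact: test_function_cpartial.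
    - exact: weak_partial_test.
  rewrite sqnorm_comb.
  have h1 : \sum_(i < d) fine (sqnorm Omega (cpartial i (comb k))) <=
      \sum_(i < m) sqmod (k i) * G i.
    apply: (@le_trans _ _ (\sum_(j < d) \sum_(i < m) sqmod (k i) *
        (2 ^+ m * fine (sqnorm Omega (cpartial j (F i)))))).
      by apply: ler_sum => j _; exact: sqnorm_cpartial_comb.
    rewrite exchange_big/=; apply: ler_sum => i _.
    by rewrite /G mulr_sumr.
  have h2 : mu * (\sum_(i < m) sqmod (k i) * \int[leb]_(x in Omega) (a x * sqmod (F i x)))
      <= mu * t * \sum_(i < m) sqmod (k i) * N i.
    rewrite -mulrA; apply: ler_wpM2l; first exact: ltW.
    rewrite mulr_sumr; apply: ler_sum => i _; rewrite mulrCA.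
    by apply: ler_wpM2l; [exact: sqmod_ge0|exact: at_].
  have h3 : \sum_(i < m) sqmod (k i) * G i + \sum_(i < m) sqmod (k i) * B i <=
      c * \sum_(i < m) sqmod (k i) * N i.
    rewrite -big_split mulr_sumr; apply: ler_sum => i _ /=.
    rewrite -mulrDr mulrCA; apply: ler_wpM2l; first exact: sqmod_ge0.
    apply: le_trans (ler_norm _) _.
    by rewrite -ler_pdivrMr.
  rewrite mulrDl; move: h1 h2 h3; rewrite /B /N; lra.
apply: (@le_trans _ _ (ereal_sup [set (rayleigh Omega a b mu psi)%:E |
    psi in [set psi | L psi /\ ~ ae_eq leb Omega psi (cst 0)]])).
  apply: ereal_inf_lbound; exists L => //; split.
  - move=> _ [k ->]; have tk := comb_test k; have Hk := test_function_H1 oOmega tk.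
    split => //; exists (fun=> comb k); split => //.
    have -> : (fun _ : nat => sqnorm_form Omega a b1 b2 mu (fun x => comb k x - comb k x)) = cst 0%E.
      apply/funext => q; rewrite /cst /sqnorm_form sqnorm_H1_subrr// add0e sqnormE.
      under eq_integral do rewrite subrr mulr0 sqmod_real expr0n.
      by rewrite integral0.
    exact: cvg_cst.
  - split.
      by exists (fun=> 0); apply/funext => x; rewrite /comb big1// => i _; rewrite mul0r.
    move=> z _ _ [k ->] [l ->]; exists (fun i => z * k i + l i); apply/funext => x.
    rewrite /comb mulr_sumr -big_split; apply: eq_bigr => i _ /=.
    by rewrite mulrDl mulrA.
  - exists F; split.
    + move=> i; exists (fun j => (j == i)%:R); apply/funext => x.
      rewrite /comb (bigD1 i)//= eqxx mul1r big1 ?addr0// => j /negPf ->.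
      by rewrite mul0r.
    (* Since squared moduli add up without cross terms, [k i <> 0] would force [F i] to vanish
       almost everywhere. *)
    + move=> k k0 i; apply: contrapT => ki; apply: (F0 (i := i)).
      apply: filterS k0 => x + Ox => /(_ Ox) h.
      have := sqmod_comb k x; rewrite /comb h sqmod_real expr0n => /esym/eqP.
      rewrite psumr_eq0 => [|j _]; last by rewrite mulr_ge0// sqmod_ge0.
      move=> /allP/(_ i); rewrite mem_index_enum => /(_ isT).
      rewrite mulf_eq0 => /orP[/eqP/sqmod_eq0//|/eqP/sqmod_eq0 ->//].
    + by move=> _ [k ->]; exists k; exact: aeW.
apply: ub_ereal_sup => _ [psi [[k ->] k0] <-].
by rewrite lee_fin; exact: ray.
Qed.

End finite_family.

(** * Test functions concentrated where a function is negative *)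

Section concentration.
Context {R : realType}.

(** With E the part of the box where h < 0, the integral of h over E is negative, and replacing 1_E
    by phi^2 changes it by less than its absolute value. The square matches the density |phi|^2 of a
    trial function. *)
Lemma negative_bump n (l r : 'I_n -> R) (h : 'rV[R]_n -> R) :
  (@lebesgue_rV R n).-integrable (obox l r) (EFin \o h) ->
  ~ (@lebesgue_rV R n).-negligible (obox l r `&` [set x | h x < 0]) ->
  exists phi, [/\ smooth phi, forall x, ~ obox l r x -> phi x = 0 &
    \int[lebesgue_rV n]_(x in obox l r) (h x * phi x ^+ 2) < 0].
Proof.
set leb := lebesgue_rV n; set U := obox l r; set E := U `&` _ => ih nE.
have mU : measurable U by exact: measurable_obox.
have mh : measurable_fun U h by have /integrableP[/measurable_EFinP] := ih.
have mE : measurable E.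
  rewrite /E (_ : [set x | _] = h @^-1` `]-oo, 0[%classic); first exact: mh.
  by apply/seteqP; split => x /=; rewrite in_itv.
have mI : measurable_fun U (\1_E : 'rV[R]_n -> R) by exact: measurable_indic.
have I1 x : U x -> `|\1_E x : R| <= 1.
  by move=> _; rewrite indicE; case: (_ \in _); rewrite ?normr1// normr0.
have ihE := integrableM_bounded mU ih mI I1.
have nhE : \int[leb]_(x in U) (h x * \1_E x) < 0.
  have hE x : U x -> `|h x * \1_E x| = - (h x * \1_E x).
    move=> Ux; rewrite ler0_norm// indicE; case: (boolP (x \in E)) => [/set_mem[_ h0]|_].
      by rewrite mulr1 ltW.
    by rewrite mulr0.
  have E0 : (\int[leb]_(x in U) `|(h x * \1_E x)%:E| =
      (- \int[leb]_(x in U) (h x * \1_E x))%:E)%E.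
    rewrite (eq_integral (fun x => (-1)%:E * (h x * \1_E x)%:E)%E) => [|x /set_mem Ux].
      rewrite integralZl// mulN1e [RHS]EFinN /Rintegral fineK//; exact: integrable_fin_num.
    by rewrite abse_EFin hE// -EFinM mulN1r.
  have h0 : (0 <= \int[leb]_(x in U) `|(h x * \1_E x)%:E|)%E by exact: integral_ge0.
  rewrite E0 lee_fin oppr_ge0 le_eqVlt in h0; case/orP: h0 => // /eqP e0.
  move: E0; rewrite e0 oppr0 => /(ae_eq_integral_abs leb mU (measurable_int leb ihE)) ae0.
  exfalso; apply: nE; apply: negligibleS ae0 => x Ex /(_ Ex.1).
  case: (Ex) => _ h1 [] /eqP; rewrite indicE mem_set// mulr1 => /eqP h2.
  by move: h1; rewrite /= h2 ltxx.
pose e := - \int[leb]_(x in U) (h x * \1_E x).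
have e0 : 0 < e by rewrite oppr_gt0.
have [phi [sphi phi0 _ lte]] := dense_test ih mE e0.
exists phi; split => //.
have mphi : measurable_fun U phi.
  by apply: measurable_funS (continuous_measurable_rV (smooth_continuous sphi)).
have mD : measurable_fun U (fun x => h x * (phi x ^+ 2 - \1_E x)).
  by apply: measurable_funM => //; apply: measurable_funB => //; exact: measurable_funX.
have normE : (\int[leb]_(x in U) `|(h x * (phi x ^+ 2 - \1_E x))%:E| =
    \int[leb]_(x in U) (`|h x| * `|\1_E x - phi x ^+ 2|)%:E)%E.
  by apply: eq_integral => x _; rewrite abse_EFin normrM distrC.
have iD : leb.-integrable U (EFin \o (fun x => h x * (phi x ^+ 2 - \1_E x))).
  apply/integrableP; split; first exact/measurable_EFinP.
  by rewrite normE; exact: lt_trans lte (ltry e).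
have -> : \int[leb]_(x in U) (h x * phi x ^+ 2) =
    \int[leb]_(x in U) (h x * (phi x ^+ 2 - \1_E x)) + \int[leb]_(x in U) (h x * \1_E x).
  by rewrite -RintegralD//; apply: eq_Rintegral => x _; rewrite /=; ring.
rewrite -ltrBrDr sub0r; apply: le_lt_trans (ler_norm _) _.
apply: le_lt_trans (le_normr_Rintegral mU iD) _.
rewrite -lte_fin -/e; apply: le_lt_trans lte.
rewrite /Rintegral fineK; last by apply: integrable_fin_num => //; have := integrable_norm iD.
by rewrite -normE.
Qed.

End concentration.

(** * Trial functions near density points *)

Section upper_bound.
Context {R : realType} {n : nat}.
Local Notation leb := (@lebesgue_rV R n.+1).

Lemma negligible_seq (s : seq 'rV[R]_n.+1) : leb.-negligible [set` s].
Proof.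
elim: s => [|x s ih].
  by apply: negligibleS (@negligible_set0 _ _ _ leb) => x.
apply: (@negligibleS _ _ _ _ ([set x] `|` [set` s])).
  by move=> y /=; rewrite inE => /orP[/eqP ->|ys]; [left|right].
apply: negligibleU => //; exists [set x]; split => //.
  apply: closed_measurable_rV; apply: accessible_closed_set1.
  by apply: hausdorff_accessible; exact: norm_hausdorff.
exact: lebesgue_rV_set1.
Qed.

Lemma integrable_cst_obox (l r : 'I_n.+1 -> R) k :
  leb.-integrable (obox l r) (EFin \o cst k).
Proof.
apply: measurable_bounded_integrable => //; first exact: measurable_obox.
  have [M lrM] := subset_cbox_box l r.
  apply: le_lt_trans (lebesgue_box_fin n.+1 M).
  by apply: le_measure => //; rewrite inE//; [exact: measurable_obox|exact: measurable_box].
by exists `|k|; split => // y y1 x _; rewrite /= ltW.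
Qed.

(** Otherwise every point of [A] off [s] would have a ball meeting [A] in a null set, and
    [locally_negligible] would make [A] null, the finite list being null itself. *)
Lemma density_point (A : set 'rV[R]_n.+1) (s : seq 'rV[R]_n.+1) :
  ~ leb.-negligible A ->
  exists x, [/\ A x, x \notin s & forall e, 0 < e -> ~ leb.-negligible (A `&` ball x e)].
Proof.
move=> nA; apply: contrapT => h; apply: nA.
apply: (@negligibleS _ _ _ _ ((A `\` [set` s]) `|` [set` s])).
  by move=> x Ax; have [xs|xs] := pselect ([set` s] x); [right|left].
apply: negligibleU; last exact: negligible_seq.
apply: locally_negligible => x [Ax xs].
apply: contrapT => h'; apply: h; exists x; split => //; first exact/negP.
move=> e e0 N; apply: h'; exists e => //.
by apply: negligibleS N => y [[Ay _] By].
Qed.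

Lemma density_points (A : set 'rV[R]_n.+1) (m : nat) : ~ leb.-negligible A ->
  exists2 x : 'I_m -> 'rV[R]_n.+1, injective x &
    forall i, A (x i) /\ forall e, 0 < e -> ~ leb.-negligible (A `&` ball (x i) e).
Proof.
move=> nA.
suff [s [sz us hs]] : exists s : seq 'rV[R]_n.+1, [/\ size s = m, uniq s &
    forall x, x \in s -> A x /\ forall e, 0 < e -> ~ leb.-negligible (A `&` ball x e)].
  exists (fun i => nth 0 s i) => [i j /eqP|i].
    by rewrite nth_uniq ?sz// => /eqP/val_inj.
  by apply: hs; rewrite mem_nth// sz.
elim: m => [|m [s [sz us hs]]]; first by exists [::].
have [x [Ax xs hx]] := density_point s nA.
exists (x :: s); split; rewrite /= ?sz ?xs//.
by move=> y; rewrite inE => /orP[/eqP ->|/hs].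
Qed.

Lemma near_cbox_sub (U : set 'rV[R]_n.+1) x : open U -> U x ->
  \forall e \near 0^'+, cbox (fun i => x ord0 i - e) (fun i => x ord0 i + e) `<=` U.
Proof.
rewrite openE => /(_ x)/[apply]; rewrite /interior -nbhs_ballE => -[e/= e0 eU].
near=> t => y yt; apply: eU; split => // i j; rewrite (ord1 i) /ball/=.
have te : t < e by near: t; exact: nbhs_right_lt.
have /andP[h1 h2] := yt j.
by rewrite ltr_distlC; apply/andP; split; lra.
Unshelve. all: by end_near. Qed.

Lemma near_ball_disjoint (x y : 'rV[R]_n.+1) : x != y ->
  \forall e \near 0^'+, forall z, ~ (ball x e z /\ ball y e z).
Proof.
move=> xy; have [k xyk] : exists k, x ord0 k != y ord0 k.
  apply: contrapT => h; move/eqP: xy; apply; apply/rowP => k.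
  by apply/eqP; apply: contrapT => hk; apply: h; exists k; exact/negP.
have e0 : 0 < `|x ord0 k - y ord0 k| / 2 by rewrite divr_gt0// normr_gt0 subr_eq0.
near=> e => z [[_ /(_ ord0 k) h1] [_ /(_ ord0 k) h2]].
have : e < `|x ord0 k - y ord0 k| / 2 by near: e; exact: nbhs_right_lt.
move: h1 h2; rewrite /ball/= => h1 h2.
have := ler_distD (z ord0 k) (x ord0 k) (y ord0 k); rewrite (distrC (z ord0 k)); lra.
Unshelve. all: by end_near. Qed.

Lemma minmax_le (Omega : set 'rV[R]_n.+1) a b b1 b2 (t : R) m :
  open Omega -> L1loc Omega a -> L1loc Omega b -> (ess_inf_on Omega a < t%:E)%E ->
  exists c : R, forall mu, 0 < mu -> (minmax Omega a b b1 b2 mu m <= (mu * t + c)%:E)%E.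
Proof.
move=> oO ha hb at_.
have [x xI xP] := density_points m (ess_inf_on_lt at_).
pose l e (i : 'I_m) k := x i ord0 k - e; pose r e (i : 'I_m) k := x i ord0 k + e.
(* Finitely many conditions, each valid for all small radii, hold for a common radius. *)
have [e [e0 eO disj]] : exists e, [/\ 0 < e, forall i, cbox (l e i) (r e i) `<=` Omega &
    forall i j, i != j -> forall z, ~ (ball (x i) e z /\ ball (x j) e z)].
  have h1 : \forall e \near 0^'+, forall i, cbox (l e i) (r e i) `<=` Omega.
    by apply: filter_forall => i; apply: near_cbox_sub => //; have [[]] := xP i.
  have h2 : \forall e \near 0^'+, forall i j, i != j ->
      forall z, ~ (ball (x i) e z /\ ball (x j) e z).
    apply: filter_forall => i; apply: filter_forall => j.
    have [->|ij] := eqVneq i j; first exact: nearW.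
    have := @near_ball_disjoint (x i) (x j); rewrite (inj_eq xI) => /(_ ij).
    by apply: filterS => e + _.
  by near (0 : R)^'+ => e; exists e; split; near: e; [exact: nbhs_right_gt| |].
pose U i := obox (l e i) (r e i).
have UE i : U i = ball (x i) e by rewrite ball_obox.
have UO i : U i `<=` Omega by apply: subset_trans (eO i); exact: subset_obox_cbox.
have mU i : measurable (U i) by exact: measurable_obox.
have ic i : leb.-integrable (U i) (EFin \o (fun x => a x - t)).
  have mc := closed_measurable_rV (@closed_cbox R n.+1 (l e i) (r e i)).
  have ia := integrableS mc (mU i) (@subset_obox_cbox _ _ _ _) (ha.2 _ (@compact_cbox _ _ _ _) (eO i)).
  by have := integrableB (mU i) ia (@integrable_cst_obox _ _ t).
have /choice[phi phiP] (i : 'I_m) : exists phi, [/\ smooth phi, forall x, ~ U i x -> phi x = 0 &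
    \int[leb]_(x in U i) ((a x - t) * phi x ^+ 2) < 0].
  apply: negative_bump (ic i) _; have [_ /(_ e e0) ne] := xP i => N; apply: ne.
  apply: negligibleS N => y [[Oy ay] By]; split; first by rewrite -/(U i) UE.
  by rewrite /= subr_lt0.
pose F i : 'rV[R]_n.+1 -> R[i] := fun x => (phi i x)%:C%C.
have tF i : test_function Omega (F i).
  by have [s h _] := phiP i; exact: test_function_real s (eO i) h.
have Fint (u : 'rV[R]_n.+1 -> R) i : \int[leb]_(x in Omega) (u x * sqmod (F i x)) =
    \int[leb]_(x in U i) (u x * phi i x ^+ 2).
  rewrite [LHS]Rintegral_mkcond [RHS]Rintegral_mkcond.
  apply: eq_Rintegral => y _; rewrite !patchE /F sqmod_real.
  have [yU|yU] := boolP (y \in U i).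
    by rewrite ifT// inE; exact: (UO i _ (set_mem yU)).
  have nU : ~ U i y by move=> /mem_set; exact/negP.
  by case: ifP => // _; have [_ /(_ y nU) -> _] := phiP i; rewrite expr0n mulr0.
have lt0 i : \int[leb]_(x in Omega) ((a x - t) * sqmod (F i x)) < 0.
  by rewrite (Fint (fun x => a x - t)); have [] := phiP i.
have mF i : measurable_fun Omega (fun x => sqmod (F i x)).
  have [s _ _] := phiP i; apply: (eq_measurable_fun (fun x => phi i x ^+ 2)).
    by move=> y _; rewrite /F sqmod_real.
  by apply: measurable_funX; apply: measurable_funS
    (continuous_measurable_rV (smooth_continuous s)).
apply: (@minmax_le_of_family _ _ _ oO _ F) => //.
- move=> i j y ij; apply: contrapT => /not_orP[h1 h2].
  apply: (disj i j ij y); rewrite -!UE; split; apply: contrapT => h.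
    by apply: h1; rewrite /F; have [_ /(_ y h) -> _] := phiP i.
  by apply: h2; rewrite /F; have [_ /(_ y h) -> _] := phiP j.
(* The negative integral against |F i|^2 excludes that [F i] vanishes almost everywhere. *)
- move=> i Fi0; have := lt0 i; rewrite /Rintegral (ae_eq_integral (cst 0%E)) ?integral0 ?ltxx//.
  + exact: open_measurable_rV.
  + have [ma _] := ha; apply/measurable_EFinP; apply: measurable_funM; last exact: (mF i).
    by apply: measurable_funB.
  + by apply: filterS Fi0 => y + Oy => /(_ Oy) /= ->; rewrite sqmod_real expr0n mulr0.
- move=> i; have LF := test_function_L2 oO (tF i).
  have := wRintegralD oO (wintegrable_L1loc oO ha (tF i)) (wintegrable_cst oO (- t) LF).
  by rewrite [X in _ + X](wRintegral_cst oO)//; have := lt0 i; lra.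
Unshelve. all: by end_near. Qed.

End upper_bound.

(** One nonzero vector of [L] bounds the supremum from below; for [n > 0] linear independence makes
    the first basis vector such a vector. *)
Lemma minmax_ge {R : realType} {n d : nat} (Omega : set 'rV[R]_d) a b b1 b2 mu (t : R) :
  (0 < n)%N ->
  (forall psi, form_domain Omega a b1 b2 mu psi ->
    ~ ae_eq (lebesgue_rV d) Omega psi (cst 0) -> t <= rayleigh Omega a b mu psi) ->
  (t%:E <= minmax Omega a b b1 b2 mu n)%E.
Proof.
case: n => // n _ t_le; apply: le_ereal_inf_tmp => _ [L [LD _ [e [Le indep _]]] <-].
have e0 : ~ ae_eq (lebesgue_rV d) Omega (e ord0) (cst 0).
  move=> e0; have := indep (fun i => (i == ord0)%:R).
  have h : ae_eq (lebesgue_rV d) Omega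
      (fun x => \sum_(i < n.+1) (i == ord0)%:R * e i x) (cst 0).
    apply: filterS e0 => x + Ox => /(_ Ox) ex.
    rewrite (bigD1 ord0)//= mul1r big1 ?addr0// => i /negPf ->.
    by rewrite mul0r.
  by move=> /(_ h ord0)/eqP; rewrite eqxx oner_eq0.
apply: (@le_trans _ _ (rayleigh Omega a b mu (e ord0))%:E).
  by rewrite lee_fin; apply: t_le => //; exact: LD.
by apply: ereal_sup_ubound; exists (e ord0).
Qed.

Theorem theorem4 (R : realType) (d : nat) (hd : (1 <= d)%N)
    (Omega : set 'rV[R]_d) (Omega0 : Omega !=set0)
    (oOmega : open Omega) (cOmega : connected Omega)
    (a b b1 b2 : 'rV[R]_d -> R)
    (ha : L1loc Omega a) (hb : L1loc Omega b)
    (ha_min : (-oo < ess_inf_on Omega a)%E)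
    (hb12 : ae_eq (@lebesgue_rV R d) Omega b (fun x => b1 x + b2 x))
    (hb1 : L1loc Omega b1) (hb1_min : (-oo < ess_inf_on Omega b1)%E)
    (p : \bar R) (hp : (d%:R%:E <= p)%E) (hb2 : Lp Omega p b2)
    (n : nat) (hn : (1 <= n)%N) :
  (minmax Omega a b b1 b2 mu n / mu%:E)%E @[mu --> +oo] --> ess_inf_on Omega a.
Proof.
case: d hd Omega Omega0 oOmega cOmega a b b1 b2 ha hb ha_min hb12 hb1 hb1_min hp hb2 => // d _.
move=> Omega Omega0 oOmega _ a b b1 b2 ha hb ha_min hb12 hb1 hb1_min hp hb2.
have [c lower] := rayleigh_ge oOmega Omega0 ha hb hb1 ha_min hb12 hb1_min hp hb2.
set A := ess_inf_on Omega a in ha_min lower *; pose am := fine A.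
have AE : A = am%:E.
  by rewrite /am fineK// fin_numE -ltNye ha_min -ltey ess_inf_on_lty.
(* [am + e] exceeds the essential infimum, as [minmax_le] requires. The constant [c'] depends on [e]
   but not on [mu]. *)
have upper e : 0 < e -> exists c' : R, forall mu, 0 < mu ->
    (minmax Omega a b b1 b2 mu n <= (mu * (am + e) + c')%:E)%E.
  by move=> e0; apply: minmax_le => //; rewrite -/A AE lte_fin ltrDl.
have lowerm mu : 0 < mu -> ((mu * am - c)%:E <= minmax Omega a b b1 b2 mu n)%E.
  by move=> mu0; apply: minmax_ge => // psi; exact: lower.
(* Any fixed [e] would do: together with the lower bound this only shows that the min-max values are
   finite. *)
have [c1 upper1] := upper 1 ltr01.
have mE mu : 0 < mu ->
    minmax Omega a b b1 b2 mu n = (fine (minmax Omega a b b1 b2 mu n))%:E.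
  move=> mu0; rewrite fineK//; apply/fin_real/andP; split.
    by apply: lt_le_trans (lowerm _ mu0); rewrite ltNyr.
  by apply: le_lt_trans (upper1 _ mu0) _; rewrite ltry.
rewrite AE; apply/fine_cvgP; split.
  by near=> mu; rewrite mE// inver gt_eqF.
apply/cvgrPdist_le => e e0; have [c' upper'] := upper _ (divr_gt0 e0 (ltr0n R 2)).
near=> mu.
have mu0 : 0 < mu by near: mu; exact: nbhs_pinfty_gt.
have h1 : c <= e * mu by rewrite mulrC -ler_pdivrMr//; near: mu; exact: nbhs_pinfty_ge.
(* Half of [e] is the excess of [t] over [am], the other half pays for [c' / mu]. *)
have h2 : c' <= e / 2 * mu.
  by rewrite mulrC -ler_pdivrMr ?divr_gt0//; near: mu; exact: nbhs_pinfty_ge.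
have := upper' _ mu0; have := lowerm _ mu0; rewrite (mE _ mu0) !lee_fin => h3 h4.
rewrite /= (mE _ mu0) inver gt_eqF// -EFinM /= ler_distlC.
by rewrite ler_pdivlMr// ler_pdivrMr//; apply/andP; split; nra.
Unshelve. all: by end_near. Qed.
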